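(* Let $\{Y_{ni}(t),t\in\mathbb R\}$, $1\le i\le n$, $n\ge1$, be independent Gaussian processes with mean zero, unit variance function and correlation function $\rho_n(s,t)$, $s,t\in\mathbb R$. Let $\{S_{ni}(t),t\in\mathbb R\}$, $1\le i\le n$, $n\ge1$, be independent copies of a stochastic process $\{S(t),t\in\mathbb R\}$, independent of the Gaussian processes. Define $X_{ni}(t)=S_{ni}(t)Y_{ni}(t)$, $t\in\mathbb R$, and suppose that $S(t)>\kappa$, $t\in\mathbb R$, almost surely for some positive constant $\kappa$. If $a_n=n/\sqrt{2\pi}$ and $$\lim_{n\to\infty}2a_n^2\bigl(1-\rho_n(t_1,t_2)\bigr)=\Gamma(t_1,t_2)\in(0,\infty),\qquad t_1\ne t_2\in\mathbb R,$$ then as $n\to\infty$ $$\min_{1\le i\le n}a_n|X_{ni}(t)|\Longrightarrow\min_{i\ge1}S_i(t)\,|\Upsilon_i+Z_i(t)|=\zeta_{\Gamma,S}(t),\qquad t\in\mathbb R,$$ where $\Upsilon_i$, $i\ge1$, are the points of a Poisson point process on $\mathbb R$ with intensity measure equal to the Lebesgue measure, $\{S_i(t),t\in\mathbb R\}$, $i\ge1$, are independent copies of $\{S(t),t\in\mathbb R\}$, $\{Z_i(t),t\in\mathbb R\}$, $i\ge1$, are independent, identically distributed mean-zero Gaussian processes with incremental variance function $\Gamma$, and the point process, the processes $S_i$ and the processes $Z_i$ are mutually independent.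
   Context: $\Longrightarrow$ denotes weak convergence of the finite-dimensional distributions. A mean-zero Gaussian process $\{Z(t),t\in\mathbb R\}$ has incremental variance function $\Gamma$ if $\operatorname{Var}\{Z(t_2)-Z(t_1)\}=\Gamma(t_1,t_2)$ for all $t_1,t_2\in\mathbb R$ (with $\Gamma(t,t)=0$). *)

(* Defs.v *)
From HB Require Import structures.
From mathcomp Require Import all_boot all_order all_algebra.
From mathcomp Require Import finmap.
From mathcomp Require Import all_classical all_reals all_analysis.
From mathcomp Require Import measurable_realfun.

Set Implicit Arguments.
Unset Strict Implicit.
Unset Printing Implicit Defensive.

Import Order.TTheory GRing.Theory Num.Theory.
Import numFieldNormedType.Exports.

Local Open Scope classical_set_scope.
Local Open Scope ring_scope.

Section independence.
Context {d : measure_display} {Omega : measurableType d} {R : realType}.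
Variable P : probability Omega R.

Definition sigma_join (I : Type) (D : set I) (F : I -> set (set Omega)) :
    set (set Omega) :=
  <<s \bigcup_(i in D) F i >>.

Definition sigma_process (T : Type) d' (V : measurableType d')
    (X : T -> Omega -> V) : set (set Omega) :=
  sigma_join [set: T] (fun t => preimage_set_system [set: Omega] (X t) measurable).

(* The family is indexed by D, so that F is unconstrained outside D. *)
Definition mutually_independent (I : choiceType) (D : set I)
    (F : I -> set (set Omega)) : Prop :=
  forall J : {fset I}, [set` J] `<=` D ->
  forall A : I -> set Omega, (forall i, i \in J -> F i (A i)) ->
    P (\bigcap_(i in [set` J]) A i) = (\prod_(i <- J) P (A i))%E.

End independence.

Section processes.
Context {d : measure_display} {Omega : measurableType d} {R : realType}.
Variable P : probability Omega R.

(* normal_prob is not a Dirac mass when the standard deviation s is 0: the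
   degenerate case is needed here for linear combinations of zero variance. *)
Definition gaussian_law (m s : R) (A : set R) : \bar R :=
  if s == 0 then \d_m A else normal_prob m s A.

Definition gaussian_process (T : Type) (X : T -> {RV P >-> R}) : Prop :=
  forall (k : nat) (t : 'I_k -> T) (c : 'I_k -> R), exists m s : R,
    forall A : set R, measurable A ->
      P ((fun w => \sum_(j < k) c j * X (t j) w) @^-1` A) = gaussian_law m s A.

Definition mean_zero (T : Type) (X : T -> {RV P >-> R}) : Prop :=
  forall t, 'E_P[X t]%E = 0%E.

Definition unit_variance (T : Type) (X : T -> {RV P >-> R}) : Prop :=
  forall t, 'V_P[X t]%E = 1%E.

Definition correlation (X Y : {RV P >-> R}) : R :=
  fine (covariance P X Y) / (Num.sqrt (fine 'V_P[X]%E) * Num.sqrt (fine 'V_P[Y]%E)).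

Definition correlation_function (T : Type) (X : T -> {RV P >-> R})
    (rho : T -> T -> R) : Prop :=
  forall s t, correlation (X s) (X t) = rho s t.

Definition incremental_variance (T : Type) (X : T -> {RV P >-> R})
    (Gamma : T -> T -> R) : Prop :=
  forall t1 t2, 'V_P[(X t2 \- X t1)%R]%E = (Gamma t1 t2)%:E.

Definition point_count (U : nat -> {RV P >-> R}) (B : set R) (w : Omega) :
    \bar R :=
  (\sum_(0 <= i <oo) (\1_B (U i w))%:E)%E.

(* U is any random enumeration of the points, counted with multiplicity. The
   second argument of poisson_prob (here 0) plays no role. *)
Definition poisson_points (mu : {measure set (measurableTypeR R) -> \bar R})
    (U : nat -> {RV P >-> R}) : Prop :=
  [/\ (forall B : set R, measurable B -> (mu B < +oo)%E -> forall k : nat,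
         P [set w | point_count U B w = k%:R%:E]
         = poisson_prob (fine (mu B)) 0 [set k]),
      (forall B : set R, measurable B -> mu B = +oo%E ->
         {ae P, forall w, point_count U B w = +oo%E}) &
      (forall (m : nat) (B : 'I_m -> set R), (forall j, measurable (B j)) ->
         trivIset [set: 'I_m] B ->
         mutually_independent P [set: 'I_m] (fun j =>
           preimage_set_system [set: Omega] (point_count U (B j)) measurable))].

End processes.

Section two_spaces.
Context {d1 d2 : measure_display} {O1 : measurableType d1}
  {O2 : measurableType d2} {R : realType}.
Variables (P1 : probability O1 R) (P2 : probability O2 R).

Definition same_law (T : Type) (X1 : T -> {RV P1 >-> R})
    (X2 : T -> {RV P2 >-> R}) : Prop :=
  forall (k : nat) (t : 'I_k -> T) (B : set (k.-tuple R)), measurable B ->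
    P1 [set w | B [tuple X1 (t j) w | j < k]]
    = P2 [set w | B [tuple X2 (t j) w | j < k]].

Definition fdd_cvg (T : Type) (X : nat -> T -> O1 -> R) (X' : T -> O2 -> R) :
    Prop :=
  forall (k : nat) (t : 'I_k -> T) (f : 'rV[R]_k -> R),
    continuous f -> (exists M : R, forall x, `|f x| <= M) ->
    ('E_P1[fun w => f (\row_(j < k) X n (t j) w)])%E @[n --> \oo]
      --> ('E_P2[fun w => f (\row_(j < k) X' (t j) w)])%E.

End two_spaces.

Section statement.
Context {R : realType}.

Definition norming (n : nat) : R := n%:R / Num.sqrt (2 * pi).

(* The index (n, i) with i < n stands for the i+1-st entry of row n. *)
Definition triangle : set (nat * nat) := [set ni | (ni.2 < ni.1)%N].

(* The initial value v 0 is itself an entry of the row whenever 0 < n, so this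
   is the minimum of v over i < n; only n = 0 is junk. *)
Definition row_min (v : nat -> R) (n : nat) : R :=
  \big[Num.min/v 0%N]_(i < n) v i.

Definition array_min {d : measure_display} {Omega : measurableType d}
    (X : nat -> nat -> R -> Omega -> R) (n : nat) (t : R) (w : Omega) : R :=
  row_min (fun i => norming n * `|X n i t w|) n.

Definition zeta_term {d : measure_display} {Omega : measurableType d}
    (U : nat -> Omega -> R) (S Z : nat -> R -> Omega -> R)
    (t : R) (w : Omega) (i : nat) : R :=
  S i t w * `|U i w + Z i t w|.

(* An almost sure minimum under the hypotheses of the theorem; inf makes it a
   total function. *)
Definition zeta {d : measure_display} {Omega : measurableType d}
    (U : nat -> Omega -> R) (S Z : nat -> R -> Omega -> R)
    (t : R) (w : Omega) : R :=
  inf (range (zeta_term U S Z t w)).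

End statement.

(* Main.v *)
Require Import Defs.
From HB Require Import structures.
From mathcomp Require Import all_boot all_order all_algebra.
From mathcomp Require Import finmap.
From mathcomp Require Import all_classical all_reals all_analysis.
From mathcomp Require Import measurable_realfun.
From mathcomp Require Import ring lra.

Set Implicit Arguments.
Unset Strict Implicit.
Unset Printing Implicit Defensive.

Import Order.TTheory GRing.Theory Num.Theory.
Import numFieldNormedType.Exports.

Local Open Scope classical_set_scope.
Local Open Scope ring_scope.

(** For times [t_j] and levels [x_j], the probability that [min_i a_n |X_ni (t_j)| > x_j] for all
    [j] is a product over the row, so it converges to [exp (- L)] as soon as the intensity
    [n P (a_n S |Y_n (t_j)| <= x_j for some j)] converges to
    [L = \int P (S |u + Z (t_j)| <= x_j for some j) du].

    For this convergence, [n P] is tested against a Gaussian density in one coordinate of [a_n Y_n]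
    times a wave [cos (\sum_i c_i a_n Y_n (t_i) + b)]: the integral is explicit, and it depends on
    [a_n Y_n] only through the increment variances and terms of order [a_n ^- 2].  Mollification
    replaces the Gaussian density by a window [1_{|y| <= r}], one coordinate after the other; the
    error is controlled because [n P] gives each coordinate a law below Lebesgue measure.

    For the limit process, conditioning on the Poisson points leaves the Laplace functional
    [E \prod_i (1 - h (U_i)) = exp (- \int h)], and [\int h = L].  The minimum is attained because
    the mean number of terms below a level is at most [\int h], which is finite.  Convergence of all
    joint survival probabilities gives that of boxes, hence of a grid approximation of any bounded
    continuous test function. *)

(** The measures [n P] have total mass [n], and their limit, the law of [(u + Z (t_j))_j] under
    Lebesgue measure in [u], is infinite. Hence there is no limiting characteristic function and no
    continuity theorem to quote: a wave is integrable against the limit only after a Gaussian or a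
    window has localized one coordinate. This is why [1 - \prod_j (1 - window)] is split into terms
    that each retain one window. The constant in [a_n] is dictated by the density of [a_n Y], whose
    maximum is [1 / n]: it gives the bound by Lebesgue measure at every [n] and the weight 1 in the
    limit. [Gamma] determines only the increments of [Z], whose own variance is free; translation
    invariance of Lebesgue measure removes that freedom, since [u] can absorb the value of [Z] at
    one time. The lower bound [kappa] keeps the random levels [x_j / S] bounded, as dominated
    convergence over [S] requires. On the limit side the points come in an arbitrary enumeration, so
    no single point has a known law; only sums and products over the points are accessible. *)

Section real_integrals.
Context d (T : measurableType d) (R : realType).
Implicit Types (mu : {measure set T -> \bar R}) (f g : T -> R).

Lemma integrable_le mu f g : measurable_fun setT f ->
  (forall x, `|f x| <= g x) -> mu.-integrable setT (EFin \o g) ->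
  mu.-integrable setT (EFin \o f).
Proof.
move=> mf fg; apply: le_integrable => //; first exact/measurable_EFinP.
by move=> x _; rewrite lee_fin (le_trans (fg _))// ler_norm.
Qed.

Lemma Rdominated_cvg mu (f_ : nat -> T -> R) f g :
  (forall n, measurable_fun setT (f_ n)) ->
  (forall x, f_ n x @[n --> \oo] --> f x) ->
  mu.-integrable setT (EFin \o g) ->
  (forall n x, `|f_ n x| <= g x) ->
  \int[mu]_x f_ n x @[n --> \oo] --> \int[mu]_x f x.
Proof.
move=> mf cf ig fg.
have mf0 : measurable_fun setT f by apply: (measurable_fun_cvg mf) => x _.
have fg0 x : `|f x| <= g x.
  apply: (ler_cvg_to (cvg_norm (cf x)) (cvg_cst (g x))).
  exact: nearW.
have if0 : mu.-integrable setT (EFin \o f) by exact: integrable_le fg0 ig.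
apply: fine_cvg; rewrite fineK; last exact: integrable_fin_num.
apply: (@dominated_cvg _ _ _ _ _ _ _ _ (EFin \o g)) => //.
- by move=> n; exact/measurable_EFinP.
- by move=> x _; apply: cvg_EFin; [exact: nearW|exact: cf].
- by move=> n x _; rewrite lee_fin.
Qed.

Lemma eq_RintegralT mu f g : (forall x, f x = g x) ->
  \int[mu]_x f x = \int[mu]_x g x.
Proof. by move=> fg; apply: eq_Rintegral => x _. Qed.

Lemma EFin_Rintegral mu f : mu.-integrable setT (EFin \o f) ->
  (\int[mu]_x f x)%:E = (\int[mu]_x (f x)%:E)%E.
Proof. by move=> fi; rewrite fineK//; exact: integrable_fin_num. Qed.

End real_integrals.

(** Inner integrals are finite only almost everywhere, and [fine] changes their value elsewhere;
    hence the passage to the extended integrals by [ae_eq_integral] on both sides. *)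
Lemma RFubini d1 d2 (T1 : measurableType d1) (T2 : measurableType d2)
    (R : realType) (m1 : {sigma_finite_measure set T1 -> \bar R})
    (m2 : {sigma_finite_measure set T2 -> \bar R}) (f : T1 * T2 -> R) :
  (m1 \x m2)%E.-integrable setT (EFin \o f) ->
  \int[m1]_x \int[m2]_y f (x, y) = \int[m2]_y \int[m1]_x f (x, y).
Proof.
move=> fi; rewrite /Rintegral.
have e1 : (\int[m1]_x (fine (\int[m2]_y (f (x, y))%:E))%:E)%E =
          (\int[m1]_x \int[m2]_y (f (x, y))%:E)%E.
  apply: ae_eq_integral => //.
  - apply/measurable_EFinP; apply: (@measurableT_comp _ _ _ _ _ _ fine) => //.
    exact: (measurable_fubini_F fi).
  - exact: (measurable_fubini_F fi).
  - have := ae_integrable1 fi; apply: filterS => x fx _.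
    by rewrite fineK//; exact: (integrable_fin_num _ fx).
have e2 : (\int[m2]_y (fine (\int[m1]_x (f (x, y))%:E))%:E)%E =
          (\int[m2]_y \int[m1]_x (f (x, y))%:E)%E.
  apply: ae_eq_integral => //.
  - apply/measurable_EFinP; apply: (@measurableT_comp _ _ _ _ _ _ fine) => //.
    exact: (measurable_fubini_G fi).
  - exact: (measurable_fubini_G fi).
  - have := ae_integrable2 fi; apply: filterS => x fx _.
    by rewrite fineK//; exact: (integrable_fin_num _ fx).
by rewrite e1 e2; congr fine; exact: (Fubini fi).
Qed.

Section whole_line.
Context (R : realType).
Local Notation leb := (@lebesgue_measure R).

(** Integration by parts on the whole line without boundary terms: the fundamental theorem on
    growing intervals, then dominated convergence. All the normal moments and the normal
    characteristic function below are instances with a suitable primitive [F]. *)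
Lemma Rintegral_derivative0 (F f : R -> R) :
  (forall x : R, is_derive x 1 F (f x)) -> continuous f ->
  leb.-integrable setT (EFin \o f) ->
  F n%:R @[n --> \oo] --> 0 -> F (- n%:R) @[n --> \oo] --> 0 ->
  \int[leb]_x f x = 0.
Proof.
move=> dF cf fi Fy FNy.
have cF x : {for x, continuous F}.
  by apply: differentiable_continuous; apply/derivable1_diffP; apply: ex_derive.
have dFx x : derivable F x 1 by apply: ex_derive.
(* [n.+1] instead of [n] keeps the interval nondegenerate. *)
have itv n : \int[leb]_x (f \_ `[- n.+1%:R, n.+1%:R]) x =
    F n.+1%:R - F (- n.+1%:R).
  rewrite -Rintegral_mkcond /Rintegral (@continuous_FTC2 _ f F)//.
  - by rewrite (@lt_trans _ _ 0)// ?oppr_lt0 ?ltr0n.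
  - exact: continuous_subspaceT.
  - split => //.
    + by apply: cvg_at_right_filter; exact: cF.
    + by apply: cvg_at_left_filter; exact: cF.
  - by move=> x _; rewrite derive1E; exact: derive_val.
have l1 : \int[leb]_x (f \_ `[- n.+1%:R, n.+1%:R]) x @[n --> \oo] -->
    \int[leb]_x f x.
  apply: (@Rdominated_cvg _ _ _ leb
    (fun n => f \_ `[- n.+1%:R, n.+1%:R]) f (fun x => `|f x|)).
  - move=> n; have mI : measurable (`[- n.+1%:R, n.+1%:R]%classic : set R) by [].
    apply/(measurable_restrictT _ mI).
    by apply: measurable_funTS; exact: continuous_measurable_fun.
  - move=> x; apply: cvg_near_cst.
    near=> n; rewrite patchE ifT// inE/= in_itv/= -ler_norml.
    by rewrite (@le_trans _ _ n%:R)// ?ler_nat//; near: n; exact: nbhs_infty_ger.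
  - exact: integrable_abse fi.
  - by move=> n x; rewrite patchE; case: ifPn => //; rewrite normr0.
have l2 : F n.+1%:R - F (- n.+1%:R) @[n --> \oo] --> (0:R).
  rewrite -[X in _ --> X]subr0; apply: cvgB.
  - by rewrite (cvg_shiftS (fun n => F n%:R)).
  - by rewrite (cvg_shiftS (fun n => F (- n%:R))).
move: l1; under eq_fun do rewrite itv; move=> l1.
exact: (cvg_unique _ l1 l2).
Unshelve. all: by end_near. Qed.

End whole_line.

(** * Gaussian laws and their characteristic functions *)

Section normal_characteristic.
Context (R : realType) (m s : R).
Hypothesis s0 : s != 0.
Local Notation leb := (@lebesgue_measure R).
Local Notation p := (normal_pdf m s).

Let ss : 0 < s ^+ 2. Proof. by rewrite exprn_even_gt0. Qed.

(* a Gaussian density with twice the standard deviation dominates [p] times polynomials of degree 2 *)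
Let dom (x : R) : R := (1 + 8 * s ^+ 2) * normal_peak s * normal_fun m (2 * s) x.

Let pE x : p x = normal_peak s * normal_fun m s x.
Proof. by rewrite normal_pdfE. Qed.

Let dom_ge0 x : 0 <= dom x.
Proof.
rewrite /dom !mulr_ge0 ?normal_peak_ge0 ?normal_fun_ge0//.
by rewrite addr_ge0// mulr_ge0// ltW.
Qed.

Let dom_integrable : leb.-integrable setT (EFin \o dom).
Proof.
have s2 : 2 * s != 0 by rewrite mulf_neq0 ?pnatr_eq0.
have -> : EFin \o dom = fun x => (((1 + 8 * s ^+ 2) * normal_peak s /
   normal_peak (2 * s))%:E * (normal_pdf m (2 * s) x)%:E)%E.
  apply/funext => x; rewrite /= -EFinM normal_pdfE// mulrA divfK//.
  by rewrite gt_eqF// normal_peak_gt0.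
by apply: integrableZl => //; exact: integrable_normal_pdf.
Qed.

(** With [z = (x - m)^2 / (8 s^2)] the two Gaussians differ by the factor [exp (3 z)], which is at
    least [1 + z], while [(1 + 8 s^2) (1 + z)] is at least [1 + 8 s^2 z = 1 + (x - m)^2]. This is
    the origin of the constant in [dom]. *)
Let dom_bound x : (1 + (x - m) ^+ 2) * p x <= dom x.
Proof.
rewrite pE /dom mulrCA -!mulrA [leRHS]mulrCA ler_pM2l ?normal_peak_gt0//.
have -> : normal_fun m (2 * s) x =
   expR ((x - m) ^+ 2 / (8 * s ^+ 2) * 3) * normal_fun m s x.
  by rewrite /normal_fun -expRD; congr expR; field.
rewrite mulrA ler_pM2r ?expR_gt0//.
set y := (x - m) ^+ 2; have y0 : 0 <= y by rewrite sqr_ge0.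
have := expR_ge1Dx (y / (8 * s ^+ 2) * 3).
set e := expR _; set z := y / (8 * s ^+ 2) => ez.
have -> : y = 8 * s ^+ 2 * z by rewrite /z; field.
have z0 : 0 <= z by rewrite divr_ge0// mulr_ge0// ltW.
have : 1 + z <= e by lra.
move=> ze; apply: (@le_trans _ _ ((1 + 8 * s ^+ 2) * (1 + z))); last first.
  by rewrite ler_pM2l// ltr_pwDl// mulr_ge0// ltW.
by have := ltW ss; nra.
Qed.

Let p_ge0 x : 0 <= p x. Proof. exact: normal_pdf_ge0. Qed.

Let le_dom (f x K : R) : `|f| <= K * (1 + (x - m) ^+ 2) -> `|f * p x| <= K * dom x.
Proof.
move=> f1; have K0 : 0 <= K.
  have := le_trans (normr_ge0 f) f1; rewrite pmulr_lge0//.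
  by rewrite ltr_pwDl// sqr_ge0.
apply: le_trans (ler_wpM2l K0 (dom_bound x)); rewrite normrM (ger0_norm (p_ge0 _)).
by rewrite mulrA ler_wpM2r.
Qed.

Let cvg_dom (u : nat -> R) : (forall n, n%:R <= `|u n|) ->
  dom (u n) @[n --> \oo] --> (0:R).
Proof.
move=> un; rewrite /dom /normal_fun -[X in _ --> X](mulr0 ((1 + 8 * s ^+ 2) * normal_peak s)).
apply: cvgM; first exact: cvg_cst.
have : (u n - m) ^+ 2 / ((2 * s) ^+ 2 *+ 2) @[n --> \oo] --> +oo.
  apply/cvgryPge => A; near=> n.
  have nA : `|m| + 1 + (2 * s) ^+ 2 *+ 2 * `|A| <= n%:R.
    by near: n; exact: nbhs_infty_ger.
  rewrite ler_pdivlMr; last by rewrite exprMn mulrn_wgt0// mulr_gt0// exprn_gt0.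
  have h1 : n%:R - `|m| <= `|u n - m|.
    by rewrite (le_trans _ (lerB_dist _ _))// lerB.
  have c0 : 0 <= (2 * s) ^+ 2 *+ 2 by rewrite mulrn_wge0// sqr_ge0.
  have A0 := normr_ge0 A.
  have h2 : 1 <= `|u n - m|.
    by apply: le_trans h1; rewrite lerBrDl; nra.
  rewrite -[leRHS]ger0_norm ?sqr_ge0// normrX.
  have h3 : A * ((2 * s) ^+ 2 *+ 2) <= `|u n - m|.
    have : A <= `|A| by rewrite ler_norm.
    by move=> AA; nra.
  by apply: le_trans h3 _; nra.
move=> h; have := cvg_comp _ _ h (@cvgr_expR R).
by apply: cvg_trans; apply: near_eq_cvg; apply: nearW => n; rewrite /= mulNr.
Unshelve. all: by end_near. Qed.

Let dp (x : R) : is_derive x 1 (p : R -> R) (- ((x - m) / s ^+ 2) * p x).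
Proof.
rewrite normal_pdfE//.
have -> : (fun x => normal_peak s * normal_fun m s x) =
   (fun x => normal_peak s * expR (- (s ^+ 2 *+ 2)^-1 * (x - m) ^+ 2)).
  by apply/funext => y; rewrite /normal_fun; congr (_ * expR _); field.
apply: is_derive_eq.
have -> : normal_fun m s x = expR (- (s ^+ 2 *+ 2)^-1 * (x - m) ^+ 2).
  by rewrite /normal_fun; congr (expR _); field.
by rewrite /GRing.scale/=; field.
Qed.

Let integrable_poly (f : R -> R) (K : R) : continuous f ->
  (forall x, `|f x| <= K * (1 + (x - m) ^+ 2)) ->
  leb.-integrable setT (EFin \o (fun x => f x * p x)).
Proof.
move=> cf fb; apply: (@integrable_le _ _ _ leb _ (fun x => K * dom x)).
- apply: measurable_funM; first exact: continuous_measurable_fun.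
  exact: measurable_normal_pdf.
- by move=> x; exact: le_dom.
- rewrite (_ : _ \o _ = fun x => (K%:E * (dom x)%:E)%E)//.
  exact: integrableZl.
Qed.

Let derive_integral0 (F f : R -> R) (K : R) :
  (forall x : R, is_derive x 1 F (f x * p x)) -> continuous f ->
  (forall x, `|f x| <= K * (1 + (x - m) ^+ 2)) ->
  (forall x, `|F x| <= K * dom x) ->
  \int[leb]_x (f x * p x) = 0.
Proof.
move=> dF cf fb Fb.
have cp : continuous p by exact: continuous_normal_pdf.
have cfp : continuous (fun x => f x * p x).
  by move=> x; apply: cvgM; [exact: cf|exact: cp].
have Fu (u : nat -> R) : (forall n, n%:R <= `|u n|) -> F (u n) @[n --> \oo] --> 0.
  move=> un; apply: norm_cvg0; apply: (@squeeze_cvgr _ _ _ _ (fun=> 0)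
    (fun n => K * dom (u n))).
  - by apply: nearW => n; rewrite normr_ge0 Fb.
  - exact: cvg_cst.
  - rewrite -[X in _ --> X](mulr0 K); apply: cvgM; first exact: cvg_cst.
    exact: cvg_dom.
apply: (Rintegral_derivative0 dF) => //.
- exact: integrable_poly fb.
- by apply: Fu => n; rewrite normr_nat.
- by apply: Fu => n; rewrite normrN normr_nat.
Qed.

Let center_le (x : R) : `|x - m| <= 1 + (x - m) ^+ 2.
Proof.
rewrite -[(x - m) ^+ 2]ger0_norm ?sqr_ge0// normrX.
by have := normr_ge0 (x - m); nra.
Qed.

Let continuous_center : continuous (fun x : R => x - m).
Proof. by move=> x; apply: cvgB; [exact: cvg_id|exact: cvg_cst]. Qed.

Lemma integrable_normal_center :
  leb.-integrable setT (EFin \o (fun x => (x - m) * p x)).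
Proof. by apply: (@integrable_poly _ 1) => // x; rewrite mul1r. Qed.

Lemma integrable_normal_center2 :
  leb.-integrable setT (EFin \o (fun x => (x - m) ^+ 2 * p x)).
Proof.
apply: (@integrable_poly _ 1) => [x|x]; last by rewrite mul1r ger0_norm ?sqr_ge0// lerDr.
by apply: cvgM; exact: continuous_center.
Qed.

Lemma integrable_normal_cst (f : R -> R) (K : R) : continuous f ->
  (forall x, `|f x| <= K) ->
  leb.-integrable setT (EFin \o (fun x => f x * p x)).
Proof.
move=> cf f1; apply: (@integrable_poly _ K) => // x; rewrite (le_trans (f1 x))//.
by rewrite ler_peMr ?lerDl ?sqr_ge0// (le_trans _ (f1 x)).
Qed.

Lemma Rintegral_normal_pdf : \int[leb]_x p x = 1.
Proof. by rewrite /Rintegral integral_normal_pdf. Qed.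

Lemma normal_mean0 : \int[leb]_x ((x - m) * p x) = 0.
Proof.
apply: (@derive_integral0 (fun x => - s ^+ 2 * p x) _ (1 + s ^+ 2)) => //.
- move=> x; have := dp x => dpx; apply: is_derive_eq.
  by rewrite /GRing.scale/=; field.
- move=> x; apply: le_trans (center_le x) _.
  by rewrite ler_peMl ?addr_ge0 ?sqr_ge0// lerDl sqr_ge0.
- move=> x; apply: le_dom; rewrite normrN ger0_norm ?sqr_ge0//.
  by have := sqr_ge0 (x - m); have := ss; nra.
Qed.

(** The derivative of [(x - m) p] is [(1 - (x - m)^2 / s^2) p], whose integral vanishes. *)
Lemma normal_variance : \int[leb]_x ((x - m) ^+ 2 * p x) = s ^+ 2.
Proof.
have := @derive_integral0 (fun x => (x - m) * p x)
  (fun x => 1 - (s ^+ 2)^-1 * (x - m) ^+ 2) (1 + (s ^+ 2)^-1).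
have cc : continuous (fun x : R => 1 - (s ^+ 2)^-1 * (x - m) ^+ 2).
  move=> x; apply: cvgB; first exact: cvg_cst.
  by apply: cvgM; [exact: cvg_cst|apply: cvgM; exact: continuous_center].
have si : 0 < (s ^+ 2)^-1 by rewrite invr_gt0.
move=> /(_ _ cc) h.
have {h} : \int[leb]_x ((1 - (s ^+ 2)^-1 * (x - m) ^+ 2) * p x) = 0.
  apply: h.
  - move=> x; have := dp x => dpx; apply: is_derive_eq.
    by rewrite /GRing.scale/=; field.
  - move=> x; have := sqr_ge0 (x - m) => x0; rewrite ler_norml.
    by apply/andP; split; nra.
  - move=> x; apply: le_dom; apply: le_trans (center_le x) _.
    by rewrite ler_peMl ?addr_ge0 ?sqr_ge0// lerDl ltW.
under eq_RintegralT => x do rewrite mulrBl mul1r -mulrA.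
rewrite RintegralB//; [|exact: integrable_normal_pdf|]; last first.
  rewrite (_ : _ \o _ = fun x => (((s ^+ 2)^-1)%:E * ((x - m) ^+ 2 * p x)%:E)%E)//.
  by apply: integrableZl => //; exact: integrable_normal_center2.
rewrite RintegralZl//; last exact: integrable_normal_center2.
rewrite Rintegral_normal_pdf => /eqP; rewrite subr_eq0 => /eqP/esym h.
by rewrite -[LHS](mulVKf (lt0r_neq0 ss)) h mulr1.
Qed.

(** The characteristic function in real terms: the free phase [b] replaces the complex exponential,
    [b = 0] giving the cosine and [b = - pi / 2] the sine. *)
Let I (b a : R) := \int[leb]_x (cos (a * (x - m) + b) * p x).

Let continuous_cos_affine (a b : R) : continuous (fun x : R => cos (a * (x - m) + b)).
Proof.
move=> x; apply: (@continuous_comp _ _ _ (fun x : R => a * (x - m) + b) cos); last exact: continuous_cos.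
apply: cvgD; last exact: cvg_cst.
by apply: cvgM; [exact: cvg_cst|exact: continuous_center].
Qed.

Let continuous_sin_affine (a b : R) : continuous (fun x : R => sin (a * (x - m) + b)).
Proof.
move=> x; apply: (@continuous_comp _ _ _ (fun x : R => a * (x - m) + b) sin); last exact: continuous_sin.
apply: cvgD; last exact: cvg_cst.
by apply: cvgM; [exact: cvg_cst|exact: continuous_center].
Qed.

Let by_parts (a b : R) :
  \int[leb]_x (sin (a * (x - m) + b) * (x - m) * p x) = s ^+ 2 * a * I b a.
Proof.
pose f x := s ^+ 2 * a * cos (a * (x - m) + b) - sin (a * (x - m) + b) * (x - m).
have isin : leb.-integrable setT (EFin \o (fun x => sin (a * (x - m) + b) * (x - m) * p x)).
  apply: (@integrable_poly _ 1) => [x|x].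
    by apply: cvgM; [exact: continuous_sin_affine|exact: continuous_center].
  rewrite mul1r normrM; apply: le_trans (center_le x).
  by rewrite ler_piMl// sin_max.
have icos := integrable_normal_cst (@continuous_cos_affine a b) (fun x => cos_max _).
have : \int[leb]_x (f x * p x) = 0.
  apply: (@derive_integral0 (fun x => s ^+ 2 * (sin (a * (x - m) + b) * p x)) _
    (1 + s ^+ 2 + `|s ^+ 2 * a|)) => //.
  - move=> x; have := dp x => dpx; apply: is_derive_eq.
    by rewrite /f /GRing.scale/=; field.
  - move=> x; apply: cvgB; last first.
      by apply: cvgM; [exact: continuous_sin_affine|exact: continuous_center].
    by apply: cvgM; [exact: cvg_cst|exact: continuous_cos_affine].
  - move=> x; rewrite (le_trans (ler_normB _ _))// !(normrM _ (cos _), normrM (sin _)).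
    have h1 := center_le x; have h2 := sin_max (a * (x - m) + b).
    have h3 := cos_max (a * (x - m) + b); have h4 := sqr_ge0 (x - m).
    have h5 := normr_ge0 (s ^+ 2 * a); have h6 := normr_ge0 (x - m).
    have h7 := normr_ge0 (sin (a * (x - m) + b)).
    have h8 : `|s ^+ 2 * a| * `|cos (a * (x - m) + b)| <= `|s ^+ 2 * a|.
      by rewrite ler_piMr.
    have h9 : `|sin (a * (x - m) + b)| * `|x - m| <= `|x - m| by rewrite ler_piMl.
    apply: (@le_trans _ _ (`|s ^+ 2 * a| + (1 + (x - m) ^+ 2))); first by lra.
    by have := ss; nra.
  - move=> x; rewrite mulrA; apply: le_dom; rewrite normrM (ger0_norm (sqr_ge0 s)).
    have h2 := sin_max (a * (x - m) + b); have h4 := sqr_ge0 (x - m).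
    have h5 := normr_ge0 (s ^+ 2 * a).
    apply: (@le_trans _ _ (s ^+ 2)); first by rewrite ler_piMr// ltW.
    by have := ss; nra.
have -> : \int[leb]_x (f x * p x) = \int[leb]_x (s ^+ 2 * a * (cos (a * (x - m) + b) * p x)
     - sin (a * (x - m) + b) * (x - m) * p x).
  by apply: eq_RintegralT => x; rewrite /f; ring.
rewrite RintegralB//; last first.
  rewrite (_ : _ \o _ = fun x => ((s ^+ 2 * a)%:E * (cos (a * (x - m) + b) * p x)%:E)%E)//.
  exact: integrableZl.
by rewrite RintegralZl// => /eqP; rewrite subr_eq0 => /eqP.
Qed.

(** Differentiation under the integral produces the sine integral, which [by_parts] turns back into
    [I b a]: a linear differential equation in the frequency. *)
Let dI (b a : R) : is_derive a 1 (I b) (- (s ^+ 2 * a * I b a)).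
Proof.
pose f (a x : R) := cos (a * (x - m) + b) * p x.
have df (a' x : R) : is_derive a' 1 (f ^~ x) (- (sin (a' * (x - m) + b) * (x - m) * p x)).
  by apply: is_derive_eq; rewrite /GRing.scale/=; ring.
(* The dominating function [G] chosen below does not involve the frequency, so any neighbourhood of
   [a] would serve. *)
have aI : `]a - 1, a + 1[%classic a by rewrite /= in_itv/=; lra.
have pf a' x : partial1of2 f a' x = - (sin (a' * (x - m) + b) * (x - m) * p x).
  by rewrite partial1of2E; exact: derive_val.
pose G x := 1 * dom x.
have iG : leb.-integrable setT (EFin \o G).
  by rewrite (_ : EFin \o G = EFin \o dom)//; apply/funext => x; rewrite /G/= mul1r.
have fi x : `]a - 1, a + 1[%classic x -> leb.-integrable setT (EFin \o f x).
  by move=> _; exact: (integrable_normal_cst (@continuous_cos_affine x b) (fun x => cos_max _)).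
have fd (x y : R) : `]a - 1, a + 1[%classic x -> setT y -> derivable (f ^~ y) x 1.
  by move=> _ _; apply: ex_derive.
have G0 x : 0 <= G x by rewrite /G mul1r.
have Gb (x y : R) : `]a - 1, a + 1[%classic x -> setT y -> `|partial1of2 f x y| <= G y.
  move=> _ _; rewrite pf normrN; apply: le_dom; rewrite mul1r normrM.
  by rewrite (le_trans _ (center_le y))// ler_piMl// sin_max.
apply: DeriveDef; first exact: (derivable_under_integral measurableT aI fi fd G0 iG Gb).
rewrite -derive1E (differentiation_under_integral measurableT aI fi fd G0 iG Gb).
rewrite -by_parts.
have -> : \int[leb]_x partial1of2 f a x =
    \int[leb]_x (-1 * (sin (a * (x - m) + b) * (x - m) * p x)).
  by apply: eq_RintegralT => x; rewrite pf mulN1r.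
rewrite RintegralZl//; first by rewrite mulN1r.
apply: (@integrable_poly _ 1) => [x|x].
  by apply: cvgM; [exact: continuous_sin_affine|exact: continuous_center].
rewrite mul1r normrM; apply: le_trans (center_le x).
by rewrite ler_piMl// sin_max.
Qed.

(** By [dI], the product of [I b] with the integrating factor [expR (s^2 a^2 / 2)] has derivative
    zero, so it keeps its value [cos b] at [a = 0]. *)
Lemma normal_cos_center (a b : R) :
  \int[leb]_x (cos (a * (x - m) + b) * p x) = cos b * expR (- (s ^+ 2 * a ^+ 2 / 2)).
Proof.
rewrite -/(I b a).
pose h a := I b a * expR (s ^+ 2 / 2 * a ^+ 2).
have dh (x : R) : is_derive x 1 h 0.
  rewrite /h; have := dI b x => dIx; apply: is_derive_eq.
  by rewrite /GRing.scale/=; field.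
have := is_derive_0_is_cst a 0 dh; rewrite {2}/h expr0n/= mulr0 expR0 mulr1 /h => e.
have <- : I b 0 = cos b.
  rewrite /I; under eq_RintegralT => x do rewrite mul0r add0r.
  by rewrite RintegralZl ?Rintegral_normal_pdf ?mulr1//; exact: integrable_normal_pdf.
by rewrite -e -(mulrA (I b a)) -expRD (_ : _ + _ = 0) ?expR0 ?mulr1//; field.
Qed.

Lemma normal_cos (a b : R) :
  \int[leb]_x (cos (a * x + b) * p x) = cos (a * m + b) * expR (- (s ^+ 2 * a ^+ 2 / 2)).
Proof.
rewrite -normal_cos_center; apply: eq_RintegralT => x; congr (cos _ * _); ring.
Qed.

Lemma normal_mean : \int[leb]_x (x * p x) = m.
Proof.
have -> : \int[leb]_x (x * p x) = \int[leb]_x ((x - m) * p x + m * p x).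
  by apply: eq_RintegralT => x; ring.
have im : leb.-integrable setT (EFin \o (fun x : R => m * p x)).
  by apply: (@integrable_normal_cst (fun=> m : R) `|m|) => // x; exact: cvg_cst.
rewrite RintegralD//; last exact: integrable_normal_center.
rewrite normal_mean0 add0r RintegralZl// ?Rintegral_normal_pdf ?mulr1//.
exact: integrable_normal_pdf.
Qed.

End normal_characteristic.

(** * Densities, image laws and second moments *)

Section density.
Context d (T : measurableType d) (R : realType).
Variables (mu nu : {measure set T -> \bar R}) (h : T -> R).
Hypotheses (mh : measurable_fun setT h) (h0 : forall x, 0 <= h x).
Hypothesis nuE : forall A, measurable A -> nu A = (\int[mu]_(x in A) (h x)%:E)%E.
Local Open Scope ereal_scope.
Import HBNNSimple.

Let mhE : measurable_fun setT (EFin \o h). Proof. exact/measurable_EFinP. Qed.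

Let density_nnsfun (f : {nnsfun T >-> R}) :
  \int[nu]_x (f x)%:E = \int[mu]_x ((f x)%:E * (h x)%:E).
Proof.
transitivity (\int[nu]_x (\sum_(y \in range f) (y * \1_(f @^-1` [set y]) x)%:E)).
  by apply: eq_integral => t _; rewrite /= fimfunE -fsumEFin.
rewrite ge0_integral_fsum//; last 2 first.
  - by move=> r; apply/measurable_EFinP; exact: measurable_funM.
  - by move=> m y _; rewrite EFinM; exact: nnfun_muleindic_ge0.
transitivity (\int[mu]_x (\sum_(y \in range f)
    ((y * \1_(f @^-1` [set y]) x)%:E * (h x)%:E))); last first.
  apply: eq_integral => x _.
  rewrite -ge0_mule_fsuml => [|y]; last by rewrite EFinM; exact: nnfun_muleindic_ge0.
  by rewrite fsumEFin // -(fimfunE _ x).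
rewrite ge0_integral_fsum//; last 2 first.
  - move=> y; apply: emeasurable_funM => //.
    by apply/measurable_EFinP; exact: measurable_funM.
  - move=> m y _; rewrite mule_ge0//; last by rewrite lee_fin.
    by rewrite EFinM; exact: nnfun_muleindic_ge0.
apply: eq_fsbigr => r rf.
have r0 : (0 <= r)%R by move: rf => /set_mem[x _ <-].
under eq_integral do rewrite EFinM.
rewrite integralZl_indic_nnsfun// integral_indic// setIT nuE//.
under [RHS]eq_integral do rewrite EFinM -muleA.
rewrite ge0_integralZl//; last 2 first.
- by apply: emeasurable_funM => //; exact/measurable_EFinP.
- by move=> x _; rewrite mule_ge0 ?lee_fin.
congr (_ * _); rewrite [LHS]integral_mkcond; apply: eq_integral => x _.
by rewrite patchE indicE; case: ifPn => _; rewrite ?mul1e ?mul0e.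
Qed.

Lemma ge0_integral_density (f : T -> \bar R) :
  measurable_fun setT f -> (forall x, 0 <= f x) ->
  \int[nu]_x f x = \int[mu]_x (f x * (h x)%:E).
Proof.
move=> mf f0; pose f_ := nnsfun_approx measurableT mf.
have cf x : (f_ n x)%:E @[n --> \oo] --> f x by exact: cvg_nnsfun_approx.
transitivity (limn (fun n => \int[nu]_x (f_ n x)%:E)).
  rewrite -monotone_convergence//=.
  - by apply: eq_integral => x _; apply/esym/cvg_lim.
  - by move=> n; exact/measurable_EFinP.
  - by move=> n x _; rewrite lee_fin.
  - by move=> x _ a b ab; rewrite lee_fin; exact/lefP/nd_nnsfun_approx.
transitivity (limn (fun n => \int[mu]_x ((f_ n x)%:E * (h x)%:E))).
  by apply: congr_lim; apply/funext => n; exact: density_nnsfun.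
rewrite -monotone_convergence//=.
- apply: eq_integral => x _; apply/cvg_lim => //.
  by apply: cvgeZr => //; exact: cf.
- by move=> n; apply: emeasurable_funM => //; exact/measurable_EFinP.
- by move=> n x _; rewrite mule_ge0 ?lee_fin.
- move=> x _ a b ab; rewrite lee_wpmul2r ?lee_fin//.
  exact/lefP/nd_nnsfun_approx.
Qed.

Lemma Rintegral_density (f : T -> R) : measurable_fun setT f ->
  (\int[nu]_x f x = \int[mu]_x (f x * h x))%R.
Proof.
move=> mf; rewrite /Rintegral; congr fine; rewrite [LHS]integralE [RHS]integralE.
have mfE : measurable_fun setT (EFin \o f) by exact/measurable_EFinP.
congr (_ - _).
  rewrite ge0_integral_density//; last exact: measurable_funepos.
  apply: eq_integral => x _; rewrite !funeposE -!EFin_max -EFinM; congr EFin.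
  case: (leP 0%R (f x)) => fx.
    by rewrite !max_l// mulr_ge0.
  by rewrite max_r ?mul0r ?max_r// ?nmulr_rle0// ltW.
rewrite ge0_integral_density//; last exact: measurable_funeneg.
apply: eq_integral => x _; rewrite !funenegE -!EFin_max -EFinM; congr EFin.
case: (leP 0%R (f x)) => fx.
  by rewrite !max_r ?mul0r// oppr_le0// mulr_ge0.
have f1 : (f x * h x <= 0)%R by rewrite nmulr_rle0.
by rewrite !max_l ?mulNr ?oppr_ge0// ltW.
Qed.

End density.

Section image_measure.
Context d (Omega : measurableType d) (R : realType) (P : {measure set Omega -> \bar R}).
Context d' (T : measurableType d') (X : Omega -> T).
Hypothesis mX : measurable_fun setT X.

Let X_ : Omega -> T := X.
HB.instance Definition _ := @isMeasurableFun.Build _ _ _ _ X_ mX.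

Lemma ge0_integral_image (nu : {measure set T -> \bar R}) (f : T -> \bar R) :
  (forall A, measurable A -> P (X @^-1` A) = nu A) ->
  measurable_fun setT f -> (forall x, 0 <= f x)%E ->
  (\int[P]_w f (X w) = \int[nu]_x f x)%E.
Proof.
move=> PX mf f0; transitivity (\int[pushforward P X_]_x f x)%E.
  by rewrite ge0_integral_pushforward.
by apply: eq_measure_integral => A mA _; exact: PX.
Qed.

Lemma ge0_integral_image_le (nu : {measure set T -> \bar R}) (f : T -> \bar R) :
  (forall A, measurable A -> P (X @^-1` A) <= nu A)%E ->
  measurable_fun setT f -> (forall x, 0 <= f x)%E ->
  (\int[P]_w f (X w) <= \int[nu]_x f x)%E.
Proof.
move=> PX mf f0.
rewrite (@ge0_integral_image (pushforward P X_))//.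
exact: ge0_le_measure_integral.
Qed.

Lemma Rintegral_image (nu : {measure set T -> \bar R}) (f : T -> R) :
  (forall A, measurable A -> P (X @^-1` A) = nu A) -> measurable_fun setT f ->
  \int[P]_w f (X w) = \int[nu]_x f x.
Proof.
move=> PX mf; rewrite /Rintegral; congr fine; rewrite [LHS]integralE [RHS]integralE.
have mfE : measurable_fun setT (EFin \o f) by exact/measurable_EFinP.
congr (_ - _)%E.
  rewrite -ge0_integral_image//; last exact: measurable_funepos.
  by apply: eq_integral => w _ /=; rewrite !funeposE.
rewrite -ge0_integral_image//; last exact: measurable_funeneg.
by apply: eq_integral => w _ /=; rewrite !funenegE.
Qed.

Lemma Rintegral_image_density (mu : {measure set T -> \bar R}) (h f : T -> R) :
  (forall A, measurable A -> P (X @^-1` A) = \int[mu]_(x in A) (h x)%:E)%E ->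
  measurable_fun setT h -> (forall x, 0 <= h x) -> measurable_fun setT f ->
  \int[P]_w f (X w) = \int[mu]_x (f x * h x).
Proof.
move=> PX mh h0 mf; rewrite -(Rintegral_density mh h0 (nu := pushforward P X_))//.
exact: Rintegral_image.
Qed.

End image_measure.

Section random_variable_laws.
Context d (Omega : measurableType d) (R : realType) (P : probability Omega R).
Local Notation leb := (@lebesgue_measure R).

Variables (X : Omega -> R) (m s : R).
Hypothesis mX : measurable_fun setT X.
Hypothesis lawX : forall A : set R, measurable A -> P (X @^-1` A) = gaussian_law m s A.

Let gaussian_degenerate (f : R -> R) : s = 0 -> measurable_fun setT f ->
  \int[P]_w f (X w) = f m.
Proof.
move=> s0 mf.
rewrite (Rintegral_image mX (nu := \d_m))// => [|A mA]; last first.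
  by have := lawX mA; rewrite /gaussian_law s0 eqxx.
by rewrite /Rintegral integral_dirac// ?diracT ?mul1e//; exact/measurable_EFinP.
Qed.

Let gaussian_nondegenerate (f : R -> R) : s != 0 -> measurable_fun setT f ->
  \int[P]_w f (X w) = \int[leb]_x (f x * normal_pdf m s x).
Proof.
move=> s0 mf.
have mX' : measurable_fun setT (X : Omega -> measurableTypeR R) := mX.
apply: (Rintegral_image_density mX' (mu := leb) (h := normal_pdf m s)) => //.
- by move=> A mA; have := lawX mA; rewrite /gaussian_law (negbTE s0).
- exact: measurable_normal_pdf.
- by move=> x; exact: normal_pdf_ge0.
Qed.

(** [gaussian_process] provides the parameters [m] and [s] only existentially; these identities
    recover them from the moments, the Dirac case [s = 0] included. Frequency 1 suffices for the
    cosine because [gaussian_process] already ranges over all linear combinations. *)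
Lemma gaussian_moments :
  [/\ \int[P]_w X w = m, \int[P]_w (X w - m) ^+ 2 = s ^+ 2 &
      forall b : R, \int[P]_w cos (X w + b) = cos (m + b) * expR (- (s ^+ 2 / 2))].
Proof.
have mc (b : R) : measurable_fun setT (fun x : R => cos (x + b)).
  apply: measurableT_comp; last exact: measurable_funD.
  by apply: continuous_measurable_fun; exact: continuous_cos.
have mv : measurable_fun setT (fun x : R => (x - m) ^+ 2).
  by apply: measurable_funX; exact: measurable_funB.
have [s0|s0] := eqVneq s 0.
  split; rewrite ?(gaussian_degenerate (f := id))//.
  - by rewrite (gaussian_degenerate (f := fun x => (x - m) ^+ 2))// subrr s0.
  - move=> b; rewrite (gaussian_degenerate (f := fun x => cos (x + b)))//.
    by rewrite s0 expr0n/= mul0r oppr0 expR0 mulr1.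
split.
- by rewrite (gaussian_nondegenerate (f := id))// normal_mean.
- by rewrite (gaussian_nondegenerate (f := fun x => (x - m) ^+ 2))// normal_variance.
- move=> b; rewrite (gaussian_nondegenerate (f := fun x => cos (x + b)))//.
  have := normal_cos m s0 1 b; rewrite mul1r expr1n mulr1 => <-.
  by apply: eq_RintegralT => x; rewrite mul1r.
Qed.

End random_variable_laws.

(** Everything is referred to one coordinate [y o], the products of increments being polarized into
    squared increments. For the scaled array only the term in [y o ^+ 2] diverges, and its
    coefficient is the square of the total weight; differences of squares have mean zero under unit
    variance. The weight [s] on [y o] is later the Fourier variable of a Gaussian density;
    [s = - \sum_i c i] leaves increments only. *)
Lemma square_combination (R : realType) k (c y : 'I_k -> R) (o : 'I_k) (s : R) :
  (s * y o + \sum_i c i * y i) ^+ 2 =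
  (s + \sum_i c i) ^+ 2 * y o ^+ 2 +
  (s + \sum_i c i) * \sum_i c i * (y i ^+ 2 - y o ^+ 2 - (y i - y o) ^+ 2) +
  \sum_i \sum_j c i * c j / 2 *
     ((y i - y o) ^+ 2 + (y j - y o) ^+ 2 - (y i - y j) ^+ 2).
Proof.
pose D := \sum_i c i * (y i - y o).
have -> : \sum_i c i * y i = (\sum_i c i) * y o + D.
  by rewrite mulr_suml -big_split/=; apply: eq_bigr => i _; ring.
have -> : \sum_i c i * (y i ^+ 2 - y o ^+ 2 - (y i - y o) ^+ 2) = 2 * y o * D.
  by rewrite /D mulr_sumr; apply: eq_bigr => i _; ring.
have -> : \sum_i \sum_j c i * c j / 2 *
    ((y i - y o) ^+ 2 + (y j - y o) ^+ 2 - (y i - y j) ^+ 2) = D ^+ 2.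
  rewrite expr2 /D mulr_suml; apply: eq_bigr => i _.
  by rewrite mulr_sumr; apply: eq_bigr => j _; field.
ring.
Qed.

Lemma Rintegral_sum d (T : measurableType d) (R : realType)
    (mu : {measure set T -> \bar R}) (I : Type) (r : seq I) (F : I -> T -> R) :
  (forall i, mu.-integrable setT (EFin \o F i)) ->
  mu.-integrable setT (EFin \o (fun w => \sum_(i <- r) F i w)) /\
  \int[mu]_w (\sum_(i <- r) F i w) = \sum_(i <- r) \int[mu]_w F i w.
Proof.
move=> Fi; elim: r => [|i r [IH1 IH2]].
  have e w : \sum_(i <- [::]) F i w = 0 by rewrite big_nil.
  rewrite (eq_RintegralT _ e) big_nil Rintegral_cst// mul0r; split => //.
  rewrite (_ : _ \o _ = cst 0%E); first exact: integrable0.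
  by apply/funext => w; rewrite /= e.
rewrite big_cons -IH2 -RintegralD//; split.
  rewrite (_ : _ \o _ = (fun w => (F i w)%:E + (\sum_(j <- r) F j w)%:E)%E).
    exact: (integrableD measurableT (Fi i) IH1).
  by apply/funext => w; rewrite /= big_cons EFinD.
by apply: eq_RintegralT => w; rewrite big_cons.
Qed.

Section mean_zero_variables.
Context d (Omega : measurableType d) (R : realType) (P : probability Omega R).

(** The expectation is the integral of the positive part minus that of the negative part, and
    [+oo - +oo] is [-oo]; the value 0 therefore forces both parts to be finite. *)
Lemma mean_zero_integrable (X : {RV P >-> R}) : 'E_P[X]%E = 0%E ->
  P.-integrable setT (EFin \o X) /\ \int[P]_w X w = 0.
Proof.
rewrite unlock => X0; split; last by rewrite /Rintegral X0.
have mX : measurable_fun setT (EFin \o X) by exact/measurable_EFinP.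
move: X0; rewrite integralE => X0.
have p0 : (0 <= \int[P]_x ((EFin \o X)^\+ x))%E by exact: integral_ge0.
have n0 : (0 <= \int[P]_x ((EFin \o X)^\- x))%E by exact: integral_ge0.
apply/integrableP; split => //.
rewrite (_ : (fun x => _) = (fun x => (EFin \o X)^\+ x + (EFin \o X)^\- x)%E); last first.
  by have := fune_abse (EFin \o X) => e; apply/funext => x; rewrite -[LHS]/((abse \o (EFin \o X)) x) e.
rewrite ge0_integralD//; [|exact: measurable_funepos|exact: measurable_funeneg].
move: X0 p0 n0; case: integral => [a||]; case: integral => [b||]//=.
by rewrite ltry.
Qed.

Lemma RintegralZ (F : Omega -> R) (c : R) :
  P.-integrable setT (EFin \o F) -> P.-integrable setT (EFin \o (fun w => c * F w)).
Proof. by move=> Fi; rewrite (_ : _ \o _ = fun w => (c%:E * (F w)%:E)%E)//; exact: (integrableZl measurableT c Fi). Qed.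

Lemma gaussian_cos (T : Type) (X : T -> {RV P >-> R}) k (t : 'I_k -> T)
    (c : 'I_k -> R) (b : R) : gaussian_process X -> mean_zero X ->
  \int[P]_w cos (\sum_j c j * X (t j) w + b) =
  cos b * expR (- (\int[P]_w (\sum_j c j * X (t j) w) ^+ 2 / 2)).
Proof.
move=> gX mX; have [m [s ms]] := gX k t c.
have mS : measurable_fun setT (fun w => \sum_(j < k) c j * X (t j) w).
  by apply: measurable_sum => j; exact: measurable_funM.
have [e1 e2 e3] := gaussian_moments mS ms.
have [_ e0] := Rintegral_sum (index_enum 'I_k)
  (fun j => RintegralZ (c j) (mean_zero_integrable (mX (t j))).1).
have m0 : m = 0.
  rewrite -e1 e0 big1// => j _; have [i1 i2] := mean_zero_integrable (mX (t j)).
  by rewrite RintegralZl// i2 mulr0.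
rewrite e3 m0 add0r; congr (_ * expR (- (_ / 2))).
by rewrite -e2; apply: eq_RintegralT => w; rewrite m0 subr0.
Qed.

Lemma second_moment (X : {RV P >-> R}) (v : R) : 'E_P[X]%E = 0%E -> 'V_P[X]%E = v%:E ->
  P.-integrable setT (EFin \o (fun w => X w ^+ 2)) /\ \int[P]_w X w ^+ 2 = v.
Proof.
move=> X0; rewrite /variance unlock X0 unlock /= => Xv.
have {}Xv : (\int[P]_w (X w ^+ 2)%:E = v%:E)%E.
  rewrite -Xv; apply: eq_integral => w _; congr EFin.
  by rewrite /= /GRing.mul/= subr0 expr2.
split; last by rewrite /Rintegral Xv.
apply/integrableP; split; first exact/measurable_EFinP/measurable_funX.
rewrite (eq_integral (fun w => (X w ^+ 2)%:E)) ?Xv ?ltry// => w _.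
by rewrite gee0_abs// lee_fin sqr_ge0.
Qed.

Lemma unit_variance_increment (T : Type) (X : T -> {RV P >-> R})
    (rho : T -> T -> R) (s t : T) :
  mean_zero X -> unit_variance X -> correlation_function X rho ->
  P.-integrable setT (EFin \o (fun w => (X s w - X t w) ^+ 2)) /\
  \int[P]_w (X s w - X t w) ^+ 2 = 2 * (1 - rho s t).
Proof.
move=> mX vX cX.
have [is_ es] := second_moment (mX s) (vX s).
have [it et] := second_moment (mX t) (vX t).
have mst : measurable_fun setT (fun w => X s w * X t w) by exact: measurable_funM.
have ist : P.-integrable setT (EFin \o (fun w => X s w * X t w)).
  apply: (@integrable_le _ _ _ P _ (fun w => X s w ^+ 2 + X t w ^+ 2)) => //.
    move=> w; rewrite normrM -(real_normK (num_real (X s w))) -(real_normK (num_real (X t w))).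
    have := sqr_ge0 (`|X s w| - `|X t w|).
    by have := normr_ge0 (X s w); have := normr_ge0 (X t w); nra.
  rewrite (_ : _ \o _ = fun w => ((X s w ^+ 2)%:E + (X t w ^+ 2)%:E)%E)//.
  exact: (integrableD measurableT is_ it).
have <- : \int[P]_w (X s w * X t w) = rho s t.
  rewrite -cX /correlation !vX/= sqrtr1 mulr1 divr1 unlock !mX unlock /Rintegral.
  congr fine; apply: eq_integral => w _; congr EFin.
  by rewrite /= /GRing.mul/= !subr0.
have e w : (X s w - X t w) ^+ 2 = (X s w ^+ 2 + X t w ^+ 2) + (-2) * (X s w * X t w) by ring.
have i2 : P.-integrable setT (EFin \o (fun w => X s w ^+ 2 + X t w ^+ 2)).
  rewrite (_ : _ \o _ = fun w => ((X s w ^+ 2)%:E + (X t w ^+ 2)%:E)%E)//.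
  exact: (integrableD measurableT is_ it).
have i3 := RintegralZ (-2) ist.
split.
  rewrite (_ : _ \o _ = fun w => ((X s w ^+ 2 + X t w ^+ 2)%:E + (-2 * (X s w * X t w))%:E)%E).
    exact: (integrableD measurableT i2 i3).
  by apply/funext => w; rewrite /= e EFinD.
rewrite (eq_RintegralT _ e) RintegralD// RintegralD// RintegralZl// es et; ring.
Qed.

Lemma incremental_variance_increment (T : Type) (X : T -> {RV P >-> R})
    (Gamma : T -> T -> R) (s t : T) :
  mean_zero X -> incremental_variance X Gamma ->
  P.-integrable setT (EFin \o (fun w => (X s w - X t w) ^+ 2)) /\
  \int[P]_w (X s w - X t w) ^+ 2 = Gamma t s.
Proof.
move=> mX GX; have := @second_moment (X s \- X t)%R (Gamma t s).
apply; last exact: GX.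
have [i1 e1] := mean_zero_integrable (mX s).
have [i2 e2] := mean_zero_integrable (mX t).
rewrite unlock; have := RintegralB measurableT i1 i2; rewrite e1 e2 subr0 => e.
rewrite -[RHS]/(0%:E) -e EFin_Rintegral//.
rewrite (_ : _ \o _ = fun w => ((X s w)%:E - (X t w)%:E)%E)//.
exact: (integrableB measurableT i1 i2).
Qed.

End mean_zero_variables.

(** * Windows, Gaussian mollification and Fourier test functions *)

Section products.
Context d1 d2 (T1 : measurableType d1) (T2 : measurableType d2) (R : realType).
Variables (m1 : {sigma_finite_measure set T1 -> \bar R})
  (m2 : {sigma_finite_measure set T2 -> \bar R}).

Lemma integrable_product_le (G : T1 * T2 -> R) (F : T1 -> R) (h : T2 -> R) :
  measurable_fun setT G -> (forall x y, `|G (x, y)| <= F x * h y) ->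
  m1.-integrable setT (EFin \o F) -> m2.-integrable setT (EFin \o h) ->
  (m1 \x m2)%E.-integrable setT (EFin \o G).
Proof.
move=> mG GFh iF ih; have mGE : measurable_fun setT (EFin \o G) by exact/measurable_EFinP.
have mh : measurable_fun setT h by apply/measurable_EFinP; exact: measurable_int ih.
have mF : measurable_fun setT F by apply/measurable_EFinP; exact: measurable_int iF.
have mGx x : measurable_fun setT (fun y => G (x, y)).
  by apply: measurableT_comp mG _; exact: pair1_measurable.
apply/(integrable12ltyP _ _ mGE).
apply: (@le_lt_trans _ _ (\int[m1]_x (`|F x|%:E * \int[m2]_y `|h y|%:E))%E).
  apply: ge0_le_integral => //.
  - by move=> x _; exact: integral_ge0.
  - apply: (@measurable_fun_fubini_tonelli_F _ _ _ _ _ m2 (fun z => `|(EFin \o G) z|%E)) => //.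
    exact: measurableT_comp.
  - apply: emeasurable_funM => //; apply/measurable_EFinP; exact: measurableT_comp.
  - move=> x _; rewrite -ge0_integralZl//; first last.
    + by apply/measurable_EFinP; exact: measurableT_comp.
    + apply: ge0_le_integral => //.
      * by apply: measurableT_comp => //; apply/measurable_EFinP; exact: mGx.
      * apply: emeasurable_funM => //; apply/measurable_EFinP; exact: measurableT_comp.
      * move=> y _; rewrite -EFinM lee_fin (le_trans (GFh x y))// -normrM ler_norm//.
have /integrableP[_ hoo] := ih; have /integrableP[_ Foo] := iF.
rewrite ge0_integralZr//; last 2 first.
- by apply/measurable_EFinP; exact: measurableT_comp.
- exact: integral_ge0.
by rewrite lte_mul_pinfty// ?integral_ge0// ge0_fin_numE// integral_ge0.
Qed.

Lemma product_sigma_finite : sigma_finite setT (m1 \x m2)%E.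
Proof.
have /sigma_finiteP[F [TF ndF Foo]] := sigma_finiteT m1.
have /sigma_finiteP[G [TG ndG Goo]] := sigma_finiteT m2.
exists (fun n => F n `*` G n) => [|n].
  apply/seteqP; split => // -[x y] _.
  have : [set: T1] x by []. rewrite TF => -[i _ Fix].
  have : [set: T2] y by []. rewrite TG => -[j _ Gjy].
  exists (maxn i j) => //; split.
    by move: x Fix; exact/subsetPset/ndF/leq_maxl.
  by move: y Gjy; exact/subsetPset/ndG/leq_maxr.
have [mF lF] := Foo n; have [mG lG] := Goo n.
split; first exact: measurableX.
by rewrite product_measure1E// lte_mul_pinfty// ge0_fin_numE.
Qed.

(* the canonical sigma-finite structure on [\x] is shadowed by the one for subprobabilities *)
Definition sigma_finite_product : {sigma_finite_measure set (T1 * T2)%type -> \bar R} :=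
  HB.pack_for (SigmaFiniteMeasure.type (T1 * T2)%type R) (m1 \x m2)%E
    (Measure_isSigmaFinite.Build _ _ _ (m1 \x m2)%E product_sigma_finite).

End products.

Section mollification.
Context (R : realType).
Local Notation leb := (@lebesgue_measure R).

Lemma normal_pdfC (x y s : R) : s != 0 -> normal_pdf x s y = normal_pdf y s x.
Proof. by move=> s0; rewrite !normal_pdfE// /normal_fun -sqrrN opprB. Qed.

(** For negative [r] the window is empty, as it has to be for a negative level [x j]. *)
Definition window (r y : R) : R := \1_`[- r, r]%classic y.

(** Convolution with a Gaussian, written as an average over the centre [v], so that exchanging
    integrals reduces it to the test functions [normal_pdf v s]. *)
Definition mollified_window (r s y : R) : R :=
  \int[leb]_v (window r v * normal_pdf v s y).

Lemma measurable_window r : measurable_fun setT (window r).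
Proof. exact: measurable_indic. Qed.

Lemma window_ge0 r y : 0 <= window r y. Proof. by rewrite /window indicE ler0n. Qed.

Lemma window_le1 r y : window r y <= 1.
Proof. by rewrite /window indicE; case: (_ \in _). Qed.

Lemma integrable_window r : leb.-integrable setT (EFin \o window r).
Proof.
exact: integrable_indic_itv.
Qed.

Lemma measurable_normal_pdf2 (s : R) : measurable_fun setT (fun z : R * R => normal_pdf z.1 s z.2).
Proof.
have [->|s0] := eqVneq s 0.
  rewrite /normal_pdf eqxx; apply: measurableT_comp => //; exact: measurable_indic.
rewrite (_ : (fun _ => _) = fun z => normal_peak s * expR (- (z.2 - z.1) ^+ 2 / (s ^+ 2 *+ 2))).
  apply: measurable_funM => //; apply: measurableT_comp => //.
  apply: measurable_funM => //; apply: measurableT_comp => //.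
  by apply: measurable_funX; apply: measurable_funB; [exact: measurable_snd|exact: measurable_fst].
by apply/funext => z; rewrite normal_pdfE.
Qed.

Lemma Rintegral_window r : \int[leb]_y window r y = Num.max (2 * r) 0.
Proof.
have -> : \int[leb]_y window r y = fine (leb (`[- r, r]%classic : set R)).
  by rewrite /Rintegral /window integral_indic// setIT.
rewrite lebesgue_measure_itv/= lte_fin.
case: ltP => r0 /=; first by rewrite max_l; lra.
by rewrite max_r//; lra.
Qed.

Section fixed_width.
Variables (r s : R).
Hypothesis s0 : s != 0.
Local Notation b := (mollified_window r s).

Let mwp : measurable_fun setT (fun z : measurableTypeR R * measurableTypeR R =>
  (window r z.2 * normal_pdf z.2 s z.1)%:E).
Proof.
apply/measurable_EFinP; apply: measurable_funM.
  by apply: measurableT_comp; [exact: measurable_window|exact: measurable_snd].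
have : measurable_fun setT (fun z : R * R => (z.2, z.1)).
  by apply: measurable_fun_pair; [exact: measurable_snd|exact: measurable_fst].
exact: (measurableT_comp (measurable_normal_pdf2 s)).
Qed.

Let wp_ge0 v y : 0 <= window r v * normal_pdf v s y.
Proof. by rewrite mulr_ge0 ?window_ge0 ?normal_pdf_ge0. Qed.

Let wp_le v y : `|window r v * normal_pdf v s y| <= normal_pdf y s v.
Proof.
rewrite ger0_norm// (normal_pdfC _ _ s0) ler_piMl ?normal_pdf_ge0//.
exact: window_le1.
Qed.

Let mwpy y : measurable_fun setT (fun v => window r v * normal_pdf v s y).
Proof.
apply: measurable_funM; first exact: measurable_window.
by under eq_fun do rewrite (normal_pdfC _ _ s0); exact: measurable_normal_pdf.
Qed.

Let integrable_wp y : leb.-integrable setT (EFin \o (fun v => window r v * normal_pdf v s y)).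
Proof.
exact: (@integrable_le _ _ _ leb _ (fun v => normal_pdf y s v)) (mwpy y)
  (fun v => wp_le v y) (integrable_normal_pdf y s).
Qed.

Lemma mollified_window_ge0 y : 0 <= b y.
Proof. by apply: Rintegral_ge0 => v _. Qed.

Lemma mollified_window_le1 y : b y <= 1.
Proof.
rewrite -(Rintegral_normal_pdf y s); apply: le_Rintegral => //.
  exact: integrable_normal_pdf.
by move=> v _; rewrite (le_trans _ (wp_le v y))// ler_norm.
Qed.

Let EFin_mollified y :
  (b y)%:E = (\int[leb]_v (window r v * normal_pdf v s y)%:E)%E.
Proof. exact: EFin_Rintegral. Qed.

Lemma measurable_mollified_window : measurable_fun setT (b : R -> R).
Proof.
apply/measurable_EFinP; rewrite (_ : _ \o _ = (fubini_F leb (fun z =>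
    (window r z.2 * normal_pdf z.2 s z.1)%:E))%E).
  by apply: measurable_fun_fubini_tonelli_F => // z; rewrite lee_fin.
by apply/funext => y; rewrite /= EFin_mollified.
Qed.

Lemma integral_mollified_window : (\int[leb]_y (b y)%:E = \int[leb]_y (window r y)%:E)%E.
Proof.
under eq_integral do rewrite EFin_mollified.
rewrite (@fubini_tonelli _ _ _ _ _ leb leb (fun z => (window r z.2 * normal_pdf z.2 s z.1)%:E) mwp)/=; last first.
  by move=> z; rewrite lee_fin.
apply: eq_integral => v _; under eq_integral do rewrite EFinM.
rewrite integralZl//; last exact: integrable_normal_pdf.
by rewrite integral_normal_pdf mule1.
Qed.

Lemma integrable_mollified_window : leb.-integrable setT (EFin \o (b : R -> R)).
Proof.
apply/integrableP; split; first by apply/measurable_EFinP; exact: measurable_mollified_window.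
under eq_integral do rewrite /= ger0_norm ?mollified_window_ge0//.
rewrite integral_mollified_window -EFin_Rintegral ?ltry//.
exact: integrable_window.
Qed.

(** Chebyshev's inequality: a normal variable centred at depth [delta] inside the window leaves it
    only by deviating more than [delta]. *)
Lemma mollified_window_near (delta y : R) : 0 < delta -> `|y| <= r - delta ->
  1 - b y <= s ^+ 2 / delta ^+ 2.
Proof.
move=> d0 yr; rewrite -{1}(Rintegral_normal_pdf y s) -RintegralB//; last exact: integrable_normal_pdf.
rewrite -(normal_variance y s0) -RintegralZr//; last exact: integrable_normal_center2.
apply: le_Rintegral => //.
- rewrite (_ : _ \o _ = fun v => ((normal_pdf y s v)%:E - (window r v * normal_pdf v s y)%:E)%E)//.
  exact: (integrableB measurableT (integrable_normal_pdf y s) (integrable_wp y)).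
- rewrite (_ : _ \o _ = fun v => (((v - y) ^+ 2 * normal_pdf y s v)%:E * (delta ^- 2)%:E)%E)//.
  exact: (integrableZr measurableT _ (integrable_normal_center2 y s0)).
move=> v _; rewrite (normal_pdfC v y s0) -{1}[normal_pdf y s v]mul1r -mulrBl.
rewrite mulrAC ler_wpM2r ?normal_pdf_ge0//.
rewrite ler_pdivlMr ?exprn_gt0// /window indicE.
have [vr|vr] := boolP (v \in _); first by rewrite subrr mul0r sqr_ge0.
rewrite subr0 mul1r -[leRHS]ger0_norm ?sqr_ge0// normrX ler_pXn2r ?nnegrE ?normr_ge0 ?(ltW d0)//.
move: vr; rewrite notin_setE/= in_itv/= => /negP; rewrite -ler_norml -ltNge => vr.
by have := lerB_dist v y; lra.
Qed.

End fixed_width.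

(** Window and mollification have the same mass, so the [L^1] error is twice the loss inside the
    window. The loss is at most 1 on the two boundary strips of width [delta] and, by Chebyshev, at
    most [delta^2] deeper inside; the width [s = delta^2] is chosen to give
    [s^2 / delta^2 = delta^2]. *)
Lemma mollifier_error (r delta : R) : 0 < delta ->
  \int[leb]_y `|window r y - mollified_window r (delta ^+ 2) y| <=
  4 * delta + 4 * `|r| * delta ^+ 2.
Proof.
move=> d0; have s0 : delta ^+ 2 != 0 by rewrite sqrf_eq0 gt_eqF.
set b := mollified_window r (delta ^+ 2).
have iw := integrable_window r; have ib := integrable_mollified_window r s0.
have iw' := integrable_window (r - delta).
(* [D] bounds twice the positive part of [window - b], and [|window - b|] is that quantity plus
   [b - window], whose integral is zero. *)
pose D y := 2 * (window r y - window (r - delta) y + delta ^+ 2 * window r y).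
have ibw : leb.-integrable setT (EFin \o (fun y => b y - window r y)).
  by rewrite (_ : _ \o _ = fun y => ((b y)%:E - (window r y)%:E)%E)//; exact: (integrableB measurableT ib iw).
have iDw : leb.-integrable setT (EFin \o (fun y => window r y - window (r - delta) y)).
  by rewrite (_ : _ \o _ = fun y => ((window r y)%:E - (window (r - delta) y)%:E)%E)//; exact: (integrableB measurableT iw iw').
have idw : leb.-integrable setT (EFin \o (fun y => delta ^+ 2 * window r y)).
  by rewrite (_ : _ \o _ = fun y => ((delta ^+ 2)%:E * (window r y)%:E)%E)//; exact: (integrableZl measurableT _ iw).
have iD1 : leb.-integrable setT (EFin \o (fun y => window r y - window (r - delta) y + delta ^+ 2 * window r y)).
  by rewrite (_ : _ \o _ = fun y => ((window r y - window (r - delta) y)%:E + (delta ^+ 2 * window r y)%:E)%E)//; exact: (integrableD measurableT iDw idw).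
have iD : leb.-integrable setT (EFin \o D).
  by rewrite (_ : _ \o _ = fun y => (2%:E * (window r y - window (r - delta) y + delta ^+ 2 * window r y)%:E)%E)//; exact: (integrableZl measurableT _ iD1).
have iDb : leb.-integrable setT (EFin \o (fun y => D y + (b y - window r y))).
  by rewrite (_ : _ \o _ = fun y => ((D y)%:E + (b y - window r y)%:E)%E)//; exact: (integrableD measurableT iD ibw).
apply: (@le_trans _ _ (\int[leb]_y (D y + (b y - window r y)))).
  apply: le_Rintegral => //.
    rewrite (_ : _ \o _ = abse \o (EFin \o (fun y => window r y - b y)))//.
    apply: integrable_abse.
    by rewrite (_ : _ \o _ = fun y => ((window r y)%:E - (b y)%:E)%E)//; exact: (integrableB measurableT iw ib).
  move=> y _; rewrite /D.
  have b0 : 0 <= b y := mollified_window_ge0 r (delta ^+ 2) y.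
  have b1 : b y <= 1 := mollified_window_le1 r s0 y.
  have near1 := @mollified_window_near r (delta ^+ 2) s0 delta y d0.
  rewrite /window !indicE !mem_setE !in_itv/= -!ler_norml.
  case: (leP `|y| r) => yr; case: (leP `|y| (r - delta)) => yd /=; rewrite ?subrr ?subr0.
  - have := near1 yd; rewrite -/b (_ : _ / _ = delta ^+ 2); last by field; rewrite gt_eqF. move=> h.
    by rewrite ger0_norm; lra.
  - by rewrite ger0_norm; nra.
  - by exfalso; lra.
  - by rewrite ler0_norm; lra.
rewrite RintegralD// RintegralB//.
rewrite {2}/Rintegral integral_mollified_window// -/(Rintegral _ _ (window r)) subrr addr0.
rewrite /D RintegralZl// RintegralD// RintegralB// RintegralZl//.
rewrite !Rintegral_window.
have := ler_norm r; have := normr_ge0 r; have := sqr_ge0 delta => ? ? ?.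
case: (leP (2 * r) 0) => r0; case: (leP (2 * (r - delta)) 0) => rd; nra.
Qed.

End mollification.

Section one_measure.
Context d (T : measurableType d) (R : realType).
Variable nu : {sigma_finite_measure set T -> \bar R}.
Local Notation leb := (@lebesgue_measure R).
Implicit Types (F A Y : T -> R).

Let measurable_cos (f : T * measurableTypeR R -> R) : measurable_fun setT f ->
  measurable_fun setT (fun z => cos (f z)).
Proof.
by move=> mf; apply: measurableT_comp mf; apply: continuous_measurable_fun; exact: continuous_cos.
Qed.

Let measurable_fstF F : measurable_fun setT F ->
  measurable_fun setT (fun z : T * measurableTypeR R => F z.1).
Proof. by move=> mF; apply: measurableT_comp mF _; exact: measurable_fst. Qed.

Let measurable_sndF (h : R -> R) : measurable_fun setT h ->
  measurable_fun setT (fun z : T * measurableTypeR R => h z.2).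
Proof. by move=> mh; apply: (measurableT_comp (f := h)) mh _; exact: measurable_snd. Qed.

Section fourier.
Variables (F A Y : T -> R) (v s : R).
Hypotheses (s0 : s != 0) (mA : measurable_fun setT A) (mY : measurable_fun setT Y)
  (iF : nu.-integrable setT (EFin \o F)).

Let G (z : T * measurableTypeR R) : R :=
  F z.1 * cos (A z.1 + z.2 * (Y z.1 - v)) * normal_pdf 0 s^-1 z.2.

Let iG : (nu \x leb)%E.-integrable setT (EFin \o G).
Proof.
have mF : measurable_fun setT F by apply/measurable_EFinP; exact: measurable_int iF.
apply: (@integrable_product_le _ _ _ _ _ nu leb G (fun x => `|F x|) (normal_pdf 0 s^-1)).
- apply: measurable_funM; last by apply: measurable_sndF; exact: measurable_normal_pdf.
  apply: measurable_funM; first exact: measurable_fstF.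
  apply: measurable_cos; apply: measurable_funD; first exact: measurable_fstF.
  apply: measurable_funM; first exact: measurable_snd.
  by apply: measurable_funB => //; exact: measurable_fstF.
- move=> x y; rewrite /G/= !normrM (ger0_norm (normal_pdf_ge0 _ _ _)).
  by rewrite ler_wpM2r ?normal_pdf_ge0// ler_piMr// cos_max.
- exact: integrable_abse iF.
- exact: integrable_normal_pdf.
Qed.

Let integrable_Fcos g : nu.-integrable setT
  (EFin \o (fun x => F x * cos (A x + g * (Y x - v)))).
Proof.
have mF : measurable_fun setT F by apply/measurable_EFinP; exact: measurable_int iF.
apply: (@integrable_le _ _ _ nu _ (fun x => `|F x|)).
- apply: measurable_funM => //; apply: measurableT_comp.
    by apply: continuous_measurable_fun; exact: continuous_cos.
  apply: measurable_funD => //; apply: measurable_funM => //.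
  exact: measurable_funB.
- by move=> x; rewrite normrM ler_piMr// cos_max.
- exact: integrable_abse iF.
Qed.

Let Rintegral_G g : \int[nu]_x G (x, g) =
  \int[nu]_x (F x * cos (A x + g * (Y x - v))) * normal_pdf 0 s^-1 g.
Proof. by rewrite /G/= RintegralZr. Qed.

(** A Gaussian is the Fourier transform of a Gaussian: multiplying by [normal_fun v s (Y x)] amounts
    to adding [g (Y x - v)] to the phase, with [g] normal of standard deviation [s^-1]. The wave
    family is thereby preserved. *)
Lemma Rintegral_fourier :
  \int[nu]_x (F x * cos (A x) * normal_fun v s (Y x)) =
  \int[leb]_g (\int[nu]_x (F x * cos (A x + g * (Y x - v))) * normal_pdf 0 s^-1 g).
Proof.
have sV : s^-1 != 0 by rewrite invr_eq0.
transitivity (\int[nu]_x \int[leb]_g G (x, g)).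
  apply: eq_RintegralT => x; rewrite /G/=.
  transitivity (F x * \int[leb]_g (cos ((Y x - v) * g + A x) * normal_pdf 0 s^-1 g)).
    rewrite normal_cos// mulr0 add0r mulrA; congr (_ * expR _).
    by rewrite /normal_fun; field.
  rewrite -RintegralZl//; last first.
    apply: (@integrable_normal_cst _ 0 s^-1 sV (fun g => cos ((Y x - v) * g + A x)) 1).
      move=> g; apply: (@continuous_comp _ _ _ (fun g : R => (Y x - v) * g + A x) cos).
        apply: cvgD; last exact: cvg_cst.
        by apply: cvgM; [exact: cvg_cst|exact: cvg_id].
      exact: continuous_cos.
    by move=> g; exact: cos_max.
  by apply: eq_RintegralT => g; rewrite mulrA; congr (_ * cos _ * _); ring.
by rewrite (RFubini iG); apply: eq_RintegralT => g; rewrite Rintegral_G.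
Qed.

Lemma measurable_fourier : measurable_fun setT (fun g : R =>
  \int[nu]_x (F x * cos (A x + g * (Y x - v))) * normal_pdf 0 s^-1 g).
Proof.
rewrite (_ : (fun g : R => _) = fine \o fubini_G nu (EFin \o G)).
  by apply: (@measurableT_comp _ _ _ _ _ _ fine) => //; exact: (measurable_fubini_G iG).
by apply/funext => g; rewrite -Rintegral_G.
Qed.

Lemma Rintegral_fourier_pdf :
  \int[nu]_x (F x * normal_pdf v s (Y x) * cos (A x)) = normal_peak s *
  \int[leb]_g (\int[nu]_x (F x * cos (A x + g * (Y x - v))) * normal_pdf 0 s^-1 g).
Proof.
rewrite -Rintegral_fourier -RintegralZl//.
  by apply: eq_RintegralT => x; rewrite normal_pdfE//; ring.
have mF : measurable_fun setT F by apply/measurable_EFinP; exact: measurable_int iF.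
apply: (@integrable_le _ _ _ nu _ (fun x => `|F x|)).
- apply: measurable_funM; last first.
    by apply: measurableT_comp mY; exact: measurable_normal_fun.
  apply: measurable_funM => //; apply: measurableT_comp mA.
  by apply: continuous_measurable_fun; exact: continuous_cos.
- move=> x; rewrite !normrM -mulrA ler_piMr// mulr_ile1 ?cos_max//.
  rewrite ger0_norm ?normal_fun_ge0// -expR0 ler_expR.
  by rewrite mulNr oppr_le0 divr_ge0 ?mulrn_wge0 ?sqr_ge0.
- exact: integrable_abse iF.
Qed.

Lemma fourier_bound g : `|\int[nu]_x (F x * cos (A x + g * (Y x - v)))| <=
  \int[nu]_x `|F x|.
Proof.
rewrite (le_trans (le_normr_Rintegral _ _))//.
apply: le_Rintegral => //.
- exact: integrable_abse (integrable_Fcos g).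
- exact: integrable_abse iF.
- by move=> x _; rewrite normrM ler_piMr// cos_max.
Qed.

End fourier.

Section mollify.
Variables (F A Y : T -> R) (r s : R).
Hypotheses (s0 : s != 0) (mF : measurable_fun setT F) (mA : measurable_fun setT A)
  (mY : measurable_fun setT Y) (F01 : forall x, 0 <= F x <= 1).
Hypothesis marginal : forall B : set (measurableTypeR R), measurable B ->
  (nu (Y @^-1` B) <= leb B)%E.

Let normF x : `|F x * cos (A x)| <= 1.
Proof.
have /andP[F0 F1] := F01 x; rewrite normrM (ger0_norm F0).
by rewrite mulr_ile1// cos_max.
Qed.

Let mFc : measurable_fun setT (fun x => F x * cos (A x)).
Proof.
apply: measurable_funM => //; apply: measurableT_comp mA.
by apply: continuous_measurable_fun; exact: continuous_cos.
Qed.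

Lemma ge0_integral_marginal (f : R -> R) : measurable_fun setT f -> (forall x, 0 <= f x) ->
  (\int[nu]_x (f (Y x))%:E <= \int[leb]_y (f y)%:E)%E.
Proof.
move=> mf f0; have mY' : measurable_fun setT (Y : T -> measurableTypeR R) := mY.
have := @ge0_integral_image_le _ _ _ nu _ _ _ mY' leb (EFin \o f) marginal.
apply; first exact/measurable_EFinP.
by move=> x; rewrite lee_fin.
Qed.

Lemma integrable_marginal (f : R -> R) : leb.-integrable setT (EFin \o f) ->
  (forall x, 0 <= f x) -> nu.-integrable setT (EFin \o (f \o Y)).
Proof.
move=> fi f0; have mf : measurable_fun setT f by apply/measurable_EFinP; exact: measurable_int fi.
apply/integrableP; split; first by apply/measurable_EFinP; exact: measurableT_comp mf mY.
under eq_integral do rewrite /= ger0_norm//.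
rewrite (le_lt_trans (ge0_integral_marginal mf f0))// -EFin_Rintegral ?ltry//.
Qed.

Lemma Rintegral_marginal (f : R -> R) : leb.-integrable setT (EFin \o f) ->
  (forall x, 0 <= f x) -> \int[nu]_x f (Y x) <= \int[leb]_y f y.
Proof.
move=> fi f0; have mf : measurable_fun setT f by apply/measurable_EFinP; exact: measurable_int fi.
rewrite -lee_fin !EFin_Rintegral//; first exact: ge0_integral_marginal.
exact: integrable_marginal.
Qed.

Let H (z : T * measurableTypeR R) : R :=
  F z.1 * cos (A z.1) * (window r z.2 * normal_pdf z.2 s (Y z.1)).

Let mH : measurable_fun setT H.
Proof.
apply: measurable_funM; first exact: (measurable_fstF mFc).
apply: measurable_funM; first by apply: measurable_sndF; exact: measurable_window.
have : measurable_fun setT (fun z : T * measurableTypeR R => (z.2 : R, Y z.1)).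
  by apply: measurable_fun_pair; [exact: measurable_snd|exact: measurable_fstF].
exact: (measurableT_comp (measurable_normal_pdf2 s)).
Qed.

Let H_le x v : `|H (x, v)| <= window r v * normal_pdf v s (Y x).
Proof.
rewrite /H/= normrM (ger0_norm (mulr_ge0 (window_ge0 _ _) (normal_pdf_ge0 _ _ _))).
by rewrite ler_piMl// mulr_ge0 ?window_ge0 ?normal_pdf_ge0.
Qed.

(** [nu] may be infinite; integrability comes from its marginal. For a fixed centre [v] the Gaussian
    density in [Y x] has [nu]-integral at most its Lebesgue integral 1, and [v] ranges over a
    bounded window. *)
Let iH : (nu \x leb)%E.-integrable setT (EFin \o H).
Proof.
have mHE : measurable_fun setT (EFin \o H) by exact/measurable_EFinP.
apply/(integrable21ltyP _ _ mHE).
apply: (@le_lt_trans _ _ (\int[leb]_v (window r v)%:E)%E).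
  apply: ge0_le_integral => //.
  - by move=> v _; exact: integral_ge0.
  - apply: (@measurable_fun_fubini_tonelli_G _ _ _ _ _ nu (fun z => `|(EFin \o H) z|%E)) => //.
    exact: measurableT_comp.
  - by apply/measurable_EFinP; exact: measurable_window.
  - move=> v _; apply: (@le_trans _ _ (\int[nu]_x (window r v * normal_pdf v s (Y x))%:E)%E).
      apply: ge0_le_integral => //.
      + apply: measurableT_comp => //; apply/measurable_EFinP.
        by apply: measurableT_comp mH _; exact: pair2_measurable.
      + apply/measurable_EFinP; apply: measurable_funM => //.
        by apply: measurableT_comp mY; exact: measurable_normal_pdf.
      + by move=> x _; rewrite lee_fin H_le.
    have mw : measurable_fun setT (fun y => window r v * normal_pdf v s y).
      by apply: measurable_funM => //; exact: measurable_normal_pdf.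
    have w0 y : 0 <= window r v * normal_pdf v s y.
      by rewrite mulr_ge0 ?window_ge0 ?normal_pdf_ge0.
    apply: (le_trans (ge0_integral_marginal mw w0)).
    under eq_integral do rewrite EFinM.
    rewrite integralZl//; last exact: integrable_normal_pdf.
    by rewrite integral_normal_pdf mule1.
rewrite -EFin_Rintegral ?ltry//; exact: integrable_window.
Qed.

Let integrable_Fp v : nu.-integrable setT (EFin \o
  (fun x => F x * cos (A x) * normal_pdf v s (Y x))).
Proof.
apply: (@integrable_le _ _ _ nu _ (fun x => normal_pdf v s (Y x))).
- apply: measurable_funM => //.
  by apply: measurableT_comp mY; exact: measurable_normal_pdf.
- move=> x; rewrite normrM (ger0_norm (normal_pdf_ge0 _ _ _)).
  by rewrite ler_piMl// normal_pdf_ge0.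
- apply: (@integrable_marginal (normal_pdf v s)); first exact: integrable_normal_pdf.
  by move=> x; exact: normal_pdf_ge0.
Qed.

Let Rintegral_H v : \int[nu]_x H (x, v) =
  window r v * \int[nu]_x (F x * cos (A x) * normal_pdf v s (Y x)).
Proof. by rewrite -RintegralZl//; apply: eq_RintegralT => x; rewrite /H/= mulrCA. Qed.

Lemma Rintegral_mollified :
  \int[nu]_x (F x * cos (A x) * mollified_window r s (Y x)) =
  \int[leb]_v (window r v * \int[nu]_x (F x * cos (A x) * normal_pdf v s (Y x))).
Proof.
transitivity (\int[nu]_x \int[leb]_v H (x, v)).
  apply: eq_RintegralT => x; rewrite /H/= /mollified_window RintegralZl//.
  apply: (@integrable_le _ _ _ leb _ (fun v => normal_pdf (Y x) s v)).
  - apply: measurable_funM; first exact: measurable_window.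
    by under eq_fun do rewrite (normal_pdfC _ _ s0); exact: measurable_normal_pdf.
  - move=> v; rewrite ger0_norm; last by rewrite mulr_ge0 ?window_ge0 ?normal_pdf_ge0.
    by rewrite (normal_pdfC _ _ s0) ler_piMl ?normal_pdf_ge0// window_le1.
  - exact: integrable_normal_pdf.
by rewrite (RFubini iH); apply: eq_RintegralT => v; rewrite Rintegral_H.
Qed.

Lemma measurable_mollified : measurable_fun setT (fun v : R =>
  window r v * \int[nu]_x (F x * cos (A x) * normal_pdf v s (Y x))).
Proof.
rewrite (_ : (fun v : R => _) = fine \o fubini_G nu (EFin \o H)).
  by apply: (@measurableT_comp _ _ _ _ _ _ fine) => //; exact: (measurable_fubini_G iH).
by apply/funext => v; rewrite -Rintegral_H.
Qed.

Lemma mollified_bound v : `|window r v * \int[nu]_x (F x * cos (A x) * normal_pdf v s (Y x))|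
  <= window r v.
Proof.
rewrite normrM (ger0_norm (window_ge0 _ _)) ler_piMr ?window_ge0//.
rewrite (le_trans (le_normr_Rintegral _ _))//.
rewrite -(Rintegral_normal_pdf v s).
apply: le_trans (Rintegral_marginal (integrable_normal_pdf v s) (normal_pdf_ge0 v s)).
apply: le_Rintegral => //.
- exact: integrable_abse (integrable_Fp v).
- exact: (integrable_marginal (integrable_normal_pdf v s) (normal_pdf_ge0 v s)).
- move=> x _; rewrite normrM (ger0_norm (normal_pdf_ge0 _ _ _)).
  by rewrite ler_piMl// normal_pdf_ge0.
Qed.

(** The wave and [F] are bounded by 1 and the law of [Y] by Lebesgue measure, so the bound is an
    integral over the line, the same for all measures of the array and for the limit. *)
Lemma mollified_error :
  `|\int[nu]_x (F x * window r (Y x) * cos (A x)) -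
    \int[nu]_x (F x * cos (A x) * mollified_window r s (Y x))| <=
  \int[leb]_y `|window r y - mollified_window r s y|.
Proof.
have iw := integrable_window r; have ib := integrable_mollified_window r s0.
have bge0 := mollified_window_ge0 r s.
have iYw := integrable_marginal iw (window_ge0 r).
have iYb := integrable_marginal ib bge0.
have i1 : nu.-integrable setT (EFin \o (fun x => F x * window r (Y x) * cos (A x))).
  apply: (@integrable_le _ _ _ nu _ (fun x => window r (Y x))) => //.
    under eq_fun do rewrite mulrAC; apply: measurable_funM => //.
    by apply: measurableT_comp mY; exact: measurable_window.
  move=> x; rewrite mulrAC normrM (ger0_norm (window_ge0 _ _)).
  by rewrite ler_piMl// window_ge0.
have i2 : nu.-integrable setT (EFin \o (fun x => F x * cos (A x) * mollified_window r s (Y x))).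
  apply: (@integrable_le _ _ _ nu _ (fun x => mollified_window r s (Y x))) => //.
    apply: measurable_funM => //.
    by apply: measurableT_comp mY; exact: measurable_mollified_window.
  by move=> x; rewrite normrM (ger0_norm (bge0 _)) ler_piMl.
have id : leb.-integrable setT (EFin \o (fun y => `|window r y - mollified_window r s y|)).
  rewrite (_ : _ \o _ = abse \o (fun y => (window r y)%:E - (mollified_window r s y)%:E)%E)//.
  exact: (integrable_abse (integrableB measurableT iw ib)).
rewrite -RintegralB//.
have i3 : nu.-integrable setT (EFin \o (fun x => F x * window r (Y x) * cos (A x) -
    F x * cos (A x) * mollified_window r s (Y x))).
  rewrite (_ : _ \o _ = (fun x => (F x * window r (Y x) * cos (A x))%:E -
    (F x * cos (A x) * mollified_window r s (Y x))%:E)%E)//.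
  exact: (integrableB measurableT i1 i2).
rewrite (le_trans (le_normr_Rintegral _ i3))//.
apply: le_trans (Rintegral_marginal id (fun=> normr_ge0 _)).
apply: le_Rintegral => //.
- exact: integrable_abse i3.
- exact: (integrable_marginal id (fun=> normr_ge0 _)).
- move=> x _; rewrite mulrAC -mulrBr normrM ler_piMl//.
Qed.

End mollify.
End one_measure.

(** An [eps / 3] argument whose error [e m] is uniform in [n]; it serves for mollification and again
    for the Poisson functional. *)
Lemma cvg_approx (R : realType) (a : nat -> R) (a0 : R) (b : nat -> nat -> R)
    (b0 e : nat -> R) :
  (forall m, b m n @[n --> \oo] --> b0 m) ->
  (forall m n, `|a n - b m n| <= e m) -> (forall m, `|a0 - b0 m| <= e m) ->
  e m @[m --> \oo] --> 0 -> a n @[n --> \oo] --> a0.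
Proof.
move=> bb0 ab ab0 e0; apply/cvgrPdist_le => eps eps0.
have eps3 : 0 < eps / 3 by rewrite divr_gt0.
have [m em] : exists m, e m <= eps / 3.
  move/cvgr0_norm_le : e0 => /(_ _ eps3) [m _ /(_ m (leqnn m)) /= h].
  by exists m; rewrite (le_trans _ h)// ler_norm.
move/cvgrPdist_le : (bb0 m) => /(_ _ eps3); apply: filterS => n h.
have -> : a0 - a n = (a0 - b0 m) + (b0 m - b m n) + (b m n - a n) by ring.
rewrite (le_trans (ler_normD _ _))// (le_trans (lerD (ler_normD _ _) (lexx _)))//.
have := ab m n; have := ab0 m; rewrite (distrC (a n)); lra.
Qed.

Section oscillatory_convergence.
Context d1 d2 (T1 : measurableType d1) (T2 : measurableType d2) (R : realType) (k : nat).
Variables (mu_ : nat -> {sigma_finite_measure set T1 -> \bar R})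
  (mu : {sigma_finite_measure set T2 -> \bar R})
  (y_ : nat -> 'I_k -> T1 -> R) (y : 'I_k -> T2 -> R).
Hypotheses (my_ : forall n i, measurable_fun setT (y_ n i))
  (my : forall i, measurable_fun setT (y i)).
Local Notation leb := (@lebesgue_measure R).
Hypotheses (marg_ : forall n i (B : set (measurableTypeR R)), measurable B ->
    (mu_ n (y_ n i @^-1` B) <= leb B)%E)
  (marg : forall i (B : set (measurableTypeR R)), measurable B ->
    (mu (y i @^-1` B) <= leb B)%E).

(* Tested against waves in all coordinates at once, convergence is stable under multiplication
   by a Gaussian density, hence by a window, in any one coordinate. *)
Definition osc_cvg (F_ : nat -> T1 -> R) (F : T2 -> R) := forall (c : 'I_k -> R) (b : R),
  \int[mu_ n]_x (F_ n x * cos (\sum_i c i * y_ n i x + b)) @[n --> \oo] -->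
  \int[mu]_x (F x * cos (\sum_i c i * y i x + b)).

Let mphase_ n (c : 'I_k -> R) (b : R) :
  measurable_fun setT (fun x => \sum_i c i * y_ n i x + b).
Proof.
apply: measurable_funD => //; apply: measurable_sum => i.
by apply: measurable_funM.
Qed.

Let mphase (c : 'I_k -> R) (b : R) :
  measurable_fun setT (fun x => \sum_i c i * y i x + b).
Proof.
apply: measurable_funD => //; apply: measurable_sum => i.
by apply: measurable_funM.
Qed.

(** By [Rintegral_fourier_pdf] both sides become integrals over frequencies [g]; at each [g] the
    integrand is again a wave, and the bound [B] on the masses gives the dominating function
    [B * normal_pdf 0 s^-1]. *)
Lemma osc_cvg_normal_pdf (F_ : nat -> T1 -> R) (F : T2 -> R) (B : R) (l : 'I_k) (v s : R) : s != 0 ->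
  (forall n, (mu_ n).-integrable setT (EFin \o F_ n)) ->
  mu.-integrable setT (EFin \o F) ->
  (forall n, \int[mu_ n]_x `|F_ n x| <= B) ->
  osc_cvg F_ F -> osc_cvg (fun n x => F_ n x * normal_pdf v s (y_ n l x))
    (fun x => F x * normal_pdf v s (y l x)).
Proof.
move=> s0 iF_ iF FB oF c b.
under eq_fun do rewrite Rintegral_fourier_pdf//.
rewrite Rintegral_fourier_pdf//; apply: cvgM; first exact: cvg_cst.
apply: (@Rdominated_cvg _ _ _ leb _ _ (fun g => B * normal_pdf 0 s^-1 g)).
- by move=> n; exact: measurable_fourier.
- move=> g; apply: cvgM; last exact: cvg_cst.
  (* The random frequency [g] is absorbed into the coefficient of coordinate [l], and the centre [v]
     into the phase. *)
  pose c' i := c i + (if i == l then g else 0).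
  have e (z : 'I_k -> R) : \sum_i c i * z i + b + g * (z l - v) =
      \sum_i c' i * z i + (b - g * v).
    have -> : \sum_i c' i * z i = \sum_i c i * z i + g * z l.
      under eq_bigr do rewrite mulrDl.
      rewrite big_split/=; congr (_ + _); rewrite (bigD1 l)//= eqxx.
      by rewrite big1 ?addr0// => i /negPf il; rewrite il mul0r.
    ring.
  have := oF c' (b - g * v).
  under eq_fun do under eq_RintegralT do rewrite -(e (fun i => y_ _ i _)).
  by under [in X in _ --> X -> _]eq_RintegralT do rewrite -(e (fun i => y i _)).
- rewrite (_ : _ \o _ = fun g => (B%:E * (normal_pdf 0 s^-1 g)%:E)%E)//.
  exact: (integrableZl measurableT _ (integrable_normal_pdf 0 s^-1)).
- move=> n g; rewrite normrM (ger0_norm (normal_pdf_ge0 _ _ _)).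
  rewrite ler_wpM2r ?normal_pdf_ge0//.
  by rewrite (le_trans _ (FB n))//; exact: fourier_bound.
Qed.

Lemma osc_cvg_window (F_ : nat -> T1 -> R) (F : T2 -> R) (l : 'I_k) (r : R) :
  (forall n, measurable_fun setT (F_ n)) -> measurable_fun setT F ->
  (forall n x, 0 <= F_ n x <= 1) -> (forall x, 0 <= F x <= 1) ->
  (forall v s : R, s != 0 -> osc_cvg (fun n x => F_ n x * normal_pdf v s (y_ n l x))
    (fun x => F x * normal_pdf v s (y l x))) ->
  osc_cvg (fun n x => F_ n x * window r (y_ n l x)) (fun x => F x * window r (y l x)).
Proof.
move=> mF_ mF F_01 F01 oF c b.
(* Mollification of width [del m ^+ 2], the relation between width and strip assumed by
   [mollifier_error]. *)
pose del (m : nat) : R := m.+1%:R^-1.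
have del0 m : 0 < del m by rewrite invr_gt0.
have s0 m : del m ^+ 2 != 0 by rewrite sqrf_eq0 gt_eqF.
pose a_ m n := \int[mu_ n]_x (F_ n x * cos (\sum_i c i * y_ n i x + b) *
   mollified_window r (del m ^+ 2) (y_ n l x)).
pose a m := \int[mu]_x (F x * cos (\sum_i c i * y i x + b) *
   mollified_window r (del m ^+ 2) (y l x)).
apply: (@cvg_approx _ _ _ a_ a (fun m => 4 * del m + 4 * `|r| * del m ^+ 2)).
- move=> m; rewrite /a_ /a.
  under eq_fun => n do rewrite (Rintegral_mollified r (s0 m) (mF_ n) (mphase_ n c b) (my_ n l) (F_01 n) (@marg_ n l)).
  rewrite (Rintegral_mollified r (s0 m) mF (mphase c b) (my l) F01 (@marg l)).
  apply: (@Rdominated_cvg _ _ _ leb _ _ (window r)).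
  + by move=> n; exact: (measurable_mollified r _ (mF_ n) (mphase_ n c b) (my_ n l) (F_01 n) (@marg_ n l)).
  + move=> v; apply: cvgM; first exact: cvg_cst.
    have := oF v _ (s0 m) c b.
    under eq_fun do under eq_RintegralT do rewrite mulrAC.
    by under [in X in _ --> X -> _]eq_RintegralT do rewrite mulrAC.
  + exact: integrable_window.
  + by move=> n v; exact: (mollified_bound r _ (mF_ n) (mphase_ n c b) (my_ n l) (F_01 n) (@marg_ n l)).
- move=> m n; apply: le_trans (mollifier_error r (del0 m)).
  exact: (mollified_error r (s0 m) (mF_ n) (mphase_ n c b) (my_ n l) (F_01 n) (@marg_ n l)).
- move=> m; apply: le_trans (mollifier_error r (del0 m)).
  exact: (mollified_error r (s0 m) mF (mphase c b) (my l) F01 (@marg l)).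
- have d0 : del m @[m --> \oo] --> (0:R) by exact: cvg_harmonic.
  rewrite -[X in _ --> X](_ : 4 * 0 + 4 * `|r| * 0 ^+ 2 = 0); last by rewrite expr0n/= !mulr0 addr0.
  apply: cvgD; first by apply: cvgM; [exact: cvg_cst|exact: d0].
  by apply: cvgM; [exact: cvg_cst|apply: cvgM; exact: d0].
Qed.

Lemma eq_osc_cvg (F_ G_ : nat -> T1 -> R) (F G : T2 -> R) :
  (forall n x, F_ n x = G_ n x) -> (forall x, F x = G x) ->
  osc_cvg F_ F -> osc_cvg G_ G.
Proof.
move=> FG_ FG; have -> : G_ = F_ by apply/funext => n; apply/funext => x.
by have -> : G = F by apply/funext => x.
Qed.

Lemma osc_cvgB (F_ G_ : nat -> T1 -> R) (F G : T2 -> R) :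
  (forall n, (mu_ n).-integrable setT (EFin \o F_ n)) ->
  (forall n, (mu_ n).-integrable setT (EFin \o G_ n)) ->
  mu.-integrable setT (EFin \o F) -> mu.-integrable setT (EFin \o G) ->
  osc_cvg F_ F -> osc_cvg G_ G ->
  osc_cvg (fun n x => F_ n x - G_ n x) (fun x => F x - G x).
Proof.
move=> iF_ iG_ iF iG oF oG c b.
have ic d (T : measurableType d) (nu : {sigma_finite_measure set T -> \bar R})
    (f A : T -> R) : nu.-integrable setT (EFin \o f) -> measurable_fun setT A ->
    nu.-integrable setT (EFin \o (fun x => f x * cos (A x))).
  move=> fi mA; have mf : measurable_fun setT f by apply/measurable_EFinP; exact: measurable_int fi.
  apply: (@integrable_le _ _ _ nu _ (fun x => `|f x|)).
  - apply: measurable_funM => //; apply: measurableT_comp mA.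
    by apply: continuous_measurable_fun; exact: continuous_cos.
  - by move=> x; rewrite normrM ler_piMr// cos_max.
  - exact: integrable_abse fi.
have e d (T : measurableType d) (nu : {sigma_finite_measure set T -> \bar R})
    (f g A : T -> R) : nu.-integrable setT (EFin \o f) ->
    nu.-integrable setT (EFin \o g) -> measurable_fun setT A ->
    \int[nu]_x ((f x - g x) * cos (A x)) =
    \int[nu]_x (f x * cos (A x)) - \int[nu]_x (g x * cos (A x)).
  move=> fi gi mA; rewrite -RintegralB//; [|exact: ic..].
  by apply: eq_RintegralT => x; rewrite mulrBl.
under eq_fun => n do rewrite (e _ _ _ _ _ _ (iF_ n) (iG_ n) (mphase_ n c b)).
rewrite (e _ _ _ _ _ _ iF iG (mphase c b)).
by apply: cvgB; [exact: oF|exact: oG].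
Qed.

Hypothesis base : forall (j : 'I_k) (v s : R), s != 0 ->
  osc_cvg (fun n x => normal_pdf v s (y_ n j x)) (fun x => normal_pdf v s (y j x)).
Variable r : 'I_k -> R.

Let miss (s : seq 'I_k) (z : 'I_k -> R) : R := \prod_(i <- s) (1 - window (r i) (z i)).

Let miss01 s z : 0 <= miss s z <= 1.
Proof.
rewrite /miss; elim: s => [|i s /andP[IH0 IH1]]; first by rewrite big_nil ler01 lexx.
rewrite big_cons; have := window_ge0 (r i) (z i); have := window_le1 (r i) (z i) => w1 w0.
by rewrite mulr_ge0 ?subr_ge0//= mulr_ile1// ?subr_ge0// gerBl.
Qed.

Let F01 j s z : 0 <= window (r j) (z j) * miss s z <= 1.
Proof.
have /andP[h0 h1] := miss01 s z; rewrite mulr_ge0 ?window_ge0//=.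
by rewrite mulr_ile1// ?window_ge0// window_le1.
Qed.

Let measurable_miss d (T : measurableType d) (z : 'I_k -> T -> R) s :
  (forall i, measurable_fun setT (z i)) -> measurable_fun setT (fun x => miss s (z ^~ x)).
Proof.
move=> mz; rewrite /miss; apply: measurable_prod => i _.
apply: measurable_funB => //; apply: measurableT_comp (mz i).
exact: measurable_window.
Qed.

Let measurable_F d (T : measurableType d) (z : 'I_k -> T -> R) j s :
  (forall i, measurable_fun setT (z i)) ->
  measurable_fun setT (fun x => window (r j) (z j x) * miss s (z ^~ x)).
Proof.
move=> mz; apply: measurable_funM; last exact: measurable_miss.
by apply: measurableT_comp (mz j); exact: measurable_window.
Qed.

Let F_le j s z : `|window (r j) (z j) * miss s z| <= window (r j) (z j).
Proof.
have /andP[h0 h1] := miss01 s z; rewrite ger0_norm; last by have /andP[] := F01 j s z.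
by rewrite ler_piMr// window_ge0.
Qed.

Let integrable_F_ n j s : (mu_ n).-integrable setT
  (EFin \o (fun x => window (r j) (y_ n j x) * miss s (fun i => y_ n i x))).
Proof.
apply: (@integrable_le _ _ _ (mu_ n) _ (fun x => window (r j) (y_ n j x))).
- exact: (measurable_F j s (my_ n)).
- by move=> x; exact: (F_le j s (fun i => y_ n i x)).
- exact: (integrable_marginal (my_ n j) (@marg_ n j) (integrable_window (r j)) (window_ge0 (r j))).
Qed.

Let integrable_F j s : mu.-integrable setT
  (EFin \o (fun x => window (r j) (y j x) * miss s (fun i => y i x))).
Proof.
apply: (@integrable_le _ _ _ mu _ (fun x => window (r j) (y j x))).
- exact: (measurable_F j s my).
- by move=> x; exact: (F_le j s (fun i => y i x)).
- exact: (integrable_marginal (my j) (@marg j) (integrable_window (r j)) (window_ge0 (r j))).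
Qed.

(** The window in coordinate [j] makes the masses finite and uniformly bounded, as
    [osc_cvg_normal_pdf] requires for every further factor. Before it is present the function is the
    constant 1, which an infinite [mu] does not integrate; there the Gaussian stage is the
    hypothesis [base]. *)
Let osc_cvg_F j s : osc_cvg
  (fun n x => window (r j) (y_ n j x) * miss s (fun i => y_ n i x))
  (fun x => window (r j) (y j x) * miss s (fun i => y i x)).
Proof.
elim: s => [|i s IH].
  apply: (@eq_osc_cvg (fun n x => 1 * window (r j) (y_ n j x)) _
    (fun x => 1 * window (r j) (y j x))).
  - by move=> n x; rewrite /miss big_nil mul1r mulr1.
  - by move=> x; rewrite /miss big_nil mul1r mulr1.
  apply: (@osc_cvg_window (fun _ _ => 1) (fun=> 1)) => //.
  - by move=> *; rewrite ler01 lexx.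
  - by move=> *; rewrite ler01 lexx.
  - move=> v s s0; apply: (@eq_osc_cvg (fun n x => normal_pdf v s (y_ n j x)) _
      (fun x => normal_pdf v s (y j x))) => [n x|x|]; rewrite ?mul1r//.
    exact: base.
have osc_w : osc_cvg
   (fun n x => window (r j) (y_ n j x) * miss s (fun i => y_ n i x) * window (r i) (y_ n i x))
   (fun x => window (r j) (y j x) * miss s (fun i => y i x) * window (r i) (y i x)).
  apply: (@osc_cvg_window
    (fun n x => window (r j) (y_ n j x) * miss s (fun i => y_ n i x))
    (fun x => window (r j) (y j x) * miss s (fun i => y i x))).
  - by move=> n; exact: (measurable_F j s (my_ n)).
  - exact: (measurable_F j s my).
  - by move=> n x; exact: (F01 j s (fun i => y_ n i x)).
  - by move=> x; exact: (F01 j s (fun i => y i x)).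
  - move=> v s' s0; apply: (@osc_cvg_normal_pdf _ _ (\int[leb]_v window (r j) v) i v s' s0
      (fun n => integrable_F_ n j s) (integrable_F j s) _ IH).
    move=> n; apply: le_trans (Rintegral_marginal (my_ n j) (@marg_ n j)
      (integrable_window (r j)) (window_ge0 (r j))).
    apply: le_Rintegral => //.
    + exact: integrable_abse (integrable_F_ n j s).
    + exact: (integrable_marginal (my_ n j) (@marg_ n j) (integrable_window (r j)) (window_ge0 (r j))).
    + by move=> x _; exact: (F_le j s (fun i => y_ n i x)).
have iwn n : (mu_ n).-integrable setT (EFin \o (fun x =>
    window (r j) (y_ n j x) * miss s (fun i => y_ n i x) * window (r i) (y_ n i x))).
  apply: (@integrable_le _ _ _ (mu_ n) _ (fun x => window (r j) (y_ n j x) * miss s (fun i => y_ n i x))) => //.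
    apply: measurable_funM; first exact: (measurable_F j s (my_ n)).
    by apply: measurableT_comp (my_ n i); exact: measurable_window.
  move=> x; have /andP[h0 _] := F01 j s (fun i => y_ n i x).
  by rewrite ger0_norm ?(mulr_ge0 h0 (window_ge0 _ _))// ler_piMr// window_le1.
  exact: integrable_F_.
have iw : mu.-integrable setT (EFin \o (fun x =>
    window (r j) (y j x) * miss s (fun i => y i x) * window (r i) (y i x))).
  apply: (@integrable_le _ _ _ mu _ (fun x => window (r j) (y j x) * miss s (fun i => y i x))) => //.
    apply: measurable_funM; first exact: (measurable_F j s my).
    by apply: measurableT_comp (my i); exact: measurable_window.
  move=> x; have /andP[h0 _] := F01 j s (fun i => y i x).
  by rewrite ger0_norm ?(mulr_ge0 h0 (window_ge0 _ _))// ler_piMr// window_le1.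
have e z : window (r j) (z j) * miss (i :: s) z =
   window (r j) (z j) * miss s z - window (r j) (z j) * miss s z * window (r i) (z i).
  by rewrite /miss big_cons; ring.
have := osc_cvgB (fun n => integrable_F_ n j s) iwn (integrable_F j s) iw IH osc_w.
apply: eq_osc_cvg => [n x|x]; first by rewrite (e (fun i => y_ n i x)).
by rewrite (e (fun i => y i x)).
Qed.

Let integrable_hit d (T : measurableType d) (nu : {sigma_finite_measure set T -> \bar R})
    (z : 'I_k -> T -> R) s :
  (forall j s, nu.-integrable setT (EFin \o (fun x => window (r j) (z j x) * miss s (z ^~ x)))) ->
  nu.-integrable setT (EFin \o (fun x => 1 - miss s (z ^~ x))).
Proof.
move=> iz; elim: s => [|i s IH].
  rewrite (_ : _ \o _ = cst 0%E); first exact: integrable0.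
  by apply/funext => x; rewrite /miss/= big_nil subrr.
rewrite (_ : _ \o _ = (fun x => (1 - miss s (z ^~ x))%:E +
    (window (r i) (z i x) * miss s (z ^~ x))%:E)%E).
  exact: (integrableD measurableT IH (iz i s)).
by apply/funext => x; rewrite /miss/= big_cons -EFinD; congr EFin; ring.
Qed.

(** Removing the factors one by one writes [1 - \prod] as a sum of terms [window * miss], each
    localized by its own window and covered by [osc_cvg_F]. *)
Lemma cvg_hit (s : seq 'I_k) :
  \int[mu_ n]_x (1 - \prod_(i <- s) (1 - window (r i) (y_ n i x))) @[n --> \oo] -->
  \int[mu]_x (1 - \prod_(i <- s) (1 - window (r i) (y i x))).
Proof.
have e d (T : measurableType d) (nu : {sigma_finite_measure set T -> \bar R})
    (z : 'I_k -> T -> R) i s' :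
    (forall j s, nu.-integrable setT (EFin \o (fun x => window (r j) (z j x) * miss s (z ^~ x)))) ->
    \int[nu]_x (1 - miss (i :: s') (z ^~ x)) = \int[nu]_x (1 - miss s' (z ^~ x)) +
    \int[nu]_x (window (r i) (z i x) * miss s' (z ^~ x)).
  move=> iz; rewrite -RintegralD//; last exact: integrable_hit.
  by apply: eq_RintegralT => x; rewrite /miss big_cons; ring.
elim: s => [|i s IH].
  have z0 d (T : measurableType d) (nu : {sigma_finite_measure set T -> \bar R})
      (z : 'I_k -> T -> R) : \int[nu]_x (1 - miss [::] (z ^~ x)) = 0.
    rewrite -[RHS](mul0r (fine (nu setT))) -Rintegral_cst//.
    by apply: eq_RintegralT => x; rewrite /miss big_nil subrr.
  under eq_fun => n do rewrite (z0 _ _ (mu_ n) (y_ n)).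
  by rewrite (z0 _ _ mu y); exact: cvg_cst.
under eq_fun => n do rewrite (e _ _ (mu_ n) (y_ n) i s (integrable_F_ n)).
rewrite (e _ _ mu y i s integrable_F); apply: cvgD; first exact: IH.
(* At zero frequencies and zero phase the wave is the constant 1. *)
have := @osc_cvg_F i s (fun=> 0) 0.
have c1 (z : 'I_k -> R) a : a * cos (\sum_i (fun=> 0) i * z i + 0) = a.
  by rewrite big1 ?addr0 ?cos0 ?mulr1// => j _; rewrite mul0r.
under eq_fun => n do under eq_RintegralT => x do rewrite (c1 (fun i => y_ n i x)).
by under [in X in _ --> X -> _]eq_RintegralT => x do rewrite (c1 (fun i => y i x)).
Qed.

End oscillatory_convergence.

(** * Scaled Gaussian vectors with a uniform shift *)

Lemma Rintegral_mscale d (T : measurableType d) (R : realType)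
    (mu : {measure set T -> \bar R}) (c : {nonneg R}) (f : T -> R) :
  measurable_fun setT f -> mu.-integrable setT (EFin \o f) ->
  \int[mscale c mu]_x f x = c%:num * \int[mu]_x f x.
Proof.
move=> mf fi; have mfE : measurable_fun setT (EFin \o f) by exact/measurable_EFinP.
have fp : (\int[mu]_x ((EFin \o f)^\+ x) \is a fin_num)%E.
  by apply: integrable_pos_fin_num.
have fn : (\int[mu]_x ((EFin \o f)^\- x) \is a fin_num)%E.
  by apply: integrable_neg_fin_num.
rewrite /Rintegral integralE [in RHS]integralE.
rewrite !ge0_integral_mscale//; [|exact: measurable_funeneg|exact: measurable_funepos].
by rewrite -muleBr ?fin_num_adde_defr// fineM// fin_numB fp.
Qed.

Lemma RFubini2 d1 d2 (T1 : measurableType d1) (T2 : measurableType d2)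
    (R : realType) (m1 : {sigma_finite_measure set T1 -> \bar R})
    (m2 : {sigma_finite_measure set T2 -> \bar R}) (f : T1 * T2 -> R) :
  (m1 \x m2)%E.-integrable setT (EFin \o f) ->
  \int[sigma_finite_product m1 m2]_z f z = \int[m2]_y \int[m1]_x f (x, y).
Proof.
move=> fi; rewrite /Rintegral; congr fine.
transitivity (\int[m1 \x m2]_z (f z)%:E)%E; first by [].
rewrite -(integral21_prod_meas1 fi); apply: ae_eq_integral => //.
- exact: (measurable_fubini_G fi).
- apply/measurable_EFinP; apply: (@measurableT_comp _ _ _ _ _ _ fine) => //.
  exact: (measurable_fubini_G fi).
- have := ae_integrable2 fi; apply: filterS => y fy _.
  by rewrite fineK//; exact: (integrable_fin_num _ fy).
Qed.

Section translation.
Context (R : realType).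
Local Notation leb := (@lebesgue_measure R).

Let shift_ (z : R) : measurableTypeR R -> measurableTypeR R := fun u : R => u + z.

Let mshift (z : R) : measurable_fun setT (shift_ z).
Proof. exact: (@measurable_funD _ _ _ setT (fun u : R => u) (fun=> z)). Qed.

HB.instance Definition _ z := @isMeasurableFun.Build _ _ _ _ (shift_ z) (mshift z).

Lemma lebesgue_measure_translation (z : R) (B : set (measurableTypeR R)) :
  measurable B -> leb ((fun u : R => u + z) @^-1` B) = leb B.
Proof.
move=> mB; rewrite [RHS](lebesgue_measure_unique (mu := pushforward leb (shift_ z)))//.
move=> X /ocitvP[->|[[a b]/= ab ->]]; first by rewrite !measure0.
transitivity (leb (`]a - z, b - z]%classic : set R)).
  by rewrite !lebesgue_measure_itv/= !lte_fin ltrD2r ab -!EFinD; congr EFin; ring.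
congr (leb _); apply/seteqP; split => x /=; rewrite /shift_ !in_itv/=; lra.
Qed.

End translation.

Section translated_variable.
Context d (Omega : measurableType d) (R : realType) (P : probability Omega R).
Local Notation leb := (@lebesgue_measure R).

(** For each fixed sample point, [Z] merely translates Lebesgue measure. Every coordinate of the
    limit measure thus has exactly Lebesgue law, whatever the law of [Z]. *)
Lemma product_translation (Z : Omega -> R) (B : set (measurableTypeR R)) :
  measurable_fun setT Z -> measurable B ->
  sigma_finite_product leb P ((fun x => x.1 + Z x.2) @^-1` B) = leb B.
Proof.
move=> mZ mB.
have mf : measurable_fun setT (fun x : measurableTypeR R * Omega => x.1 + Z x.2 : measurableTypeR R).
  apply: (@measurable_funD _ _ _ setT (fun x : measurableTypeR R * Omega => x.1 : R) (fun x => Z x.2)).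
    exact: measurable_fst.
  by apply: measurableT_comp mZ _; exact: measurable_snd.
have mA := mf measurableT _ mB; rewrite setTI in mA.
transitivity ((leb \x^ P)%E ((fun x => x.1 + Z x.2) @^-1` B)).
  by apply: (@product_measure_unique _ _ _ _ _ leb P (leb \x^ P)%E) => // C D mC mD; exact: product_measure2E.
rewrite /product_measure2 (eq_integral (fun=> leb B)).
  rewrite integral_cst// -[RHS]mule1; congr (_ * _)%E; exact: probability_setT.
move=> w _ /=; rewrite -(lebesgue_measure_translation (Z w) mB); congr (leb _).
by apply/seteqP; split => u; rewrite /ysection/= ?inE.
Qed.

End translated_variable.

Section gaussian_density_bound.
Context d (Omega : measurableType d) (R : realType) (P : probability Omega R).
Local Notation leb := (@lebesgue_measure R).

Lemma gaussian_law_le (m s : R) (B : set (measurableTypeR R)) : s != 0 -> measurable B ->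
  (gaussian_law m s B <= (normal_peak s)%:E * leb B)%E.
Proof.
move=> s0 mB; rewrite /gaussian_law (negbTE s0) /normal_prob.
rewrite -integral_cst//; apply: ge0_le_integral => //.
- by move=> x _; rewrite lee_fin normal_pdf_ge0.
- by apply/measurable_EFinP; apply: measurable_funTS; exact: measurable_normal_pdf.
- by move=> x _; rewrite lee_fin normal_pdf_ub.
Qed.

End gaussian_density_bound.

Section explicit_limit.
Context (R : realType).
Local Notation leb := (@lebesgue_measure R).

Lemma Rintegral_normal_fun_cos (m s a b : R) : s != 0 ->
  \int[leb]_g (cos (a * g + b) * normal_fun m s g) =
  (normal_peak s)^-1 * (cos (a * m + b) * expR (- (s ^+ 2 * a ^+ 2 / 2))).
Proof.
move=> s0; rewrite -(normal_cos m s0 a b) -RintegralZl//.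
  apply: eq_RintegralT => x; rewrite normal_pdfE// mulrCA; congr (_ * _).
  by rewrite mulrA mulVf ?mul1r// gt_eqF// normal_peak_gt0.
apply: (@integrable_normal_cst _ m s s0 (fun x => cos (a * x + b)) 1).
  move=> x; apply: (@continuous_comp _ _ _ (fun g : R => a * g + b) cos).
    apply: cvgD; last exact: cvg_cst.
    by apply: cvgM; [exact: cvg_cst|exact: cvg_id].
  exact: continuous_cos.
by move=> x; exact: cos_max.
Qed.

Lemma integrable_normal_fun_cos (m s a b : R) : s != 0 ->
  leb.-integrable setT (EFin \o (fun g => cos (a * g + b) * normal_fun m s g)).
Proof.
move=> s0; rewrite (_ : _ \o _ = fun g =>
    ((normal_peak s)^-1%:E * (cos (a * g + b) * normal_pdf m s g)%:E)%E).
  apply: (integrableZl measurableT).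
  apply: (@integrable_normal_cst _ m s s0 (fun x => cos (a * x + b)) 1).
    move=> x; apply: (@continuous_comp _ _ _ (fun g : R => a * g + b) cos).
      apply: cvgD; last exact: cvg_cst.
      by apply: cvgM; [exact: cvg_cst|exact: cvg_id].
    exact: continuous_cos.
  by move=> x; exact: cos_max.
apply/funext => g; rewrite /= -EFinM normal_pdfE//; congr EFin.
by rewrite mulrCA mulKf// gt_eqF// normal_peak_gt0.
Qed.

(** Completing the square in [g]: the exponents combine into a Gaussian of variance
    [1 / (s^2 + a^2)] centred at [- m], times the constant [expR (- (K / 2))] with the abbreviations
    [m] and [K] of the proof. The tilt is the exponent found in [Y_moment]. *)
Lemma Rintegral_tilted (a C S W v b s : R) : s != 0 ->
  \int[leb]_g (cos (b - g * v) *
     expR (- (((g + C) ^+ 2 * a ^+ 2 - (g + C) * S + W) / 2)) * normal_pdf 0 s^-1 g) =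
  normal_peak s^-1 / normal_peak (Num.sqrt (s ^+ 2 + a ^+ 2))^-1 *
  expR (- (((4 * C ^+ 2 * a ^+ 2 * s ^+ 2 + 4 * C * a ^+ 2 * S - S ^+ 2) /
            (4 * (s ^+ 2 + a ^+ 2)) - C * S + W) / 2)) *
  (cos (b + (2 * C * a ^+ 2 - S) / (2 * (s ^+ 2 + a ^+ 2)) * v) *
   expR (- (v ^+ 2 / (2 * (s ^+ 2 + a ^+ 2))))).
Proof.
move=> s0; set L := s ^+ 2 + a ^+ 2.
have ss : 0 < s ^+ 2 by rewrite exprn_even_gt0.
have L0 : 0 < L by rewrite ltr_wpDr// sqr_ge0.
have Ln0 : L != 0 by rewrite gt_eqF.
have sL2 : Num.sqrt L ^+ 2 = L by rewrite sqr_sqrtr// ltW.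
have sL0 : Num.sqrt L != 0 by rewrite gt_eqF// sqrtr_gt0.
set m := (2 * C * a ^+ 2 - S) / (2 * L).
set K := _ - C * S + W.
have -> : \int[leb]_g (cos (b - g * v) *
     expR (- (((g + C) ^+ 2 * a ^+ 2 - (g + C) * S + W) / 2)) * normal_pdf 0 s^-1 g) =
   \int[leb]_g (normal_peak s^-1 * expR (- (K / 2)) *
     (cos ((- v) * g + b) * normal_fun (- m) (Num.sqrt L)^-1 g)).
  apply: eq_RintegralT => g; rewrite normal_pdfE ?invr_eq0// /normal_fun.
  have -> : cos (b - g * v) = cos (- v * g + b) by congr cos; ring.
  rewrite [LHS](_ : _ = normal_peak s^-1 * cos (- v * g + b) *
    (expR (- (((g + C) ^+ 2 * a ^+ 2 - (g + C) * S + W) / 2)) *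
     expR (- (g - 0) ^+ 2 / (s^-1 ^+ 2 *+ 2)))); last by ring.
  rewrite [RHS](_ : _ = normal_peak s^-1 * cos (- v * g + b) *
    (expR (- (K / 2)) * expR (- (g - - m) ^+ 2 / ((Num.sqrt L)^-1 ^+ 2 *+ 2)))); last by ring.
  congr (_ * _); rewrite -!expRD; congr expR.
  rewrite !exprVn sL2 /K /m /L; field.
  by rewrite -/L Ln0 s0.
rewrite RintegralZl//; last by apply: integrable_normal_fun_cos; rewrite invr_eq0.
rewrite Rintegral_normal_fun_cos ?invr_eq0//.
rewrite mulrA; congr (_ * _); first by ring.
rewrite exprVn sL2; congr (cos _ * expR _); first by rewrite /m; ring.
by field.
Qed.

End explicit_limit.

Lemma prod_miss01 (R : realType) (k : nat) (r z : 'I_k -> R) :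
  0 <= \prod_i (1 - window (r i) (z i)) <= 1.
Proof.
apply: (big_ind (fun x : R => 0 <= x <= 1)); first by rewrite ler01 lexx.
- by move=> x y /andP[x0 x1] /andP[y0 y1]; rewrite mulr_ge0//= mulr_ile1.
- by move=> i _; rewrite subr_ge0 window_le1 gerBl window_ge0.
Qed.

Section gaussian_base.
Context d (Omega : measurableType d) d' (Omega' : measurableType d') (R : realType).
Variables (P : probability Omega R) (P' : probability Omega' R) (k : nat).
Variables (Y : nat -> 'I_k -> Omega -> R) (Z : 'I_k -> Omega' -> R) (a : nat -> R)
  (w : nat -> {nonneg R}) (G : 'I_k -> 'I_k -> R).
Local Notation leb := (@lebesgue_measure R).
Hypotheses (a0 : forall n, 0 < a n) (wE : forall n, (w n)%:num = a n * Num.sqrt (2 * pi))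
  (ay : (a n ^+ 2)^-1 @[n --> \oo] --> 0)
  (mY : forall n j, measurable_fun setT (Y n j)) (mZ : forall j, measurable_fun setT (Z j))
  (Ycos : forall n (c : 'I_k -> R) b,
     \int[P]_x cos (\sum_j c j * Y n j x + b) =
     cos b * expR (- (\int[P]_x (\sum_j c j * Y n j x) ^+ 2 / 2)))
  (Zcos : forall (c : 'I_k -> R) b,
     \int[P']_x cos (\sum_j c j * Z j x + b) =
     cos b * expR (- (\int[P']_x (\sum_j c j * Z j x) ^+ 2 / 2)))
  (iY : forall n j, P.-integrable setT (EFin \o (fun x => Y n j x ^+ 2)))
  (Y1 : forall n j, \int[P]_x (Y n j x ^+ 2) = 1)
  (iYY : forall n i j, P.-integrable setT (EFin \o (fun x => (Y n i x - Y n j x) ^+ 2)))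
  (YG : forall i j, a n ^+ 2 * \int[P]_x (Y n i x - Y n j x) ^+ 2 @[n --> \oo] --> G i j)
  (iZZ : forall i j, P'.-integrable setT (EFin \o (fun x => (Z i x - Z j x) ^+ 2)))
  (ZG : forall i j, \int[P']_x (Z i x - Z j x) ^+ 2 = G i j).

(** Let [Q i j] be the second moment of [y i - y j]. By polarization [Wf Q c o] is the second moment
    of [\sum_i c i * (y i - y o)]; if all the [y i] have equal second moments, [- Sf Q c o] is twice
    the mean of the product of that sum with [y o]. *)
Let Sf (Q : 'I_k -> 'I_k -> R) (c : 'I_k -> R) (o : 'I_k) : R := \sum_i c i * Q i o.
Let Wf (Q : 'I_k -> 'I_k -> R) (c : 'I_k -> R) (o : 'I_k) : R :=
  \sum_i \sum_j c i * c j / 2 * (Q i o + Q j o - Q i j).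

Let W_integral e (T : measurableType e) (mu : probability T R) (y : 'I_k -> T -> R)
    (c : 'I_k -> R) o :
  (forall i j, mu.-integrable setT (EFin \o (fun x => (y i x - y j x) ^+ 2))) ->
  mu.-integrable setT (EFin \o (fun x => \sum_i \sum_j c i * c j / 2 *
     ((y i x - y o x) ^+ 2 + (y j x - y o x) ^+ 2 - (y i x - y j x) ^+ 2))) /\
  \int[mu]_x (\sum_i \sum_j c i * c j / 2 *
     ((y i x - y o x) ^+ 2 + (y j x - y o x) ^+ 2 - (y i x - y j x) ^+ 2)) =
  Wf (fun i j => \int[mu]_x (y i x - y j x) ^+ 2) c o.
Proof.
move=> iy.
have i3 i j : mu.-integrable setT (EFin \o (fun x =>
    (y i x - y o x) ^+ 2 + (y j x - y o x) ^+ 2 - (y i x - y j x) ^+ 2)).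
  rewrite (_ : _ \o _ = fun x => (((y i x - y o x) ^+ 2)%:E + ((y j x - y o x) ^+ 2)%:E -
    ((y i x - y j x) ^+ 2)%:E)%E)//.
  exact: (integrableB measurableT (integrableD measurableT (iy i o) (iy j o)) (iy i j)).
have e3 i j : \int[mu]_x (c i * c j / 2 *
    ((y i x - y o x) ^+ 2 + (y j x - y o x) ^+ 2 - (y i x - y j x) ^+ 2)) =
    c i * c j / 2 * (\int[mu]_x (y i x - y o x) ^+ 2 + \int[mu]_x (y j x - y o x) ^+ 2 -
      \int[mu]_x (y i x - y j x) ^+ 2).
  rewrite RintegralZl// RintegralB//; last first.
    rewrite (_ : _ \o _ = fun x => (((y i x - y o x) ^+ 2)%:E + ((y j x - y o x) ^+ 2)%:E)%E)//.
    exact: (integrableD measurableT (iy i o) (iy j o)).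
  by rewrite RintegralD.
have s1 i := Rintegral_sum (index_enum 'I_k) (fun j => RintegralZ (c i * c j / 2) (i3 i j)).
have [s2 s3] := Rintegral_sum (index_enum 'I_k) (fun i => (s1 i).1).
split => //; rewrite s3 /Wf; apply: eq_bigr => i _.
by rewrite (s1 i).2; apply: eq_bigr => j _; rewrite e3.
Qed.

(** Subtracting [(\sum_i c i) * Z o] makes the total weight zero. Only such combinations have a
    variance determined by [G]. *)
Let Z_moment (c : 'I_k -> R) o b :
  \int[P']_x cos (\sum_i c i * Z i x - (\sum_i c i) * Z o x + b) =
  cos b * expR (- (Wf G c o / 2)).
Proof.
have [C CE] : exists C, C = \sum_i c i by exists (\sum_i c i).
rewrite -CE; pose c' i := c i - (if i == o then C else 0).
have e x : \sum_i c i * Z i x - C * Z o x = \sum_i c' i * Z i x.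
  under [RHS]eq_bigr do rewrite mulrBl.
  rewrite big_split/=; congr (_ + _); rewrite [RHS](bigD1 o)//= eqxx.
  by rewrite big1 ?addr0// => i /negPf il; rewrite il mul0r oppr0.
under eq_RintegralT do rewrite e.
rewrite Zcos; congr (_ * expR (- (_ / 2))).
rewrite (_ : Wf G c o = Wf (fun i j => \int[P']_x (Z i x - Z j x) ^+ 2) c o); last first.
  by apply: eq_bigr => i _; apply: eq_bigr => j _; rewrite !ZG.
rewrite -(W_integral c o iZZ).2; apply: eq_RintegralT => x; rewrite -e.
have := square_combination c (fun i => Z i x) o (- C).
by rewrite -CE addNr expr0n/= !mul0r !add0r => <-; congr (_ ^+ 2); ring.
Qed.

Let Y_moment n (c : 'I_k -> R) o g b :
  let Q i j := a n ^+ 2 * \int[P]_x (Y n i x - Y n j x) ^+ 2 in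
  \int[P]_x cos (\sum_i c i * (a n * Y n i x) + g * (a n * Y n o x) + b) =
  cos b * expR (- (((g + \sum_i c i) ^+ 2 * a n ^+ 2 - (g + \sum_i c i) * Sf Q c o + Wf Q c o) / 2)).
Proof.
move=> Q; pose c' i := a n * (c i + (if i == o then g else 0)).
have e x : \sum_i c i * (a n * Y n i x) + g * (a n * Y n o x) = \sum_i c' i * Y n i x.
  have -> : \sum_i c' i * Y n i x =
      \sum_i (c i * (a n * Y n i x) + (if i == o then g else 0) * (a n * Y n i x)).
    by apply: eq_bigr => i _; rewrite /c'; move: (if _ then _ else _) => q; ring.
  rewrite big_split/=; congr (_ + _); rewrite [RHS](bigD1 o)//= eqxx.
  by rewrite big1 ?addr0// => i /negPf il; rewrite il mul0r.
under eq_RintegralT do rewrite e.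
rewrite Ycos; congr (_ * expR (- (_ / 2))).
have e2 x : (\sum_j c' j * Y n j x) ^+ 2 = a n ^+ 2 * (
   (g + \sum_i c i) ^+ 2 * Y n o x ^+ 2 +
   (g + \sum_i c i) * \sum_i c i * (Y n i x ^+ 2 - Y n o x ^+ 2 - (Y n i x - Y n o x) ^+ 2) +
   \sum_i \sum_j c i * c j / 2 *
     ((Y n i x - Y n o x) ^+ 2 + (Y n j x - Y n o x) ^+ 2 - (Y n i x - Y n j x) ^+ 2)).
  rewrite -square_combination -exprMn; congr (_ ^+ 2).
  rewrite -e mulrDr addrC; congr (_ + _); first by ring.
  by rewrite mulr_sumr; apply: eq_bigr => i _; ring.
have i3 i : P.-integrable setT (EFin \o (fun x => Y n i x ^+ 2 - Y n o x ^+ 2 - (Y n i x - Y n o x) ^+ 2)).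
  rewrite (_ : _ \o _ = fun x => ((Y n i x ^+ 2)%:E - (Y n o x ^+ 2)%:E - ((Y n i x - Y n o x) ^+ 2)%:E)%E)//.
  exact: (integrableB measurableT (integrableB measurableT (iY n i) (iY n o)) (iYY n i o)).
have [s1 s2] := Rintegral_sum (index_enum 'I_k) (fun i => RintegralZ (c i) (i3 i)).
have [w1 w2] := W_integral c o (iYY n).
have i4 := RintegralZ (g + \sum_i c i) s1.
have i5 := RintegralZ ((g + \sum_i c i) ^+ 2) (iY n o).
have i6 : P.-integrable setT (EFin \o (fun x => (g + \sum_i c i) ^+ 2 * Y n o x ^+ 2 +
   (g + \sum_i c i) * \sum_i c i * (Y n i x ^+ 2 - Y n o x ^+ 2 - (Y n i x - Y n o x) ^+ 2))).
  exact: (integrableD measurableT i5 i4).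
rewrite (eq_RintegralT _ e2) RintegralZl//; last exact: (integrableD measurableT i6 w1).
rewrite RintegralD// w2 RintegralD// !RintegralZl// Y1 s2.
have -> : \sum_(i <- index_enum 'I_k) \int[P]_x (c i * (Y n i x ^+ 2 - Y n o x ^+ 2 - (Y n i x - Y n o x) ^+ 2)) =
    - \sum_i c i * \int[P]_x (Y n i x - Y n o x) ^+ 2.
  rewrite -sumrN; apply: eq_bigr => i _; rewrite RintegralZl// RintegralB//; last first.
    exact: (integrableB measurableT (iY n i) (iY n o)).
  by rewrite RintegralB// !Y1; ring.
have -> : Sf Q c o = a n ^+ 2 * \sum_i c i * \int[P]_x (Y n i x - Y n o x) ^+ 2.
  by rewrite mulr_sumr; apply: eq_bigr => i _; rewrite /Q; ring.
have -> : Wf Q c o = a n ^+ 2 * Wf (fun i j => \int[P]_x (Y n i x - Y n j x) ^+ 2) c o.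
  rewrite mulr_sumr; apply: eq_bigr => i _; rewrite mulr_sumr; apply: eq_bigr => j _.
  by rewrite /Q; ring.
ring.
Qed.

Let mu_ n : {sigma_finite_measure set Omega -> \bar R} := mscale (w n) P.
Let mu : {sigma_finite_measure set (measurableTypeR R * Omega')%type -> \bar R} :=
  sigma_finite_product leb P'.
Let y_ n j x := a n * Y n j x.
Let y j (z : measurableTypeR R * Omega') := z.1 + Z j z.2.

Lemma measurable_scaled n j : measurable_fun setT (y_ n j).
Proof. exact: measurable_funM. Qed.

Lemma measurable_translated j : measurable_fun setT (y j).
Proof.
apply: (@measurable_funD _ _ _ setT (fun x : measurableTypeR R * Omega' => x.1 : R) (fun x => Z j x.2)).
  exact: measurable_fst.
by apply: measurableT_comp (mZ j) _; exact: measurable_snd.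
Qed.

Let marginal_translated j (B : set (measurableTypeR R)) : measurable B ->
  (mu (y j @^-1` B) <= leb B)%E.
Proof. by move=> mB; rewrite /mu /y product_translation. Qed.

(** The peaks combine with the weight to [a n / sqrt (s^2 + a n ^+ 2)], which tends to 1: the weight
    [a n * sqrt (2 pi)] is the right order of growth, with the right constant. *)
Let weight_constant n s : s != 0 ->
  (w n)%:num * (normal_peak s * (normal_peak s^-1 / normal_peak (Num.sqrt (s ^+ 2 + a n ^+ 2))^-1)) =
  (Num.sqrt (s ^+ 2 * (a n ^+ 2)^-1 + 1))^-1.
Proof.
move=> s0; rewrite wE /normal_peak.
have an := a0 n; have ss : 0 < s ^+ 2 by rewrite exprn_even_gt0.
set L := s ^+ 2 + a n ^+ 2; have L0 : 0 < L by rewrite ltr_wpDr// sqr_ge0.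
have pi0 : 0 < pi :> R by exact: pi_gt0.
have r0 : 0 < Num.sqrt (2 * pi) :> R by rewrite sqrtr_gt0 mulr_gt0.
have e1 : Num.sqrt (s ^+ 2 * pi *+ 2) = `|s| * Num.sqrt (2 * pi).
  by rewrite -mulr_natl mulrCA sqrtrM ?sqr_ge0// sqrtr_sqr.
have e2 : Num.sqrt (s^-1 ^+ 2 * pi *+ 2) = `|s|^-1 * Num.sqrt (2 * pi).
  by rewrite -mulr_natl mulrCA sqrtrM ?sqr_ge0// sqrtr_sqr normfV.
have e3 : Num.sqrt ((Num.sqrt L)^-1 ^+ 2 * pi *+ 2) = (Num.sqrt L)^-1 * Num.sqrt (2 * pi).
  by rewrite -mulr_natl mulrCA sqrtrM ?sqr_ge0// sqrtr_sqr ger0_norm// invr_ge0 sqrtr_ge0.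
have -> : s ^+ 2 * (a n ^+ 2)^-1 + 1 = (a n ^+ 2)^-1 * L.
  by rewrite /L; field; rewrite gt_eqF.
have e4 : Num.sqrt ((a n ^+ 2)^-1 * L) = (a n)^-1 * Num.sqrt L.
  by rewrite sqrtrM ?invr_ge0 ?sqr_ge0// -exprVn sqrtr_sqr gtr0_norm// invr_gt0.
rewrite e1 e2 e3 e4.
by field; rewrite !gt_eqF ?normr_gt0// sqrtr_gt0.
Qed.

(** For fixed [Z], integrating [u] first makes [u + Z o] normal with mean [v]. The other coordinates
    differ from it by [Z i - Z o], so [Z_moment] applies. *)
Let limit_integral o v s (c : 'I_k -> R) b : s != 0 ->
  \int[mu]_z (normal_pdf v s (y o z) * cos (\sum_i c i * y i z + b)) =
  cos (b + (\sum_i c i) * v) * expR (- (s ^+ 2 * (\sum_i c i) ^+ 2 / 2)) * expR (- (Wf G c o / 2)).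
Proof.
move=> s0; rewrite RFubini2; last first.
  apply: (@integrable_le _ _ _ mu _ (fun z => normal_pdf v s (y o z))).
  - apply: measurable_funM.
      by apply: measurableT_comp (measurable_translated o); exact: measurable_normal_pdf.
    apply: measurableT_comp; first by apply: continuous_measurable_fun; exact: continuous_cos.
    apply: measurable_funD => //; apply: measurable_sum => i.
    by apply: measurable_funM => //; exact: measurable_translated.
  - move=> z; rewrite normrM (ger0_norm (normal_pdf_ge0 _ _ _)).
    by rewrite ler_piMr ?normal_pdf_ge0// cos_max.
  - apply: (integrable_marginal (measurable_translated o) (@marginal_translated o) (integrable_normal_pdf v s)).
    by move=> x; exact: normal_pdf_ge0.
transitivity (\int[P']_x (expR (- (s ^+ 2 * (\sum_i c i) ^+ 2 / 2)) *
   cos (\sum_i c i * Z i x - (\sum_i c i) * Z o x + (b + (\sum_i c i) * v)))).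
  apply: eq_RintegralT => x; rewrite /y/=.
  transitivity (\int[leb]_u (cos ((\sum_i c i) * u + (\sum_i c i * Z i x + b)) * normal_pdf (v - Z o x) s u)).
    apply: eq_RintegralT => u; rewrite mulrC; congr (cos _ * _).
      by rewrite addrA mulr_suml -big_split/=; congr (_ + _); apply: eq_bigr => i _; ring.
    by rewrite !normal_pdfE// /normal_fun opprB [_ + (Z o x - v)]addrA.
  by rewrite normal_cos// mulrC; congr (_ * cos _); ring.
rewrite RintegralZl//.
  by rewrite Z_moment; ring.
apply: (@integrable_le _ _ _ P' _ (fun=> 1)).
- apply: measurableT_comp; first by apply: continuous_measurable_fun; exact: continuous_cos.
  apply: measurable_funD => //; apply: measurable_funB; last exact: measurable_funM.
  by apply: measurable_sum => i; exact: measurable_funM.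
- by move=> x; exact: cos_max.
- exact: finite_measure_integrable_cst.
Qed.

(** [Rintegral_tilted] rewritten in terms of [e = a n ^- 2], after division of numerators and
    denominators by [a n ^+ 2]: nothing diverges any more and the limit is the value at [e = 0]. *)
Let array_integral n o v s (c : 'I_k -> R) b : s != 0 ->
  let Q i j := a n ^+ 2 * \int[P]_x (Y n i x - Y n j x) ^+ 2 in
  let C := \sum_i c i in let e := (a n ^+ 2)^-1 in
  \int[mu_ n]_x (normal_pdf v s (y_ n o x) * cos (\sum_i c i * y_ n i x + b)) =
  (Num.sqrt (s ^+ 2 * e + 1))^-1 *
  (expR (- (((4 * C ^+ 2 * s ^+ 2 + 4 * C * Sf Q c o - Sf Q c o ^+ 2 * e) /
            (4 * (s ^+ 2 * e + 1)) - C * Sf Q c o + Wf Q c o) / 2)) *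
  (cos (b + (2 * C - Sf Q c o * e) / (2 * (s ^+ 2 * e + 1)) * v) *
   expR (- (v ^+ 2 * e / (2 * (s ^+ 2 * e + 1)))))).
Proof.
move=> s0 Q C e.
have mphase : measurable_fun setT (fun x => \sum_i c i * y_ n i x + b).
  apply: measurable_funD => //; apply: measurable_sum => i.
  by apply: measurable_funM => //; exact: measurable_scaled.
have mpdf : measurable_fun setT (fun x => normal_pdf v s (y_ n o x)).
  by apply: measurableT_comp (measurable_scaled n o); exact: measurable_normal_pdf.
have mcos : measurable_fun setT (fun x => cos (\sum_i c i * y_ n i x + b)).
  by apply: measurableT_comp mphase; apply: continuous_measurable_fun; exact: continuous_cos.
rewrite /mu_ Rintegral_mscale//; first last.
- apply: (@integrable_le _ _ _ P _ (fun=> normal_peak s)).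
  + exact: measurable_funM.
  + move=> x; rewrite normrM (ger0_norm (normal_pdf_ge0 _ _ _)).
    rewrite (le_trans _ (normal_pdf_ub v (y_ n o x) s0))// ler_piMr ?normal_pdf_ge0//.
    exact: cos_max.
  + exact: finite_measure_integrable_cst.
- exact: measurable_funM.
have one : P.-integrable setT (EFin \o (fun=> 1 : R)) by exact: finite_measure_integrable_cst.
have -> : \int[P]_x (normal_pdf v s (y_ n o x) * cos (\sum_i c i * y_ n i x + b)) =
   \int[P]_x (1 * normal_pdf v s (y_ n o x) * cos (\sum_i c i * y_ n i x + b)).
  by apply: eq_RintegralT => x; rewrite mul1r.
rewrite (Rintegral_fourier_pdf v s0 mphase (measurable_scaled n o) one).
have -> : \int[leb]_g (\int[P]_x (1 * cos (\sum_i c i * y_ n i x + b + g * (y_ n o x - v))) *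
     normal_pdf 0 s^-1 g) =
   \int[leb]_g (cos (b - g * v) * expR (- (((g + C) ^+ 2 * a n ^+ 2 - (g + C) * Sf Q c o + Wf Q c o) / 2)) *
     normal_pdf 0 s^-1 g).
  apply: eq_RintegralT => g; congr (_ * _).
  have := Y_moment n c o g (b - g * v); rewrite -/Q -/C => <-.
  apply: eq_RintegralT => x; rewrite mul1r; congr cos; rewrite /y_; ring.
rewrite Rintegral_tilted//.
have ss : 0 < s ^+ 2 by rewrite exprn_even_gt0.
have an0 : a n != 0 by rewrite gt_eqF.
have an2 : 0 < a n ^+ 2 by rewrite exprn_gt0.
have L0 : s ^+ 2 + a n ^+ 2 != 0 by rewrite gt_eqF// addr_gt0.
have L1 : s ^+ 2 * e + 1 != 0 by rewrite gt_eqF// addr_gt0// mulr_gt0// invr_gt0.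
have Le : s ^+ 2 * e + 1 = e * (s ^+ 2 + a n ^+ 2) by rewrite /e; field.
set S := Sf Q c o; set W := Wf Q c o.
have eK : (4 * C ^+ 2 * a n ^+ 2 * s ^+ 2 + 4 * C * a n ^+ 2 * S - S ^+ 2) /
    (4 * (s ^+ 2 + a n ^+ 2)) =
    (4 * C ^+ 2 * s ^+ 2 + 4 * C * S - S ^+ 2 * e) / (4 * (s ^+ 2 * e + 1)).
  by rewrite Le /e; field; rewrite an0 L0.
have em : (2 * C * a n ^+ 2 - S) / (2 * (s ^+ 2 + a n ^+ 2)) =
    (2 * C - S * e) / (2 * (s ^+ 2 * e + 1)).
  by rewrite Le /e; field; rewrite an0 L0.
have ev : v ^+ 2 / (2 * (s ^+ 2 + a n ^+ 2)) = v ^+ 2 * e / (2 * (s ^+ 2 * e + 1)).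
  by rewrite Le /e; field; rewrite an0 L0.
by rewrite eK em ev -weight_constant// !mulrA.
Qed.

Let gaussian_base o v s : s != 0 ->
  osc_cvg mu_ mu y_ y (fun n x => normal_pdf v s (y_ n o x)) (fun z => normal_pdf v s (y o z)).
Proof.
move=> s0 c b; rewrite limit_integral//.
under eq_fun => n do rewrite array_integral//.
set C := \sum_i c i.
pose Q n i j := a n ^+ 2 * \int[P]_x (Y n i x - Y n j x) ^+ 2.
have cS : Sf (Q n) c o @[n --> \oo] --> Sf G c o.
  by apply: cvg_big => [|i _]; [exact: add_continuous|apply: cvgM; [exact: cvg_cst|exact: YG]].
have cW : Wf (Q n) c o @[n --> \oo] --> Wf G c o.
  apply: cvg_big => [|i _]; first exact: add_continuous.
  apply: cvg_big => [|j _]; first exact: add_continuous.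
  apply: cvgM; first exact: cvg_cst.
  by apply: cvgB; [apply: cvgD|]; exact: YG.
have c1 : s ^+ 2 * (a n ^+ 2)^-1 + 1 @[n --> \oo] --> (1 : R).
  rewrite -[X in _ --> X]add0r -[X in _ --> X + _](mulr0 (s ^+ 2)).
  by apply: cvgD; [apply: cvgM; [exact: cvg_cst|exact: ay]|exact: cvg_cst].
have cSe : Sf (Q n) c o * (a n ^+ 2)^-1 @[n --> \oo] --> (0 : R).
  by rewrite -[X in _ --> X](mulr0 (Sf G c o)); apply: cvgM.
have cexp (u : nat -> R) l : u n @[n --> \oo] --> l -> expR (u n) @[n --> \oo] --> expR l.
  by move=> ul; apply: (cvg_comp _ _ ul); exact: continuous_expR.
(* The right-hand side is the formula of [array_integral] at [e = 0]. There the two terms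
   [C * Sf G c o] cancel, so the limit sees only [Wf]. *)
have -> : cos (b + C * v) * expR (- (s ^+ 2 * C ^+ 2 / 2)) * expR (- (Wf G c o / 2)) = 1^-1 * (expR (- (((4 * C ^+ 2 * s ^+ 2 + 4 * C * Sf G c o - Sf G c o * 0) /
            (4 * 1) - C * Sf G c o + Wf G c o) / 2)) *
  (cos (b + (2 * C - 0) / (2 * 1) * v) * expR (- (v ^+ 2 * 0 / (2 * 1))))).
  rewrite !mulr0 !subr0 mul0r oppr0 expR0 !mulr1 invr1 mul1r mulrAC -mulrA -expRD [RHS]mulrC.
  by congr (cos _ * expR _); field.
have c2 : (2 * (s ^+ 2 * (a n ^+ 2)^-1 + 1))^-1 @[n --> \oo] --> ((2 * 1)^-1 : R).
  by apply: cvgV; [rewrite mulr1 pnatr_eq0|apply: cvgM; [exact: cvg_cst|exact: c1]].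
have c4 : (4 * (s ^+ 2 * (a n ^+ 2)^-1 + 1))^-1 @[n --> \oo] --> ((4 * 1)^-1 : R).
  by apply: cvgV; [rewrite mulr1 pnatr_eq0|apply: cvgM; [exact: cvg_cst|exact: c1]].
have cSSe : Sf (Q n) c o ^+ 2 * (a n ^+ 2)^-1 @[n --> \oo] --> Sf G c o * 0.
  have e n : Sf (Q n) c o ^+ 2 * (a n ^+ 2)^-1 = Sf (Q n) c o * (Sf (Q n) c o * (a n ^+ 2)^-1).
    by rewrite expr2 mulrA.
  by under eq_fun do rewrite e; apply: cvgM; [exact: cS|exact: cSe].
have h1 : (Num.sqrt (s ^+ 2 * (a n ^+ 2)^-1 + 1))^-1 @[n --> \oo] --> (1^-1 : R).
  apply: cvgV; first exact: oner_neq0.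
  rewrite -[X in _ --> X]sqrtr1; apply: (cvg_comp _ _ c1); exact: sqrt_continuous.
have h2 : expR (- (((4 * C ^+ 2 * s ^+ 2 + 4 * C * Sf (Q n) c o - Sf (Q n) c o ^+ 2 * (a n ^+ 2)^-1) /
            (4 * (s ^+ 2 * (a n ^+ 2)^-1 + 1)) - C * Sf (Q n) c o + Wf (Q n) c o) / 2)) @[n --> \oo] -->
   expR (- (((4 * C ^+ 2 * s ^+ 2 + 4 * C * Sf G c o - Sf G c o * 0) /
            (4 * 1) - C * Sf G c o + Wf G c o) / 2)).
  apply: cexp; apply: cvgN; apply: cvgM; last exact: cvg_cst.
  apply: cvgD; last exact: cW.
  apply: cvgB; last by apply: cvgM; [exact: cvg_cst|exact: cS].
  apply: cvgM; last exact: c4.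
  apply: cvgB; last exact: cSSe.
  by apply: cvgD; [exact: cvg_cst|apply: cvgM; [exact: cvg_cst|exact: cS]].
have h3 : cos (b + (2 * C - Sf (Q n) c o * (a n ^+ 2)^-1) /
     (2 * (s ^+ 2 * (a n ^+ 2)^-1 + 1)) * v) @[n --> \oo] --> cos (b + (2 * C - 0) / (2 * 1) * v).
  have ccos : forall x : R, {for x, continuous (@cos R)} by exact: continuous_cos.
  apply: (cvg_comp (fun n => b + (2 * C - Sf (Q n) c o * (a n ^+ 2)^-1) /
     (2 * (s ^+ 2 * (a n ^+ 2)^-1 + 1)) * v) cos); last exact: ccos.
  apply: cvgD; first exact: cvg_cst.
  apply: cvgM; last exact: cvg_cst.
  by apply: cvgM; [apply: cvgB; [exact: cvg_cst|exact: cSe]|exact: c2].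
have h4 : expR (- (v ^+ 2 * (a n ^+ 2)^-1 / (2 * (s ^+ 2 * (a n ^+ 2)^-1 + 1)))) @[n --> \oo] -->
    expR (- (v ^+ 2 * 0 / (2 * 1))).
  apply: cexp; apply: cvgN; apply: cvgM; last exact: c2.
  by apply: cvgM; [exact: cvg_cst|exact: ay].
exact: (cvgM h1 (cvgM h2 (cvgM h3 h4))).
Qed.

Hypothesis Ymarg : forall n j (B : set (measurableTypeR R)), measurable B ->
  ((w n)%:num%:E * P ((fun x => a n * Y n j x)%R @^-1` B) <= leb B)%E.

Lemma cvg_gaussian_hit (r : 'I_k -> R) :
  (w n)%:num * \int[P]_x (1 - \prod_i (1 - window (r i) (a n * Y n i x))) @[n --> \oo] -->
  \int[sigma_finite_product leb P']_z (1 - \prod_i (1 - window (r i) (z.1 + Z i z.2))).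
Proof.
have := @cvg_hit _ _ _ _ _ _ mu_ mu y_ y measurable_scaled measurable_translated Ymarg
  (@marginal_translated) gaussian_base r (index_enum 'I_k).
move=> h; apply: cvg_trans h; apply: near_eq_cvg; apply: nearW => n.
have w01 i z : 0 <= window (r i) z <= 1 by rewrite window_ge0 window_le1.
have mh : measurable_fun setT (fun x => 1 - \prod_i (1 - window (r i) (a n * Y n i x))).
  apply: measurable_funB => //; apply: measurable_prod => i _; apply: measurable_funB => //.
  by apply: measurableT_comp (measurable_scaled n i); exact: measurable_window.
rewrite /mu_ Rintegral_mscale//.
apply: (@integrable_le _ _ _ P _ (fun=> 1)) => // [x|]; last exact: finite_measure_integrable_cst.
have := prod_miss01 r (fun i => a n * Y n i x).
by move=> /andP[h0 h1]; rewrite ger0_norm; lra.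
Qed.

End gaussian_base.

(** * Independence *)

Section sub_sigma_algebras.
Context d (Omega : measurableType d) (R : realType) (P : probability Omega R).

Section projection.
Variable G : set (set Omega).
Hypothesis GO : G `<=` measurable.

Lemma sub_sigma_measurable : <<s G >> `<=` (measurable : set (set Omega)).
Proof. by apply: smallest_sub => //; exact: sigma_algebra_measurable. Qed.

(** The identity viewed as a map onto the same set with the smaller sigma-algebra; its law is the
    restriction of [P] to [<<s G >>]. *)
Definition sub_id : Omega -> g_sigma_algebraType G := fun w => w.

Lemma measurable_sub_id : measurable_fun setT sub_id.
Proof. by move=> _ B mB; rewrite setTI; exact: sub_sigma_measurable. Qed.

End projection.

Section product_formula.
Variables (G1 G2 : set (set Omega)) (M : set Omega) (c : {nonneg R}).
Hypotheses (G1O : G1 `<=` measurable) (G2O : G2 `<=` measurable) (mM : measurable M).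
Hypothesis rect : forall C D, <<s G1 >> C -> <<s G2 >> D ->
  P (M `&` (C `&` D)) = (c%:num%:E * (P C * P D))%E.

Let T1 := g_sigma_algebraType G1.
Let T2 := g_sigma_algebraType G2.
Let i1 : Omega -> T1 := @sub_id G1.
Let i2 : Omega -> T2 := @sub_id G2.
HB.instance Definition _ := @isMeasurableFun.Build _ _ _ _ i1 (measurable_sub_id G1O).
HB.instance Definition _ := @isMeasurableFun.Build _ _ _ _ i2 (measurable_sub_id G2O).
Let diag : Omega -> T1 * T2 := fun w => (w, w).
Let mdiag : measurable_fun setT diag.
Proof.
by apply: measurable_fun_pair; [exact: (measurable_sub_id G1O)|exact: (measurable_sub_id G2O)].
Qed.
HB.instance Definition _ := @isMeasurableFun.Build _ _ _ _ diag mdiag.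

(** The diagonal map carries [P] restricted to [M] to a measure on [T1 * T2], and [rect] says that
    on rectangles it is [c] times the product of the two restrictions of [P]; a product measure is
    determined by rectangles. In [independent_pairs], [M] collects the other events and [c] their
    probabilities. *)
Lemma product_formula (Q : set (T1 * T2)) : measurable Q ->
  P (M `&` [set w | Q (w, w)]) = (c%:num%:E * \int[P]_w1 P [set w2 | Q (w1, w2)])%E.
Proof.
move=> mQ.
pose m1 : {finite_measure set T1 -> \bar R} := mscale c (distribution P i1).
pose m2 : {finite_measure set T2 -> \bar R} := distribution P i2.
have h := @product_measure_unique _ _ _ _ _ m1 m2 (pushforward (mrestr P mM) diag).
have {}h := h mdiag _ Q mQ.
rewrite setIC -[LHS]/(pushforward (mrestr P mM) diag Q) -h; last first.
  move=> A B mA mB; rewrite /m1 /m2/= /pushforward/= /mrestr/= /mscale/=.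
  by rewrite setIC -muleA -rect.
have mx : measurable_fun setT (m2 \o xsection Q) by exact: measurable_fun_xsection.
have e w1 : (m2 \o xsection Q) w1 = P [set w2 | Q (w1, w2)].
  rewrite /m2/= /distribution/pushforward; congr (P _).
  by apply/seteqP; split => w2; rewrite /xsection/= inE.
rewrite /product_measure1 /m1 ge0_integral_mscale//; congr (_ * _)%E.
rewrite ge0_integral_distribution//.
by apply: eq_integral => w1 _; rewrite -e.
Qed.

End product_formula.
(** Conditioning without conditional expectations: an event mixing two independent sigma-algebras
    may be evaluated with two independent sample points [w1] and [w2]. *)
Lemma independent_product (G1 G2 : set (set Omega)) :
  G1 `<=` measurable -> G2 `<=` measurable ->
  (forall C D, <<s G1 >> C -> <<s G2 >> D -> P (C `&` D) = (P C * P D)%E) ->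
  forall Q : set (g_sigma_algebraType G1 * g_sigma_algebraType G2), measurable Q ->
  P [set w | Q (w, w)] = (\int[P]_w1 P [set w2 | Q (w1, w2)])%E.
Proof.
move=> G1O G2O G12 Q mQ.
have rect C D : <<s G1 >> C -> <<s G2 >> D ->
    P (setT `&` (C `&` D)) = ((1%:nng : {nonneg R})%:num%:E * (P C * P D))%E.
  by move=> GC GD; rewrite setTI mul1e G12.
by have := product_formula G1O G2O measurableT rect mQ; rewrite setTI mul1e.
Qed.

Lemma measurable_diagonal (G1 G2 : set (set Omega)) :
  G1 `<=` measurable -> G2 `<=` measurable ->
  forall Q : set (g_sigma_algebraType G1 * g_sigma_algebraType G2), measurable Q ->
  measurable [set w : Omega | Q (w, w)].
Proof.
move=> G1O G2O Q mQ.
have := measurable_fun_pair (measurable_sub_id G1O) (measurable_sub_id G2O).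
by move=> /(_ measurableT Q mQ); rewrite setTI.
Qed.

(* One pair of sigma-algebras at a time, the rectangles [C i `&` D i] are replaced by
   arbitrary events of the product sigma-algebra. *)
Lemma independent_pairs (m : nat) (G1 G2 : 'I_m -> set (set Omega)) (A0 : set Omega)
    (E : 'I_m -> set Omega) :
  (forall i, G1 i `<=` measurable) -> (forall i, G2 i `<=` measurable) -> measurable A0 ->
  (forall i C D, <<s G1 i >> C -> <<s G2 i >> D -> P (C `&` D) = (P C * P D)%E) ->
  (forall C D, (forall i, <<s G1 i >> (C i)) -> (forall i, <<s G2 i >> (D i)) ->
    P (A0 `&` \big[setI/setT]_(i < m) (C i `&` D i)) =
    (P A0 * \prod_(i < m) (P (C i) * P (D i)))%E) ->
  (forall i, exists2 Q : set (g_sigma_algebraType (G1 i) * g_sigma_algebraType (G2 i)),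
     measurable Q & E i = [set w | Q (w, w)]) ->
  P (A0 `&` \big[setI/setT]_(i < m) E i) = (P A0 * \prod_(i < m) P (E i))%E.
Proof.
move=> G1O G2O mA0 CD CDs EQ.
pose isE i (B : set Omega) := exists2 Q : set (g_sigma_algebraType (G1 i) *
  g_sigma_algebraType (G2 i)), measurable Q & B = [set w | Q (w, w)].
pose isR i (B : set Omega) := exists C D, [/\ <<s G1 i >> C, <<s G2 i >> D & B = C `&` D].
have isRE i B : isR i B -> isE i B.
  by move=> [C [D [GC GD ->]]]; exists (C `*` D) => //; exact: measurableX.
have mE i B : isE i B -> measurable B.
  by move=> [Q mQ ->]; exact: measurable_diagonal.
suff : forall l, (l <= m)%N -> forall B : 'I_m -> set Omega,
    (forall i : 'I_m, if (i < l)%N then isE i (B i) else isR i (B i)) ->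
    P (A0 `&` \big[setI/setT]_(i < m) B i) = (P A0 * \prod_(i < m) P (B i))%E.
  by move=> /(_ m (leqnn m)); apply => i; rewrite ltn_ord.
elim => [_ B hB|l IH lm B hB].
  have [C hC] := choice (fun i : 'I_m => hB i : exists C, _).
  have [D hD] := choice hC.
  have -> : \big[setI/setT]_(i < m) B i = \big[setI/setT]_(i < m) (C i `&` D i).
    by apply: eq_bigr => i _; have [] := hD i.
  rewrite CDs => [|i|i]; [|by have [] := hD i|by have [] := hD i].
  congr (_ * _)%E; apply: eq_bigr => i _; have [GC GD ->] := hD i.
  by rewrite (CD i).
pose o := Ordinal lm.
have [Q mQ BQ] : isE o (B o) by have := hB o; rewrite ltnS leqnn.
have mB i : measurable (B i).
  by apply: (mE i); have := hB i; case: ifP => // _; exact: isRE.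
pose M := A0 `&` \big[setI/setT]_(i < m | i != o) B i.
have mM : measurable M.
  by apply: measurableI => //; apply: big_ind => //; exact: measurableI.
pose c := (P A0 * \prod_(i < m | i != o) P (B i))%E.
have Pfin A : measurable A -> P A \is a fin_num by move=> mA; exact: fin_num_measure.
have cfin : c \is a fin_num.
  rewrite /c; apply: fin_numM; first exact: Pfin.
  apply: (big_ind (fun x : \bar R => x \is a fin_num)) => // [x y|i _]; first exact: fin_numM.
  exact: Pfin.
have c0 : (0 <= fine c)%R.
  apply: fine_ge0; apply: mule_ge0 => //.
  by apply: (big_ind (fun x : \bar R => 0 <= x)%E) => //; exact: mule_ge0.
have cE : ((NngNum c0)%:num)%:E = c by rewrite fineK.
have split_o (B' : 'I_m -> set Omega) : (forall i, i != o -> B' i = B i) ->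
    A0 `&` \big[setI/setT]_(i < m) B' i = M `&` B' o.
  move=> B'B; rewrite (bigD1 o)//= /M -setIA [X in _ = _ `&` X]setIC.
  by congr (_ `&` (_ `&` _)); apply: eq_bigr => i io; exact: B'B.
have prod_o (B' : 'I_m -> set Omega) : (forall i, i != o -> B' i = B i) ->
    (P A0 * \prod_(i < m) P (B' i) = c * P (B' o))%E.
  move=> B'B; rewrite (bigD1 o)//= /c -muleA [X in _ = (_ * X)%E]muleC.
  by congr (_ * (_ * _))%E; apply: eq_bigr => i io; rewrite B'B.
rewrite split_o// prod_o// BQ.
rewrite (@product_formula (G1 o) (G2 o) M (NngNum c0) (G1O o) (G2O o) mM _ Q mQ).
  by rewrite cE (independent_product (G1O o) (G2O o) (CD o) mQ).
move=> C D GC GD; pose B' (i : 'I_m) := if i == o then C `&` D else B i.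
have B'o : B' o = C `&` D by rewrite /B' eqxx.
have B'B i : i != o -> B' i = B i by rewrite /B' => /negPf ->.
rewrite cE -(CD o)// -B'o -prod_o// -split_o//; apply: IH; first exact: ltnW.
move=> i; have [->|io] := eqVneq i o.
  by rewrite /= ltnn B'o; exists C, D.
rewrite B'B//; have := hB i; rewrite ltnS leq_eqVlt.
case: eqP => [il|_] //=.
by move: io; rewrite -(inj_eq val_inj)/= il eqxx.
Qed.

End sub_sigma_algebras.

Section mutual_independence.
Context d (Omega : measurableType d) (R : realType) (P : probability Omega R).

Lemma mutually_independent_ord (I : choiceType) (D : set I)
    (F : I -> set (set Omega)) (m : nat) (f : 'I_m -> I) (A : 'I_m -> set Omega) :
  injective f -> (forall i, D (f i)) -> mutually_independent P D F ->
  (forall i, F (f i) (A i)) ->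
  P (\big[setI/setT]_(i < m) A i) = (\prod_(i < m) P (A i))%E.
Proof.
move=> injf Df indF FA.
pose J := [fset f i | i in 'I_m]%fset.
(* The events transported along [f]; the default [setT] is never reached on [J]. *)
pose A' x := if [pick i | f i == x] is Some i then A i else setT.
have A'f i : A' (f i) = A i.
  rewrite /A'; case: pickP => [j /eqP/injf ->//|/(_ i)]; by rewrite eqxx.
have Jf x : x \in J -> exists i, x = f i.
  by move=> /imfsetP[i _ ->]; exists i.
have <- : \bigcap_(i in [set` J]) A' i = \big[setI/setT]_(i < m) A i.
  rewrite bigcap_fset big_imfset/= ?big_enum/=; last by move=> i j _ _; exact: injf.
  by apply: eq_bigr => i _; rewrite A'f.
have <- : (\prod_(i <- J) P (A' i) = \prod_(i < m) P (A i))%E.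
  rewrite big_imfset/= ?big_enum/=; last by move=> i j _ _; exact: injf.
  by apply: eq_bigr => i _; rewrite A'f.
apply: indF => x; first by move=> /Jf[i ->].
by move=> /Jf[i ->]; rewrite A'f.
Qed.

Lemma sigma_process_measurable (T : Type) (X : T -> {RV P >-> R}) :
  \bigcup_(t in [set: T]) preimage_set_system [set: Omega] (X t) measurable `<=`
  (measurable : set (set Omega)).
Proof.
by move=> _ [t _ [B mB <-]]; have mX : measurable_fun setT (X t) by []; exact: mX.
Qed.

Lemma measurable_sub_process (T : Type) (X : T -> {RV P >-> R}) (t : T) :
  measurable_fun setT (X t : g_sigma_algebraType
   (\bigcup_(t in [set: T]) preimage_set_system [set: Omega] (X t) measurable) -> R).
Proof. by move=> _ B mB; apply: sub_sigma_algebra; exists t => //; exists B. Qed.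

End mutual_independence.

Section equal_laws.
Context d (O1 : measurableType d) (R : realType) (P1 : {measure set O1 -> \bar R}).
Context d' (T : measurableType d') (X1 : O1 -> T).
Hypothesis mX1 : measurable_fun setT X1.

Let X1_ : O1 -> T := X1.
HB.instance Definition _ := @isMeasurableFun.Build _ _ _ _ X1_ mX1.

Lemma Rintegral_equal_laws d2 (O2 : measurableType d2) (P2 : {measure set O2 -> \bar R})
    (X2 : O2 -> T) (f : T -> R) : measurable_fun setT X2 -> measurable_fun setT f ->
  (forall A, measurable A -> P2 (X2 @^-1` A) = P1 (X1 @^-1` A)) ->
  \int[P2]_w f (X2 w) = \int[P1]_w f (X1 w).
Proof.
move=> mX2 mf law.
by rewrite (Rintegral_image mX2 (nu := pushforward P1 X1_))// (Rintegral_image mX1 (nu := pushforward P1 X1_)).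
Qed.

End equal_laws.

Lemma same_law_Rintegral d1 d2 (O1 : measurableType d1) (O2 : measurableType d2)
    (R : realType) (P1 : probability O1 R) (P2 : probability O2 R) (T : Type)
    (X1 : T -> {RV P1 >-> R}) (X2 : T -> {RV P2 >-> R}) k (t : 'I_k -> T)
    (f : k.-tuple R -> R) : same_law X1 X2 -> measurable_fun setT f ->
  \int[P1]_w f [tuple X1 (t j) w | j < k] = \int[P2]_w f [tuple X2 (t j) w | j < k].
Proof.
move=> sl mf.
have m1 : measurable_fun setT (fun w => [tuple X1 (t j) w | j < k]).
  by apply/measurable_fun_tnthP => i; rewrite (_ : _ \o _ = X1 (t i))//; apply/funext => w /=; rewrite tnth_mktuple.
have m2 : measurable_fun setT (fun w => [tuple X2 (t j) w | j < k]).
  by apply/measurable_fun_tnthP => i; rewrite (_ : _ \o _ = X2 (t i))//; apply/funext => w /=; rewrite tnth_mktuple.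
by apply: (Rintegral_equal_laws m2 m1) => // A mA; rewrite [LHS](sl k t A mA).
Qed.

(** * Survival events *)

Section alive.
Context (R : realType) (k : nat) (kappa : R) (x : 'I_k -> R).
Hypothesis kappa0 : 0 < kappa.

(* [Num.max (s j) kappa] is [s j] almost surely and keeps the quotient bounded everywhere *)
Definition level (s : 'I_k -> R) (j : 'I_k) : R := x j / Num.max (s j) kappa.

(** One term exceeds its threshold at every time. Dividing by [s j] moves the random factor into the
    level, so that for frozen [s] this is a condition on [y] by fixed windows. *)
Definition alive (s y : 'I_k -> R) : Prop := forall j, level s j < `|y j|.

Lemma level_bound s j : `|level s j| <= `|x j| / kappa.
Proof.
rewrite /level normf_div ler_wpM2l//.
have m0 : 0 < Num.max (s j) kappa by rewrite lt_max kappa0 orbT.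
by rewrite (gtr0_norm m0) lef_pV2// le_max lexx orbT.
Qed.

Lemma level_lt s j u : (level s j < u) = (x j < u * Num.max (s j) kappa).
Proof. by rewrite /level ltr_pdivrMr// lt_max kappa0 orbT. Qed.

Lemma measurable_alive d (T : measurableType d) (s y : 'I_k -> T -> R) :
  (forall j, measurable_fun setT (s j)) -> (forall j, measurable_fun setT (y j)) ->
  measurable [set z | alive (s ^~ z) (y ^~ z)].
Proof.
move=> ms my.
have -> : [set z | alive (s ^~ z) (y ^~ z)] =
    \big[setI/setT]_(j < k) [set z | level (s ^~ z) j < `|y j z|].
  apply/seteqP; split => z /=.
    by move=> h; apply: (big_ind (fun A : set T => A z)) => // j _; exact: h.
  by move=> h j; move: h; rewrite (bigD1 j)//= => -[].
apply: big_ind => //; first exact: measurableI.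
move=> j _.
have mM : measurable_fun setT (fun z => `|y j z| * Num.max (s j z) kappa).
  apply: measurable_funM; last exact: measurable_maxr.
  by apply: measurableT_comp (my j); exact: normr_measurable.
have := measurable_fun_ltr (measurable_cst (x j)) mM measurableT (Y := [set true]) I.
by rewrite setTI; congr measurable; apply/seteqP; split => z /=; rewrite level_lt.
Qed.

Lemma aliveP s y : reflect (alive s y) [forall j, level s j < `|y j|].
Proof. exact: forallP. Qed.

Lemma prod_alive s y : \prod_j (1 - window (level s j) (y j)) =
  ([forall j, (level s j < `|y j|)%R])%:R :> R.
Proof.
have w j : 1 - window (level s j) (y j) = ((level s j < `|y j|)%R)%:R :> R.
  rewrite /window indicE mem_setE in_itv/= -ler_norml ltNge.
  by case: (_ <= _); rewrite ?subrr ?subr0.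
case: aliveP => h /=.
  by rewrite big1// => j _; rewrite w h.
have [j hj] : exists j, ~~ (level s j < `|y j|).
  by apply/existsP; rewrite -negb_forall; apply/aliveP.
by rewrite (bigD1 j)//= w (negbTE hj) mul0r.
Qed.

Lemma fine_prob_alive d (Omega : measurableType d) (P : probability Omega R)
    (s y : 'I_k -> Omega -> R) :
  (forall j, measurable_fun setT (s j)) -> (forall j, measurable_fun setT (y j)) ->
  (\int[P]_w \prod_j (1 - window (level (s ^~ w) j) (y j w)))%:E =
  P [set w | alive (s ^~ w) (y ^~ w)].
Proof.
move=> ms my; have mA := measurable_alive ms my.
transitivity ((\int[P]_w (\1_[set w | alive (s ^~ w) (y ^~ w)] w : R))%:E).
  congr EFin; apply: eq_RintegralT => w; rewrite prod_alive indicE; congr (_%:R).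
  by congr nat_of_bool; apply/aliveP/idP => h; [exact/mem_set|exact: set_mem h].
by rewrite EFin_Rintegral ?integral_indic ?setIT//; exact: integrable_indic.
Qed.

End alive.

(** * Rows of the array *)

Section product_limit.
Context (R : realType) (p : nat -> nat -> R) (L : R).
Hypotheses (p01 : forall n i, (i <= n)%N -> 0 <= p n i <= 1)
  (pL : forall u : nat -> nat, (forall n, u n <= n)%N ->
     n.+1%:R * p n (u n) @[n --> \oo] --> L).

(* squeeze between the extreme rows: [exp (- p / (1 - p)) <= 1 - p <= exp (- p)] *)
Lemma cvg_row_product : \prod_(i < n.+1) (1 - p n i) @[n --> \oo] --> expR (- L).
Proof.
(* Since [pL] holds along every selection of one entry per row, it holds for the largest and the
   smallest one; this replaces uniformity over the row. *)
pose umax n : nat := [arg max_(i > (@ord0 n) in 'I_n.+1) p n i]%O.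
pose umin n : nat := [arg min_(i < (@ord0 n) in 'I_n.+1) p n i]%O.
have umaxn n : (umax n <= n)%N by rewrite -ltnS ltn_ord.
have uminn n : (umin n <= n)%N by rewrite -ltnS ltn_ord.
have pmax n (i : 'I_n.+1) : p n i <= p n (umax n).
  by rewrite /umax; case: arg_maxP => // j _; apply.
have pmin n (i : 'I_n.+1) : p n (umin n) <= p n i.
  by rewrite /umin; case: arg_minP => // j _; apply.
have cmax := pL umaxn; have cmin := pL uminn.
have p0 : p n (umax n) @[n --> \oo] --> (0:R).
  have e n : p n (umax n) = n.+1%:R^-1 * (n.+1%:R * p n (umax n)).
    by rewrite mulKf// pnatr_eq0.
  have h : n.+1%:R^-1 * (n.+1%:R * p n (umax n)) @[n --> \oo] --> 0 * L.
    by apply: cvgM; [exact: cvg_harmonic|exact: cmax].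
  rewrite mul0r in h; apply: cvg_trans h; apply: near_eq_cvg; apply: nearW => n.
  exact: esym (e n).
have cexp (u : nat -> R) l : u n @[n --> \oo] --> l -> expR (u n) @[n --> \oo] --> expR l.
  by move=> ul; apply: (cvg_comp _ _ ul); exact: continuous_expR.
have expn (n : nat) (a : R) : \prod_(i < n.+1) expR a = expR (n.+1%:R * a).
  by rewrite prodr_const card_ord -expRM_natl mulr_natl -mulr_natl.
apply: (@squeeze_cvgr _ _ _ _ (fun n => expR (- (n.+1%:R * p n (umax n) / (1 - p n (umax n)))))
  (fun n => expR (- (n.+1%:R * p n (umin n))))).
- have : \forall n \near \oo, p n (umax n) < 1.
    by apply: (cvgr_lt _ p0).
  apply: filterS => n pn1; apply/andP; split.
    rewrite -mulrA -mulrN -expn; apply: ler_prod => i _; rewrite expR_ge0/=.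
    have /andP[q0 q1] := p01 (ltn_ord i : (i <= n)%N).
    set q := p n i in q0 q1 *; set m := p n (umax n) in pn1 *.
    have qm : q <= m by exact: pmax.
    have m1 : 0 < 1 - m by rewrite subr_gt0.
    have qq1 : 0 < 1 - q by lra.
    apply: (@le_trans _ _ (expR (- (q / (1 - q))))).
      by rewrite ler_expR lerN2 ler_pM// ?invr_ge0 ?(ltW qq1)// lef_pV2// lerD2l lerN2; exact: pmax.
    rewrite expRN -[leRHS]invrK lef_pV2 ?posrE ?expR_gt0 ?invr_gt0//.
    apply: le_trans (expR_ge1Dx _).
    by rewrite (_ : 1 + q / (1 - q) = (1 - q)^-1)//; field; rewrite gt_eqF.
  rewrite -mulrN -expn; apply: ler_prod => i _.
  have /andP[q0 q1] := p01 (ltn_ord i : (i <= n)%N).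
  rewrite subr_ge0 q1/= (le_trans (expR_ge1Dx _))// ler_expR lerN2; exact: pmin.
- apply: cexp; apply: cvgN; rewrite -[X in _ --> X]divr1; apply: cvgM => //.
  apply: cvgV; first exact: oner_neq0.
  by rewrite -[X in _ --> X]subr0; apply: cvgB; [exact: cvg_cst|exact: p0].
- by apply: cexp; exact: cvgN.
Qed.

End product_limit.

Section unit_interval.
Context d (Omega : measurableType d) (R : realType) (P : probability Omega R) (f : Omega -> R).
Hypotheses (mf : measurable_fun setT f) (f01 : forall w, 0 <= f w <= 1).

Lemma integrable01 : P.-integrable setT (EFin \o f).
Proof.
apply: (@integrable_le _ _ _ P _ (fun=> 1)) => // [w|]; last exact: finite_measure_integrable_cst.
by have /andP[f0 f1] := f01 w; rewrite ger0_norm.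
Qed.

Lemma Rintegral01 : 0 <= \int[P]_w f w <= 1.
Proof.
rewrite Rintegral_ge0 => [/=|w _]; last by have /andP[] := f01 w.
rewrite -[leRHS](_ : \int[P]_w 1 = 1); last by rewrite Rintegral_cst//= -[fine _]/(fine (P setT)) probability_setT mulr1.
apply: le_Rintegral => // [||w _]; [exact: integrable01|exact: finite_measure_integrable_cst|].
by have /andP[] := f01 w.
Qed.

End unit_interval.

Section independent_alive.
Context d0 (O0 : measurableType d0) d (Omega : measurableType d) (R : realType).
Variables (P0 : probability O0 R) (P : probability Omega R) (T : Type) (k : nat)
  (kappa : R) (x : 'I_k -> R) (t : 'I_k -> T).
Hypothesis kappa0 : 0 < kappa.

Lemma survival01 (s y : 'I_k -> R) : 0 <= \prod_j (1 - window (level kappa x s j) (y j)) <= 1.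
Proof. by have := prod_miss01 (level kappa x s) y; lra. Qed.

Lemma measurable_survival d2 (O : measurableType d2) (s y : 'I_k -> O -> R) :
  (forall j, measurable_fun setT (s j)) -> (forall j, measurable_fun setT (y j)) ->
  measurable_fun setT (fun w => \prod_j (1 - window (level kappa x (s ^~ w) j) (y j w))).
Proof.
move=> ms my.
have -> : (fun w => \prod_j (1 - window (level kappa x (s ^~ w) j) (y j w))) =
   \1_[set w | alive kappa x (s ^~ w) (y ^~ w)].
  apply/funext => w; rewrite prod_alive// indicE; congr (_%:R).
  by congr nat_of_bool; apply/aliveP/idP => h; [exact/mem_set|exact: set_mem h].
by apply: measurable_indic; exact: measurable_alive.
Qed.

Lemma measurable_expected_survival (y : 'I_k -> Omega -> R) :
  (forall j, measurable_fun setT (y j)) ->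
  measurable_fun setT (fun tau : k.-tuple R =>
    \int[P]_w \prod_j (1 - window (level kappa x (tnth tau) j) (y j w))).
Proof.
move=> my.
pose Q := [set z : k.-tuple R * Omega | alive kappa x (fun j => tnth z.1 j) (fun j => y j z.2)].
have mQ : measurable Q.
  apply: (@measurable_alive _ _ _ _ kappa0 _ _ (fun j z => tnth z.1 j) (fun j z => y j z.2)) => j.
    exact: (measurableT_comp (measurable_tnth j) measurable_fst).
  by apply: measurableT_comp (my j) _; exact: measurable_snd.
have := measurable_fun_xsection P mQ.
move=> mx; rewrite [X in measurable_fun _ X](_ : _ = fine \o (P \o xsection Q)).
  by apply: measurableT_comp.
apply/funext => tau /=.
have := @fine_prob_alive _ _ kappa x kappa0 _ _ P (fun j _ => tnth tau j) y
  (fun j => measurable_cst _) my.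
move=> /(congr1 fine) /= ->; congr (fine (P _)).
by apply/seteqP; split => w; rewrite /xsection/= inE.
Qed.

Lemma measurable_alive_section (S Y : T -> {RV P >-> R}) (phi : 'I_k -> R -> R) :
  (forall j, measurable_fun setT (phi j)) ->
  measurable [set z : g_sigma_algebraType (\bigcup_(u in [set: T])
      preimage_set_system [set: Omega] (S u) measurable) *
    g_sigma_algebraType (\bigcup_(u in [set: T])
      preimage_set_system [set: Omega] (Y u) measurable) |
    alive kappa x (fun j => S (t j) z.1) (fun j => phi j (Y (t j) z.2))].
Proof.
move=> mphi.
set G1 := \bigcup_(u in [set: T]) preimage_set_system [set: Omega] (S u) measurable.
set G2 := \bigcup_(u in [set: T]) preimage_set_system [set: Omega] (Y u) measurable.
pose T1 := g_sigma_algebraType G1; pose T2 := g_sigma_algebraType G2.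
apply: (@measurable_alive _ _ _ _ kappa0 _ (T1 * T2)%type
    (fun j (z : T1 * T2) => S (t j) z.1) (fun j (z : T1 * T2) => phi j (Y (t j) z.2))) => j.
  exact: (measurableT_comp (measurable_sub_process (X := S) (t j))
    (measurable_fst : measurable_fun setT (fst : T1 * T2 -> T1))).
exact: (measurableT_comp (mphi j) (measurableT_comp (measurable_sub_process (X := Y) (t j))
    (measurable_snd : measurable_fun setT (snd : T1 * T2 -> T2)))).
Qed.

(** Freezing [S] leaves a function [psi] of finitely many values of [S], and [same_law] moves its
    mean to the space of [S0]. The map [phi] is the scaling by [norming n] for the array and the
    translation by a Poisson point for the limit. *)
Lemma independent_alive (S0 : T -> {RV P0 >-> R}) (S Y : T -> {RV P >-> R})
    (phi : 'I_k -> R -> R) : (forall j, measurable_fun setT (phi j)) ->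
  same_law S0 S ->
  (forall C D, sigma_process S C -> sigma_process Y D -> P (C `&` D) = (P C * P D)%E) ->
  P [set w | alive kappa x (fun j => S (t j) w) (fun j => phi j (Y (t j) w))] =
  (\int[P0]_w0 \int[P]_w \prod_j
     (1 - window (level kappa x (fun j => S0 (t j) w0) j) (phi j (Y (t j) w))))%:E.
Proof.
move=> mphi sl SY.
have my j : measurable_fun setT (fun w => phi j (Y (t j) w)).
  by apply: measurableT_comp (mphi j) (_ : measurable_fun setT (Y (t j))).
have -> := independent_product (@sigma_process_measurable _ _ _ P _ S)
  (@sigma_process_measurable _ _ _ P _ Y) SY (@measurable_alive_section S Y phi mphi).
pose psi (tau : k.-tuple R) := \int[P]_w \prod_j (1 - window (level kappa x (tnth tau) j) (phi j (Y (t j) w))).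
have mpsi : measurable_fun setT psi by apply: measurable_expected_survival.
have psiE d2 (O : measurableType d2) (P2 : probability O R) (X : T -> {RV P2 >-> R}) w1 :
    \int[P]_w \prod_j (1 - window (level kappa x (fun j => X (t j) w1) j) (phi j (Y (t j) w))) =
    psi [tuple X (t j) w1 | j < k].
  apply: eq_RintegralT => w; apply: eq_bigr => j _; congr (1 - window _ _).
  by rewrite /level tnth_mktuple.
transitivity ((\int[P]_w1 (psi [tuple S (t j) w1 | j < k])%:E)%E).
  apply: eq_integral => w1 _; rewrite -psiE.
  by rewrite (@fine_prob_alive _ _ _ _ kappa0 _ _ P (fun j _ => S (t j) w1)).
rewrite -EFin_Rintegral.
  congr EFin; apply: etrans (esym (@same_law_Rintegral _ _ _ _ _ _ _ _ _ _ k t psi sl mpsi)) _.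
  by apply: eq_RintegralT => w0; rewrite psiE.
apply: integrable01 => [|w].
  apply: measurableT_comp mpsi _.
  apply/measurable_fun_tnthP => i; rewrite (_ : _ \o _ = S (t i))//.
  by apply/funext => w /=; rewrite tnth_mktuple.
by rewrite -psiE; apply: Rintegral01 => [|w']; [exact: measurable_survival|exact: survival01].
Qed.

End independent_alive.

Section marginal_hits.
Context d (T : measurableType d) (R : realType) (nu : {sigma_finite_measure set T -> \bar R}) (k : nat)
  (y : 'I_k -> T -> R).
Local Notation leb := (@lebesgue_measure R).
Hypotheses (my : forall j, measurable_fun setT (y j))
  (marginal : forall j (B : set (measurableTypeR R)), measurable B -> (nu (y j @^-1` B) <= leb B)%E).

Lemma measurable_hit (r : 'I_k -> R) :
  measurable_fun setT (fun x => 1 - \prod_i (1 - window (r i) (y i x))).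
Proof.
apply: measurable_funB => //; apply: measurable_prod => i _; apply: measurable_funB => //.
by apply: measurableT_comp (my i); exact: measurable_window.
Qed.

Lemma hit_le_sum (r z : 'I_k -> R) :
  1 - \prod_i (1 - window (r i) (z i)) <= \sum_i window (r i) (z i).
Proof.
suff : 0 <= \prod_i (1 - window (r i) (z i)) <= 1 /\
    1 - \prod_i (1 - window (r i) (z i)) <= \sum_i window (r i) (z i) by case.
apply: (big_ind2 (fun (p q : R) => 0 <= p <= 1 /\ 1 - p <= q)).
- by rewrite ler01 lexx subrr.
- move=> p1 q1 p2 q2 [/andP[a b] c] [/andP[e f] g]; split; last by nra.
  by rewrite mulr_ge0//= mulr_ile1.
- move=> i _; have := window_ge0 (r i) (z i); have := window_le1 (r i) (z i).
  by move=> h1 h0; split; lra.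
Qed.

(** The union bound, each coordinate having a law below Lebesgue measure. The bound depends on the
    levels alone, so it dominates uniformly over the array as well as in the limit. *)
Lemma marginal_hit (r : 'I_k -> R) :
  nu.-integrable setT (EFin \o (fun x => 1 - \prod_i (1 - window (r i) (y i x)))) /\
  \int[nu]_x (1 - \prod_i (1 - window (r i) (y i x))) <= \sum_i Num.max (2 * r i) 0.
Proof.
have iw j : nu.-integrable setT (EFin \o (window (r j) \o y j)).
  apply: (integrable_marginal (my j) (marginal j) (integrable_window (r j))).
  exact: window_ge0.
have [isum esum] := Rintegral_sum (index_enum 'I_k) iw.
have ih : nu.-integrable setT (EFin \o (fun x => 1 - \prod_i (1 - window (r i) (y i x)))).
  apply: (integrable_le _ _ isum); first exact: measurable_hit.
  move=> x; have := prod_miss01 r (fun i => y i x); move=> /andP[_ h]; rewrite ger0_norm ?subr_ge0//.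
  exact: hit_le_sum.
split => //; apply: (@le_trans _ _ (\int[nu]_x \sum_i window (r i) (y i x))).
  by apply: le_Rintegral => // x _; exact: hit_le_sum.
rewrite esum; apply: ler_sum => j _; rewrite -Rintegral_window.
by apply: (Rintegral_marginal (my j) (marginal j) (integrable_window (r j))); exact: window_ge0.
Qed.

End marginal_hits.

Section expected_hits.
Context d0 (O0 : measurableType d0) d (Omega : measurableType d) (R : realType).
Variables (P0 : probability O0 R) (P : probability Omega R) (k : nat)
  (kappa : R) (x : 'I_k -> R) (s : 'I_k -> O0 -> R) (y : nat -> 'I_k -> Omega -> R)
  (w : nat -> {nonneg R}) (H : ('I_k -> R) -> R).
Local Notation leb := (@lebesgue_measure R).
Hypotheses (kappa0 : 0 < kappa) (ms : forall j, measurable_fun setT (s j))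
  (my : forall n j, measurable_fun setT (y n j))
  (marginal : forall n j (B : set (measurableTypeR R)), measurable B ->
     ((w n)%:num%:E * P (y n j @^-1` B) <= leb B)%E)
  (cvgH : forall r, (w n)%:num * \int[P]_z (1 - \prod_i (1 - window (r i) (y n i z)))
     @[n --> \oo] --> H r).

(** The convergence [cvgH] holds for each value of [s]; integration over [s] is by dominated
    convergence. The dominating constant comes from [marginal_hit], because the levels never exceed
    [|x j| / kappa]. *)
Lemma cvg_expected_hit :
  (w n)%:num * (1 - \int[P0]_w0 \int[P]_z \prod_j (1 - window (level kappa x (s ^~ w0) j) (y n j z)))
    @[n --> \oo] --> \int[P0]_w0 H (level kappa x (s ^~ w0)).
Proof.
have mE n : measurable_fun setT (fun w0 =>
    \int[P]_z \prod_j (1 - window (level kappa x (s ^~ w0) j) (y n j z))).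
  have mt : measurable_fun setT (fun w0 => [tuple s j w0 | j < k]).
    apply/measurable_fun_tnthP => i; rewrite (_ : _ \o _ = s i)//.
    by apply/funext => w0 /=; rewrite tnth_mktuple.
  have := measurableT_comp (@measurable_expected_survival _ _ _ P _ _ x kappa0 _ (my n)) mt.
  congr measurable_fun; apply/funext => w0 /=; apply: eq_RintegralT => z.
  by apply: eq_bigr => j _; rewrite /level tnth_mktuple.
have E01 n w0 : 0 <= \int[P]_z \prod_j (1 - window (level kappa x (s ^~ w0) j) (y n j z)) <= 1.
  apply: Rintegral01 => [|z]; last exact: survival01.
  by apply: measurable_survival => // j; exact: measurable_cst.
have one w0 n : 1 - \int[P]_z \prod_j (1 - window (level kappa x (s ^~ w0) j) (y n j z)) =
    \int[P]_z (1 - \prod_j (1 - window (level kappa x (s ^~ w0) j) (y n j z))).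
  rewrite RintegralB//.
  - by rewrite Rintegral_cst//= -[fine _]/(fine (P setT)) probability_setT mulr1.
  - exact: finite_measure_integrable_cst.
  - apply: integrable01 => [|z]; last exact: survival01.
    by apply: measurable_survival => // j; exact: measurable_cst.
have e n : (w n)%:num * (1 - \int[P0]_w0 \int[P]_z \prod_j (1 - window (level kappa x (s ^~ w0) j) (y n j z))) =
    \int[P0]_w0 ((w n)%:num * (1 - \int[P]_z \prod_j (1 - window (level kappa x (s ^~ w0) j) (y n j z)))).
  have i1 : P0.-integrable setT (EFin \o (fun=> 1 : R)) by exact: finite_measure_integrable_cst.
  have i2 := integrable01 P0 (mE n) (E01 n).
  rewrite RintegralZl//.
    by rewrite RintegralB// Rintegral_cst//= -[fine _]/(fine (P0 setT)) probability_setT mulr1.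
  rewrite (_ : _ \o _ = fun w0 => ((1 : R)%:E - (\int[P]_z \prod_j (1 - window (level kappa x (s ^~ w0) j) (y n j z)))%:E)%E)//.
  exact: (integrableB measurableT i1 i2).
under eq_fun do rewrite e.
apply: (@Rdominated_cvg _ _ _ P0 _ _ (fun=> \sum_j 2 * (`|x j| / kappa))).
- by move=> n; apply: measurable_funM => //; exact: measurable_funB.
- by move=> w0; under eq_fun do rewrite one; exact: cvgH.
- exact: finite_measure_integrable_cst.
- move=> n w0; rewrite one -Rintegral_mscale; first last.
  + apply: integrable01 => [|z]; first exact: measurable_hit.
    have /andP[h0 h1] := survival01 kappa x (s ^~ w0) (fun j => y n j z).
    by rewrite subr_ge0 h1 gerBl.
  + exact: measurable_hit.
  have := @marginal_hit _ _ _ (mscale (w n) P) _ (y n) (my n) (marginal n) (level kappa x (s ^~ w0)).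
  move=> [_ hle]; rewrite ger0_norm; last first.
    apply: Rintegral_ge0 => z _.
    by have /andP[_ h] := survival01 kappa x (s ^~ w0) (fun j => y n j z); rewrite subr_ge0.
  apply: (le_trans hle); apply: ler_sum => j _.
  rewrite ge_max mulr_ge0 ?divr_ge0 ?(ltW kappa0)// andbT ler_pM2l//.
  by apply: le_trans (level_bound x kappa0 _ _); exact: ler_norm.
Qed.

End expected_hits.

Section independent_sequences.
Context d (Omega : measurableType d) (R : realType) (P : probability Omega R).

Lemma mutually_independent_pair (F1 F2 : set (set Omega)) :
  mutually_independent P [set: 'I_2] (tnth [tuple F1; F2]) ->
  forall A B, F1 A -> F2 B -> P (A `&` B) = (P A * P B)%E.
Proof.
move=> F12 A B FA FB.
have := @mutually_independent_ord _ _ _ P _ _ _ 2 id (tnth [tuple A; B]) (fun _ _ h => h)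
  (fun _ => I) F12.
rewrite !big_ord_recl !big_ord0 setIT mule1; apply.
by case; case=> [|[|//]] i2.
Qed.

Lemma mutually_independent_triple (F1 F2 F3 : set (set Omega)) :
  mutually_independent P [set: 'I_3] (tnth [tuple F1; F2; F3]) ->
  forall A B C, F1 A -> F2 B -> F3 C -> P (A `&` (B `&` C)) = (P A * (P B * P C))%E.
Proof.
move=> F123 A B C FA FB FC.
have := @mutually_independent_ord _ _ _ P _ _ _ 3 id (tnth [tuple A; B; C]) (fun _ _ h => h)
  (fun _ => I) F123.
rewrite !big_ord_recl !big_ord0 setIT mule1; apply.
by case; case=> [|[|[|//]]] i3.
Qed.

Lemma sigma_join_bigI (I : Type) (D : set I) (F : I -> set (set Omega)) (m : nat)
    (f : 'I_m -> I) (A : 'I_m -> set Omega) : (forall i, D (f i)) -> (forall i, F (f i) (A i)) ->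
  sigma_join D F (\big[setI/setT]_(i < m) A i).
Proof.
move=> Df FA; rewrite /sigma_join.
pose G := \bigcup_(i in D) F i.
have mA (i : 'I_m) : measurable (A i : set (g_sigma_algebraType G)).
  by apply: sub_sigma_algebra; exists (f i).
change (measurable (\big[setI/setT]_(i < m) A i : set (g_sigma_algebraType G))).
by apply: big_ind => //; exact: (@measurableI _ (g_sigma_algebraType G)).
Qed.

Variables (I : choiceType) (D : set I) (T : Type) (X1 X2 : I -> T -> {RV P >-> R}).
Hypotheses (ind1 : mutually_independent P D (fun i => sigma_process (X1 i)))
  (ind2 : mutually_independent P D (fun i => sigma_process (X2 i)))
  (ind12 : forall A B, sigma_join D (fun i => sigma_process (X1 i)) A ->
     sigma_join D (fun i => sigma_process (X2 i)) B -> P (A `&` B) = (P A * P B)%E).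

(** Independence inside each family together with independence of the two joins gives the product
    rule for rectangles; [independent_pairs] extends it to events that mix [X1 (f i)] and [X2 (f i)]
    for each [i]. *)
Lemma independent_sequences (A0 : set Omega) m (f : 'I_m -> I) (E : 'I_m -> set Omega) :
  measurable A0 ->
  (forall A B, sigma_join D (fun i => sigma_process (X1 i)) A ->
     sigma_join D (fun i => sigma_process (X2 i)) B -> P (A0 `&` (A `&` B)) = (P A0 * (P A * P B))%E) ->
  injective f -> (forall i, D (f i)) ->
  (forall i, exists2 Q : set (g_sigma_algebraType (\bigcup_(u in [set: T])
      preimage_set_system [set: Omega] (X1 (f i) u) measurable) *
    g_sigma_algebraType (\bigcup_(u in [set: T])
      preimage_set_system [set: Omega] (X2 (f i) u) measurable)),
    measurable Q & E i = [set w | Q (w, w)]) ->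
  P (A0 `&` \big[setI/setT]_(i < m) E i) = (P A0 * \prod_(i < m) P (E i))%E.
Proof.
move=> mA0 ind0 injf Df EQ.
apply: (independent_pairs (fun i => @sigma_process_measurable _ _ _ P _ (X1 (f i)))
  (fun i => @sigma_process_measurable _ _ _ P _ (X2 (f i))) mA0) => // [i A B FA FB|A B FA FB].
  by apply: ind12; apply: sub_sigma_algebra; exists (f i).
rewrite big_split/= ind0; last 2 first.
- exact: sigma_join_bigI.
- exact: sigma_join_bigI.
rewrite (mutually_independent_ord injf Df ind1)// (mutually_independent_ord injf Df ind2)//.
by rewrite big_split.
Qed.

End independent_sequences.

Section almost_sure_events.
Context d (Omega : measurableType d) (R : realType) (P : probability Omega R).

Lemma eq_probability_ae (A B : set Omega) : measurable A -> measurable B ->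
  {ae P, forall w, A w <-> B w} -> P A = P B.
Proof.
move=> mA mB AB; rewrite -[A]setIT -[B]setIT -!integral_indic//.
apply: ae_eq_integral => //; try exact/measurable_EFinP/measurable_indic.
apply: filterS AB => w AB _; congr (_%:E); rewrite !indicE; congr (_%:R).
by congr nat_of_bool; apply/idP/idP; rewrite !inE => /AB.
Qed.

Lemma bigI_forall (I : finType) (A : I -> set Omega) :
  \big[setI/setT]_i A i = [set w | forall i, A i w].
Proof.
apply/seteqP; split => w /= h; last by apply: (big_ind (fun A : set Omega => A w)) => // i _; exact: h.
by move=> i; move: h; rewrite (bigD1 i)//= => -[].
Qed.

Lemma measurable_forall (I : finType) (A : I -> set Omega) :
  (forall i, measurable (A i)) -> measurable [set w | forall i, A i w].
Proof. by move=> mA; rewrite -bigI_forall; apply: big_ind => //; exact: measurableI. Qed.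

Lemma ae_finite (I : finType) (A : I -> Omega -> Prop) :
  (forall i, {ae P, forall w, A i w}) -> {ae P, forall w, forall i, A i w}.
Proof.
move=> hA; suff : {ae P, forall w, forall i, i \in enum I -> A i w}.
  by apply: filterS => w h i; apply: h; rewrite mem_enum.
elim: (enum I) => [|i s IH]; first by apply: nearW.
apply: filterS2 (hA i) IH => w h1 h2 j; rewrite inE => /orP[/eqP ->//|]; exact: h2.
Qed.

End almost_sure_events.

Lemma same_law_gt d0 (O0 : measurableType d0) d (Omega : measurableType d) (R : realType)
    (P0 : probability O0 R) (P : probability Omega R) (T : Type)
    (X0 : T -> {RV P0 >-> R}) (X : T -> {RV P >-> R}) (u : T) (c : R) : same_law X0 X ->
  {ae P0, forall w, c < X0 u w} -> {ae P, forall w, c < X u w}.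
Proof.
move=> sl ae0.
have mB : measurable [set tau : 1.-tuple R | tnth tau ord0 <= c].
  have mf : measurable_fun setT (fun tau : 1.-tuple R => tnth tau ord0 : R) by exact: measurable_tnth.
  have := measurable_fun_ler mf (measurable_cst c) measurableT (Y := [set true]) I.
  by rewrite setTI.
have mle e (O : measurableType e) (Q : probability O R) (W : T -> {RV Q >-> R}) :
    measurable [set w | W u w <= c].
  have mW : measurable_fun setT (W u) by [].
  have := measurable_fun_ler mW (measurable_cst c) measurableT (Y := [set true]) I.
  by rewrite setTI.
have h := sl 1%N (fun=> u) _ mB.
exists [set w | X u w <= c]; split; first exact: mle.
  have -> : [set w | X u w <= c] = [set w | [set tau : 1.-tuple R | tnth tau ord0 <= c]
      [tuple X u w | j < 1]].
    by apply/seteqP; split => w /=; rewrite tnth_mktuple.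
  rewrite -h.
  have -> : [set w | [set tau : 1.-tuple R | tnth tau ord0 <= c]
      [tuple X0 u w | j < 1]] = [set w | X0 u w <= c].
    by apply/seteqP; split => w /=; rewrite tnth_mktuple.
  apply: measure_negligible; first exact: mle.
  apply: negligibleS ae0 => w /=.
  by rewrite leNgt => /negP.
by move=> w /= /negP; rewrite -leNgt.
Qed.

Lemma lt_row_min (R : realType) (v : nat -> R) n (c : R) :
  c < row_min v n.+1 <-> forall i : 'I_n.+1, c < v i.
Proof.
rewrite /row_min; split => [h i|h].
  by apply: lt_le_trans h _; exact: bigmin_le_cond.
by apply/bigmin_gtP; split => [|i _]; [exact: (h ord0)|exact: h].
Qed.

Section array_rows.
Context d0 (O0 : measurableType d0) d (Omega : measurableType d) d' (Omega' : measurableType d')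
  (R : realType).
Variables (P0 : probability O0 R) (P : probability Omega R) (P' : probability Omega' R)
  (S : R -> {RV P0 >-> R}) (kappa : R) (Y Sn : nat -> nat -> R -> {RV P >-> R})
  (rho : nat -> R -> R -> R) (Z : R -> {RV P' >-> R}) (Gamma : R -> R -> R)
  (k : nat) (t x : 'I_k -> R).
Local Notation leb := (@lebesgue_measure R).
Hypotheses (kappa0 : 0 < kappa)
  (Y_law : forall n i, (i < n)%N ->
    [/\ gaussian_process (Y n i), mean_zero (Y n i), unit_variance (Y n i) &
        correlation_function (Y n i) (rho n)])
  (Sn_law : forall n i, (i < n)%N -> same_law S (Sn n i))
  (indY : mutually_independent P triangle (fun ni => sigma_process (Y ni.1 ni.2)))
  (indS : mutually_independent P triangle (fun ni => sigma_process (Sn ni.1 ni.2)))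
  (indYS : mutually_independent P [set: 'I_2] (tnth
    [tuple sigma_join triangle (fun ni => sigma_process (Y ni.1 ni.2));
           sigma_join triangle (fun ni => sigma_process (Sn ni.1 ni.2))]))
  (cvg_rho : forall t1 t2, t1 != t2 ->
    0 < Gamma t1 t2 /\
    2 * norming n ^+ 2 * (1 - rho n t1 t2) @[n --> \oo] --> Gamma t1 t2)
  (Z_law : [/\ gaussian_process Z, mean_zero Z & incremental_variance Z Gamma]).

Let indSY A B : sigma_join triangle (fun ni => sigma_process (Sn ni.1 ni.2)) A ->
  sigma_join triangle (fun ni => sigma_process (Y ni.1 ni.2)) B -> P (A `&` B) = (P A * P B)%E.
Proof. by move=> SA YB; rewrite setIC muleC; exact: (mutually_independent_pair indYS). Qed.

Let scale n (j : 'I_k) (y : R) : R := norming n * y.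

Let entry n i : set Omega :=
  [set w | alive kappa x (fun j => Sn n i (t j) w) (fun j => scale n j (Y n i (t j) w))].

Let mscale_ n j : measurable_fun setT (scale n j). Proof. exact: measurable_funM. Qed.

Let mentry n i : measurable (entry n i).
Proof.
apply: (@measurable_alive _ _ _ _ kappa0 _ _ (fun j w => Sn n i (t j) w)
  (fun j w => scale n j (Y n i (t j) w))) => j.
  by have : measurable_fun setT (Sn n i (t j)) by [].
have mY : measurable_fun setT (Y n i (t j)) by [].
exact: (measurableT_comp (mscale_ n j) mY).
Qed.

Lemma row_survival n : P (\big[setI/setT]_(i < n) entry n i) = (\prod_(i < n) P (entry n i))%E.
Proof.
have := @independent_sequences _ _ _ P _ _ _ _ _ indS indY indSY setT n
  (fun i : 'I_n => (n, i : nat)) (entry n).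
rewrite setTI probability_setT mul1e; apply => //.
- by move=> A B SA YB; rewrite setTI mul1e indSY.
- by move=> i j [] /val_inj.
- by move=> i; exact: ltn_ord.
- by move=> i; eexists; [exact: (@measurable_alive_section _ _ _ P _ _ kappa x t kappa0 (Sn n i) (Y n i) _ (mscale_ n))|].
Qed.

(** The integral over [S] is taken on the original space [O0], which both the array and the limit
    reach through [same_law]; the two sides therefore produce literally the same number. *)
Definition limit_intensity : R :=
  \int[P0]_w0 \int[sigma_finite_product leb P']_z
    (1 - \prod_j (1 - window (level kappa x (fun j => S (t j) w0) j) (z.1 + Z (t j) z.2))).

Let norming_gt0 n : 0 < norming n.+1 :> R.
Proof. by rewrite divr_gt0// sqrtr_gt0 mulr_gt0// pi_gt0. Qed.

(** The scaled entry is normal with variance [norming n.+1 ^+ 2], so its density is at most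
    [1 / (norming n.+1 * sqrt (2 pi))], which equals [1 / n.+1] by the choice of the norming. *)
Let entry_marginal n i j (B : set (measurableTypeR R)) : (i <= n)%N -> measurable B ->
  ((n.+1%:R)%:E * P ((fun w => norming n.+1 * Y n.+1 i (t j) w)%R @^-1` B) <= leb B)%E.
Proof.
move=> ni mB; have [gY mY vY _] := Y_law (ni : (i < n.+1)%N).
have [m [s ms]] := gY 1%N (fun=> t j) (fun=> norming n.+1).
have e : (fun w => \sum_(l < 1) norming n.+1 * Y n.+1 i (t j) w) =
    (fun w => norming n.+1 * Y n.+1 i (t j) w).
  by apply/funext => w; rewrite big_ord_recl big_ord0 addr0.
rewrite e in ms.
have mX : measurable_fun setT (fun w => norming n.+1 * Y n.+1 i (t j) w) by exact: measurable_funM.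
have [e1 e2 _] := gaussian_moments mX ms.
have [i1 e3] := mean_zero_integrable (mY (t j)).
have [i2 e4] := second_moment (mY (t j)) (vY (t j)).
have m0 : m = 0 by rewrite -e1 RintegralZl// e3 mulr0.
have s2 : s ^+ 2 = norming n.+1 ^+ 2.
  rewrite -e2 m0; transitivity (\int[P]_w (norming n.+1 ^+ 2 * Y n.+1 i (t j) w ^+ 2)).
    by apply: eq_RintegralT => w; rewrite subr0 exprMn.
  by rewrite RintegralZl// e4 mulr1.
have s0 : s != 0 by rewrite -sqrf_eq0 s2 sqrf_eq0 gt_eqF.
rewrite ms//; apply: (@le_trans _ _ ((n.+1%:R)%:E * ((normal_peak s)%:E * leb B))%E).
  by rewrite lee_pmul2l// gaussian_law_le.
rewrite muleA -EFinM.
suff -> : n.+1%:R * normal_peak s = 1 :> R by rewrite mul1e.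
rewrite /normal_peak s2 /norming -(mulr_natl _ 2).
have pn0 : pi != 0 :> R by rewrite gt_eqF// pi_gt0.
have pi0 : 0 < 2 * pi :> R by rewrite mulr_gt0// pi_gt0.
rewrite expr_div_n sqr_sqrtr ?ltW//.
have e5 (a p : R) : p != 0 -> 2 * (a / (2 * p) * p) = a by move=> p0; field.
rewrite e5// sqrtr_sqr ger0_norm// mulfV// pnatr_eq0.
Qed.

Lemma cvg_entry (u : nat -> nat) : (forall n, u n <= n)%N ->
  n.+1%:R * (1 - fine (P (entry n.+1 (u n)))) @[n --> \oo] --> limit_intensity.
Proof.
move=> un.
have un' n : (u n < n.+1)%N by rewrite ltnS.
have e n : P (entry n.+1 (u n)) = (\int[P0]_w0 \int[P]_w \prod_j
     (1 - window (level kappa x (fun j => S (t j) w0) j) (norming n.+1 * Y n.+1 (u n) (t j) w)))%:E.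
  apply: (@independent_alive _ _ _ _ _ P0 P _ _ kappa x t kappa0 S (Sn n.+1 (u n)) (Y n.+1 (u n)) (scale n.+1)) => //; first exact: Sn_law (un' n).
  by move=> A B SA YB; apply: indSY; apply: sub_sigma_algebra; exists (n.+1, u n) => //; exact: un.
under eq_fun do rewrite e/=.
pose w n : {nonneg R} := NngNum (ler0n R n.+1).
have [gZ mZ GZ] := Z_law.
apply: (@cvg_expected_hit _ _ _ _ _ P0 P _ _ x (fun j => S (t j))
  (fun n j w => norming n.+1 * Y n.+1 (u n) (t j) w) w
  (fun r => \int[sigma_finite_product leb P']_z (1 - \prod_j (1 - window (r j) (z.1 + Z (t j) z.2))))) => //.
- by move=> n j; exact: measurable_funM.
- by move=> n j B mB; exact: entry_marginal.
move=> r.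
(* [G] is instantiated by the second moments of the increments of [Z]; their identification with
   [Gamma] is left to the convergence of the array increments. *)
apply: (@cvg_gaussian_hit _ _ _ _ _ P P' _ (fun n j => Y n.+1 (u n) (t j)) (fun j => Z (t j))
  (fun n => norming n.+1) w (fun i j => \int[P']_w (Z (t i) w - Z (t j) w) ^+ 2)) => //.
- by move=> n /=; rewrite /norming divfK// gt_eqF// sqrtr_gt0 mulr_gt0// pi_gt0.
- have h : 2 * pi * (n.+1%:R^-1 * n.+1%:R^-1) @[n --> \oo] --> (2 * pi * (0 * 0) : R).
    by apply: cvgM; [exact: cvg_cst|apply: cvgM; exact: cvg_harmonic].
  rewrite !mulr0 in h; apply: cvg_trans h; apply: near_eq_cvg; apply: nearW => n.
  rewrite /norming expr_div_n sqr_sqrtr; last by rewrite mulr_ge0// pi_ge0.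
  have pn0 : pi != 0 :> R by rewrite gt_eqF// pi_gt0.
  have e5 (a p : R) : a != 0 -> p != 0 -> 2 * p * (a^-1 * a^-1) = (a ^+ 2 / (2 * p))^-1.
    by move=> a0 p0; field; rewrite a0 p0.
  by rewrite e5 ?pnatr_eq0.
- by move=> n c b; have [gY mY _ _] := Y_law (un' n); exact: gaussian_cos.
- by move=> c b; exact: gaussian_cos.
- by move=> n j; have [gY mY vY _] := Y_law (un' n); have [] := second_moment (mY (t j)) (vY (t j)).
- by move=> n j; have [gY mY vY _] := Y_law (un' n); have [] := second_moment (mY (t j)) (vY (t j)).
- move=> n i j; have [gY mY vY cY] := Y_law (un' n).
  by have [] := unit_variance_increment (t i) (t j) mY vY cY.
(* The times may repeat, while [cvg_rho] concerns distinct ones; at equal times the increments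
   vanish on both sides. *)
- move=> i j; have [->|tij] := eqVneq (t i) (t j).
    have z0 e2 (O2 : measurableType e2) (P2 : probability O2 R) (f : O2 -> R) :
        \int[P2]_w (f w - f w) ^+ 2 = 0.
      rewrite (eq_RintegralT _ (g := fun=> 0)); first by rewrite Rintegral_cst// mul0r.
      by move=> v; rewrite subrr expr0n.
    rewrite z0; under eq_fun do rewrite z0 mulr0; exact: cvg_cst.
  have [_ ->] := incremental_variance_increment (t i) (t j) mZ GZ.
  (* The increment of [Z] yields [Gamma (t j) (t i)], hence [cvg_rho] at the swapped pair. *)
  have tji : t j != t i by rewrite eq_sym.
  have [_ h] := cvg_rho tji; rewrite -cvg_shiftS in h.
  apply: cvg_trans h; apply: near_eq_cvg; apply: nearW => n /=.
  have [gY mY vY cY] := Y_law (un' n).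
  have [_ ee] := unit_variance_increment (t j) (t i) mY vY cY.
  rewrite mulrAC mulrC -ee; congr (_ * _); apply: eq_RintegralT => v; ring.
- by move=> i j; have [] := incremental_variance_increment (t i) (t j) mZ GZ.
- by move=> n j B mB; exact: entry_marginal.
Qed.

Lemma cvg_row_survival :
  fine (P (\big[setI/setT]_(i < n.+1) entry n.+1 i)) @[n --> \oo] --> expR (- limit_intensity).
Proof.
have fP n i : P (entry n i) = (1 - (1 - fine (P (entry n i))))%:E.
  by rewrite subKr fineK// fin_num_measure.
have e n : fine (P (\big[setI/setT]_(i < n.+1) entry n.+1 i)) =
    \prod_(i < n.+1) (1 - (1 - fine (P (entry n.+1 i)))).
  rewrite row_survival; under eq_bigr do rewrite fP.
  by rewrite prodEFin.
under eq_fun do rewrite e.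
apply: (@cvg_row_product _ (fun n i => 1 - fine (P (entry n.+1 i)))); last exact: cvg_entry.
move=> n i _.
have p1 : fine (P (entry n.+1 i)) <= 1.
  by rewrite -lee_fin fineK ?fin_num_measure// probability_le1.
by rewrite subr_ge0 p1 gerBl fine_ge0.
Qed.

(** The event and the intersection of the [entry] events agree where all the factors of the row
    exceed [kappa] at the times [t j]: there [Num.max] returns the factor itself, and the factor
    comes out of the absolute value. Finitely many almost sure conditions suffice for each row. *)
Lemma cvg_array_survival : (forall u, {ae P0, forall w, kappa < S u w}) ->
  fine (P [set w | forall j, x j < array_min (fun n i t w => Sn n i t w * Y n i t w) n.+1 (t j) w])
    @[n --> \oo] --> expR (- limit_intensity).
Proof.
move=> S_kappa; apply: cvg_trans cvg_row_survival; apply: near_eq_cvg; apply: nearW => n.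
have e : [set w | forall j, x j < array_min (fun n i t w => Sn n i t w * Y n i t w) n.+1 (t j) w] =
    [set w | forall i : 'I_n.+1, forall j,
      x j < norming n.+1 * `|Sn n.+1 i (t j) w * Y n.+1 i (t j) w|].
  apply/seteqP; split => w /= h => [i j|j]; first by have /lt_row_min := h j; apply.
  by apply/lt_row_min => i; exact: h.
rewrite e; congr fine; apply: eq_probability_ae.
- by rewrite bigI_forall; apply: measurable_forall => i; exact: mentry.
- apply: measurable_forall => i; apply: measurable_forall => j.
  have mf : measurable_fun setT (fun w => norming n.+1 * `|Sn n.+1 i (t j) w * Y n.+1 i (t j) w|).
    apply: measurable_funM => //; apply: measurableT_comp; first exact: normr_measurable.
    exact: measurable_funM.
  have := measurable_fun_ltr (measurable_cst (x j)) mf measurableT (Y := [set true]) I.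
  by rewrite setTI.
have : {ae P, forall w, forall ij : 'I_n.+1 * 'I_k, kappa < Sn n.+1 ij.1 (t ij.2) w}.
  apply: ae_finite => -[i j]/=; apply: (same_law_gt _ (S_kappa (t j))).
  exact: Sn_law.
apply: filterS => w hw; rewrite bigI_forall/=; split => h i j; have hij : kappa < Sn n.+1 i (t j) w := hw (i, j).
  have := h i j; rewrite level_lt// (max_idPl (ltW hij)) /scale.
  by rewrite (normrM (norming n.+1)) (normrM (Sn n.+1 i (t j) w)) (gtr0_norm (lt_trans kappa0 hij)) (gtr0_norm (norming_gt0 n)) -mulrA [X in _ * X]mulrC.
rewrite level_lt// (max_idPl (ltW hij)) /scale; have := h i j.
by rewrite (normrM (norming n.+1)) (normrM (Sn n.+1 i (t j) w)) (gtr0_norm (lt_trans kappa0 hij)) (gtr0_norm (norming_gt0 n)) mulrCA mulrC.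
Qed.

End array_rows.

(** * Poisson points *)

Section countable_partition.
Context d (Omega : measurableType d) (R : realType) (P : probability Omega R).

(** The cells have to cover only up to a null set. In the application they are the events that a
    point count equals [k], and the uncovered part is an infinite count. *)
Lemma integral_partition (A : nat -> set Omega) (F : Omega -> R) :
  (forall k, measurable (A k)) -> trivIset setT A -> (\sum_(k <oo) P (A k) = 1)%E ->
  measurable_fun setT F -> (forall w, 0 <= F w) ->
  (\int[P]_w (F w)%:E = \sum_(k <oo) \int[P]_w (F w * \1_(A k) w)%:E)%E.
Proof.
move=> mA tA A1 mF F0.
have mFE : measurable_fun setT (EFin \o F) by exact/measurable_EFinP.
have mU : measurable (\bigcup_k A k) by exact: bigcup_measurable.
have PU : P (\bigcup_k A k) = 1%E by rewrite measure_bigcup// -[RHS]A1; apply: eq_eseriesl => k; rewrite in_setT.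
rewrite (@ge0_negligible_integral _ _ _ P setT (~` \bigcup_k A k))//; last 3 first.
- exact: measurableC.
- by move=> w _; rewrite lee_fin.
- have := probability_setC P mU; rewrite PU subee//.
rewrite setTD setCK ge0_integral_bigcup//; last 2 first.
- exact: measurable_funTS.
- by move=> w _; rewrite lee_fin.
apply: eq_eseriesr => k _; rewrite integral_mkcond; apply: eq_integral => w _.
by rewrite patchE indicE; case: ifP => _; rewrite ?mulr1 ?mulr0.
Qed.

(* factors are turned one at a time from indicators of cells into the discrete functions [V j] *)
Lemma independent_discrete (m : nat) (A : 'I_m -> nat -> set Omega) (V : 'I_m -> Omega -> R)
    (v : 'I_m -> nat -> R) :
  (forall j k, measurable (A j k)) -> (forall j, trivIset setT (A j)) ->
  (forall j, \sum_(k <oo) P (A j k) = 1)%E ->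
  (forall n : 'I_m -> nat, P (\big[setI/setT]_(j < m) A j (n j)) = (\prod_(j < m) P (A j (n j)))%E) ->
  (forall j, measurable_fun setT (V j)) -> (forall j w, 0 <= V j w <= 1) ->
  (forall j k w, A j k w -> V j w = v j k) -> (forall j k, 0 <= v j k) ->
  (\int[P]_w (\prod_j V j w)%:E = \prod_j \int[P]_w (V j w)%:E)%E.
Proof.
move=> mA tA A1 Aprod mV V01 Vv v0.
suff : forall l, (l <= m)%N -> forall B : 'I_m -> Omega -> R,
    (forall j : 'I_m, if (j < l)%N then B j = V j else exists k, B j = \1_(A j k)) ->
    (\int[P]_w (\prod_j B j w)%:E = \prod_j \int[P]_w (B j w)%:E)%E.
  by move=> /(_ m (leqnn m)); apply => j; rewrite ltn_ord.
elim => [_ B hB|l IH lm B hB].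
  have [n hn] := choice (fun j => hB j : exists k, _).
  have e w : \prod_j B j w = \1_(\big[setI/setT]_(j < m) A j (n j)) w.
    rewrite (eq_bigr (fun j => \1_(A j (n j)) w)); last by move=> j _; rewrite hn.
    rewrite bigI_forall indicE; case: (boolP (w \in _)) => [/set_mem h|].
      by rewrite big1// => j _; rewrite indicE mem_set.
    rewrite notin_setE/= => /existsNP[j hj].
    by rewrite (bigD1 j)//= indicE memNset// mul0r.
  under eq_integral do rewrite e.
  have mI : measurable (\big[setI/setT]_(j < m) A j (n j)).
    by apply: big_ind => //; exact: measurableI.
  have := integral_indic P measurableT mI; rewrite setIT => h.
  apply: (etrans h); apply: (etrans (Aprod n)); apply: eq_bigr => j _.
  by rewrite hn integral_indic// setIT.
pose o := Ordinal lm.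
have Bo : B o = V o by have := hB o; rewrite ltnS leqnn.
have B01 j w : 0 <= B j w <= 1.
  have := hB j; case: ifP => [_ ->//|_ [k ->]].
  by rewrite indicE; case: (_ \in _); rewrite ?lexx ?ler01.
have B0 j w : 0 <= B j w by have /andP[] := B01 j w.
have mB j : measurable_fun setT (B j).
  by have := hB j; case: ifP => [_ ->//|_ [k ->]]; exact: measurable_indic.
pose B' k j := if j == o then \1_(A o k) else B j.
have hB' k (j : 'I_m) : if (j < l)%N then B' k j = V j else exists i, B' k j = \1_(A j i).
  rewrite /B'; have [->|jo] := eqVneq j o; first by rewrite /= ltnn; exists k.
  have := hB j; rewrite ltnS leq_eqVlt; case: eqP => [jl|_]//=.
  by move: jo; rewrite -(inj_eq val_inj)/= jl eqxx.
pose c := \prod_(j | j != o) \int[P]_w B j w.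
have cE : (\prod_(j | j != o) \int[P]_w (B j w)%:E = c%:E)%E.
  by rewrite -prodEFin; apply: eq_bigr => j _; rewrite EFin_Rintegral//; exact: integrable01.
have Vo0 w : 0 <= V o w by rewrite -Bo.
have I0 k : (\int[P]_w (\1_(A o k) w)%:E = P (A o k))%E by rewrite integral_indic// setIT.
have IHk k : (\int[P]_w (\prod_j B j w * \1_(A o k) w)%:E = c%:E * ((v o k)%:E * P (A o k)))%E.
  rewrite muleCA muleA -muleA.
  have -> : (c%:E * P (A o k) = \int[P]_w (\prod_j B' k j w)%:E)%E.
    rewrite (IH (ltnW lm) (B' k) (hB' k)) (bigD1 o)//= /B' eqxx I0 muleC -cE; congr (_ * _)%E.
    by apply: eq_bigr => j /negPf ->.
  rewrite -ge0_integralZl//; last 3 first.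
  - apply/measurable_EFinP; apply: measurable_prod => j _; rewrite /B'.
    by case: ifP => _ //; exact: measurable_indic.
  - move=> w _; rewrite lee_fin; apply: prodr_ge0 => j _; rewrite /B'.
    by case: ifP => _ //; rewrite indicE.
  - by rewrite lee_fin.
  apply: eq_integral => w _; rewrite -EFinM; congr EFin.
  rewrite (bigD1 o)//= [in RHS](bigD1 o)//= /B' eqxx Bo.
  rewrite [X in _ = _ * (_ * X)](eq_bigr (fun j => B j w)); last by move=> j /negPf ->.
  rewrite indicE; case: (boolP (w \in A o k)) => [/set_mem h|_].
    by rewrite (Vv _ _ _ h) mulr1 mul1r.
  by rewrite mulr0 mul0r mulr0.
have IV k : (\int[P]_w (V o w * \1_(A o k) w)%:E = (v o k)%:E * P (A o k))%E.
  rewrite -I0 -ge0_integralZl//; last 2 first.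
  - by apply/measurable_EFinP; exact: measurable_indic.
  - by rewrite lee_fin.
  apply: eq_integral => w _; rewrite -EFinM; congr EFin.
  rewrite indicE; case: (boolP (w \in A o k)) => [/set_mem h|_].
    by rewrite (Vv _ _ _ h) mulr1.
  by rewrite !mulr0.
rewrite (integral_partition (A := A o))//; last 2 first.
- by apply: measurable_prod => j _.
- by move=> w; exact: prodr_ge0.
rewrite (bigD1 o)//= cE Bo (integral_partition (A := A o))//.
under eq_eseriesr do rewrite IHk.
under [in RHS]eq_eseriesr do rewrite IV.
rewrite nneseriesZl; first exact: muleC.
by move=> k _; rewrite mule_ge0// lee_fin.
Qed.

End countable_partition.

(** * Poisson weights and Poisson functionals *)

Section poisson_law.
Context (R : realType).
Implicit Types (lam c : R) (k : nat).
Local Notation q lam k := (poisson_prob lam 0 [set k]).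

Lemma poisson_prob_set1 lam k : 0 < lam ->
  q lam k = (lam ^+ k / k`!%:R * expR (- lam))%:E.
Proof.
move=> lam0; rewrite /poisson_prob lam0 esum_set1 /poisson_pmf ?lam0//.
by rewrite lee_fin mulr_ge0 ?expR_ge0// divr_ge0 ?exprn_ge0 ?(ltW lam0).
Qed.

Lemma poisson_prob0_set1 k : q 0 k = ((k == 0)%:R : R)%:E.
Proof.
rewrite /poisson_prob ltxx diracE; congr (_%:R%:E); congr nat_of_bool.
by rewrite in_set1 eq_sym.
Qed.

Lemma poisson_prob_sum lam : (\sum_(k <oo) q lam k = 1)%E.
Proof.
have <- : poisson_prob lam 0 (\bigcup_k [set k]) = 1%E.
  rewrite (_ : \bigcup_k [set k] = setT) ?probability_setT//.
  by apply/seteqP; split => // k _; exists k.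
rewrite measure_bigcup//; last by move=> i j _ _ [x [-> ->]].
by apply: eq_eseriesl => k; rewrite in_setT.
Qed.

(** Weighting by [(1 - c)^k] gives again a Poisson law, up to a constant. Summation over [k] then
    yields the generating function from total mass 1, with no series to evaluate. At parameter 0 the
    law is a Dirac mass, whence the separate cases. *)
Lemma poisson_thinning lam c k : 0 <= lam -> 0 <= c <= 1 ->
  (((1 - c) ^+ k)%:E * q lam k = (expR (- (lam * c)))%:E * q (lam * (1 - c)) k)%E.
Proof.
rewrite le_eqVlt => /orP[/eqP <- _|lam0 /andP[c0 c1]].
  rewrite !mul0r oppr0 expR0 !poisson_prob0_set1 -!EFinM; congr EFin.
  by case: k => [|k]; rewrite ?expr0 ?mulr0.
rewrite (poisson_prob_set1 _ lam0); have [->|c1'] := eqVneq c 1.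
  rewrite subrr mulr0 poisson_prob0_set1 -!EFinM mulr1; congr EFin.
  by case: k => [|k]; rewrite ?expr0n/= ?mul0r ?mulr0// fact0 divr1 expr0 !mul1r mulr1.
have c2 : 0 < 1 - c by rewrite subr_gt0 lt_neqAle c1'.
rewrite (poisson_prob_set1 _ (mulr_gt0 lam0 c2)) -!EFinM; congr EFin.
rewrite [RHS]mulrCA -expRD exprMn mulrCA !mulrA; congr (_ * expR _); last by ring.
by rewrite mulrAC.
Qed.

(** [k] times the weight at [k] is [lam] times the weight at [k - 1], so the series is [lam] times
    the total mass. *)
Lemma poisson_mean lam : 0 <= lam -> (\sum_(k <oo) (k%:R)%:E * q lam k = lam%:E)%E.
Proof.
move=> lam0; rewrite nneseries_recl//; last by move=> k; rewrite mule_ge0// lee_fin.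
rewrite mul0e add0e -[RHS]mule1 -(poisson_prob_sum lam) -nneseriesZl//.
rewrite -nneseries_addn; last by move=> k; rewrite mule_ge0// lee_fin.
apply: eq_eseriesr => k _; rewrite addn1; move: lam0; rewrite le_eqVlt => /orP[/eqP <-|lam0].
  by rewrite !poisson_prob0_set1/= mule0 mul0e.
rewrite !poisson_prob_set1// -!EFinM factS natrM exprS; congr EFin.
have cancel (a b c f : R) : a != 0 -> b != 0 -> a * (lam * c / (a * b) * f) = lam * (c / b * f).
  by move=> a0 b0; field; rewrite a0 b0.
by rewrite cancel// pnatr_eq0// -lt0n fact_gt0.
Qed.

End poisson_law.

Section poisson_process.
Context d (Omega : measurableType d) (R : realType) (P : probability Omega R).
Variable U : nat -> {RV P >-> R}.
Local Notation leb := (@lebesgue_measure R).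
Hypothesis poisson_U : poisson_points leb U.
Implicit Types B : set (measurableTypeR R).

Let cell B k : set Omega := [set w | point_count U B w = k%:R%:E].

Let count B m w : nat := (\sum_(i < m) (U i w \in B))%N.

Let mU i : measurable_fun setT (U i : Omega -> measurableTypeR R).
Proof. by have : measurable_fun setT (U i) by []. Qed.

Let m1U B i : measurable B -> measurable_fun setT (fun w => \1_B (U i w) : R).
Proof.
move=> mB; have mi : measurable_fun setT (\1_B : measurableTypeR R -> R) by exact: measurable_indic.
exact: (measurableT_comp mi (mU i)).
Qed.

Let mcell B k : measurable B -> measurable (cell B k).
Proof.
move=> mB; have mc : measurable_fun setT (point_count U B).
  apply: ge0_emeasurable_sum => [i w _ _|i _]; first by rewrite lee_fin indicE.
  by apply/measurable_EFinP; exact: m1U.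
by have := mc measurableT _ (emeasurable_set1 (k%:R%:E)); rewrite setTI.
Qed.

Let trivIset_cell B : trivIset setT (cell B).
Proof.
move=> k l _ _ [w [wk wl]].
have : (k%:R%:E == l%:R%:E :> \bar R) by apply/eqP; apply: etrans (esym wk) wl.
by rewrite eqe eqr_nat => /eqP.
Qed.

Let cell_prob B k : measurable B -> (leb B < +oo)%E ->
  P (cell B k) = poisson_prob (fine (leb B)) 0 [set k].
Proof. by move=> mB Boo; have [h _ _] := poisson_U; exact: h. Qed.

Let cell_sum B : measurable B -> (leb B < +oo)%E -> (\sum_(k <oo) P (cell B k) = 1)%E.
Proof.
by move=> mB Boo; rewrite -(poisson_prob_sum (fine (leb B))); apply: eq_eseriesr => k _; exact: cell_prob.
Qed.

Let countE B m w : (count B m w)%:R = \sum_(i < m) (\1_B (U i w) : R).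
Proof. by rewrite natr_sum; apply: eq_bigr => i _; rewrite indicE. Qed.

Let cell_cvg B k w : cell B k w -> (count B m w)%:R @[m --> \oo] --> (k%:R : R).
Proof.
move=> Bk; have h : (\sum_(0 <= i < m) (\1_B (U i w))%:E)%E @[m --> \oo] --> (k%:R%:E : \bar R).
  rewrite -[k%:R%:E](Bk : point_count U B w = _) /point_count.
  by apply: is_cvg_nneseries => i _ _; rewrite lee_fin indicE.
apply: cvg_trans (fine_cvg h); apply: near_eq_cvg; apply: nearW => m /=.
by rewrite countE big_mkord sumEFin.
Qed.

Let count_le B k w m : cell B k w -> (count B m w <= k)%N.
Proof.
move=> Bk; have ck := cell_cvg Bk; rewrite -(ler_nat R) -(cvg_lim (@Rhausdorff R) ck).
apply: (nondecreasing_cvgn_le (u_ := fun m => (count B m w)%:R)); last by apply/cvg_ex; exists k%:R.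
apply/nondecreasing_seqP => n; rewrite ler_nat /count big_ord_recr/=; exact: leq_addr.
Qed.

(** The enumeration is arbitrary, so the single probabilities are unknown; but the first [m] points
    are among all points. On the cell where [B] contains [k] points the partial count is at most
    [k], and [poisson_mean] adds up these bounds. *)
Lemma poisson_points_mean B m : measurable B ->
  (\sum_(i < m) P (U i @^-1` B) <= leb B)%E.
Proof.
move=> mB; have [Boo|] := ltP (leb B) +oo%E; last by rewrite leye_eq => /eqP ->; rewrite leey.
pose F w : R := (count B m w)%:R.
have FE w : (F w)%:E = (\sum_(i < m) (\1_B (U i w))%:E)%E by rewrite /F countE sumEFin.
have -> : (\sum_(i < m) P (U i @^-1` B) = \int[P]_w (F w)%:E)%E.
  under eq_integral do rewrite FE.
  rewrite ge0_integral_sum//; last first.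
    by move=> i; apply/measurable_EFinP; exact: m1U.
  apply: eq_bigr => i _.
  have mUB : measurable (U i @^-1` B) by rewrite -[X in measurable X]setTI; exact: mU.
  by have := integral_indic P measurableT mUB; rewrite setIT => <-.
rewrite (integral_partition (A := cell B))//; last 3 first.
- by move=> k; exact: mcell.
- exact: cell_sum.
- rewrite (_ : F = fun w => \sum_(i < m) (\1_B (U i w) : R)); last by apply/funext => w; exact: countE.
  by apply: measurable_sum => i; exact: m1U.
have fB : leb B = (fine (leb B))%:E by rewrite fineK// ge0_fin_numE.
rewrite [leRHS]fB -(poisson_mean (fine_ge0 _))//.
apply: lee_nneseries => [k _ _|k _].
  by apply: integral_ge0 => w _; rewrite lee_fin mulr_ge0// indicE.
rewrite -cell_prob//.
have := integral_indic P measurableT (mcell k mB); rewrite setIT => <-.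
rewrite -ge0_integralZl//; last first.
  by apply/measurable_EFinP; apply: measurable_indic; exact: mcell.
apply: ge0_le_integral => //.
- by move=> w _; rewrite lee_fin mulr_ge0// indicE.
- apply/measurable_EFinP; apply: measurable_funM; last by apply: measurable_indic; exact: mcell.
  rewrite (_ : F = fun w => \sum_(i < m) (\1_B (U i w) : R)); last by apply/funext => w; exact: countE.
  by apply: measurable_sum => i; exact: m1U.
- apply/measurable_EFinP; apply: measurable_funM => //; apply: measurable_indic; exact: mcell.
move=> w _; rewrite -EFinM lee_fin indicE; case: (boolP (w \in _)) => [/set_mem h|_].
  by rewrite !mulr1 /F ler_nat; exact: count_le.
by rewrite !mulr0.
Qed.

Section simple_functional.
Variables (p : nat) (c : 'I_p -> R) (B : 'I_p -> set (measurableTypeR R)).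
Hypotheses (c01 : forall j, 0 <= c j <= 1) (mB : forall j, measurable (B j))
  (Boo : forall j, (leb (B j) < +oo)%E) (tB : trivIset setT B).

Let miss j m w : R := \prod_(i < m) (1 - c j * \1_(B j) (U i w)).

Let missE j m w : miss j m w = (1 - c j) ^+ count (B j) m w.
Proof.
rewrite /miss /count; elim: m => [|m IH]; first by rewrite !big_ord0.
rewrite !big_ord_recr/= IH exprD; congr (_ * _).
by rewrite indicE; case: (_ \in _); rewrite ?mulr1 ?expr1// mulr0 subr0 expr0.
Qed.

Let c01' j : 0 <= 1 - c j <= 1.
Proof. by have /andP[c0 c1] := c01 j; rewrite subr_ge0 c1 gerBl. Qed.

Let miss01 j m w : 0 <= miss j m w <= 1.
Proof. by have /andP[h0 h1] := c01' j; rewrite missE exprn_ge0//= exprn_ile1. Qed.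

Let mmiss j m : measurable_fun setT (miss j m).
Proof.
apply: measurable_prod => i _; apply: measurable_funB => //; apply: measurable_funM => //.
exact: m1U.
Qed.

Let survive j w : R := limn (fun m => miss j m w).

Let miss_cvg j w : miss j m w @[m --> \oo] --> survive j w.
Proof.
apply: (@nonincreasing_is_cvgn _ (fun m => miss j m w)).
  apply/nonincreasing_seqP => n; have /andP[h0 h1] := c01' j.
  rewrite !missE; apply: ler_wiXn2l => //; rewrite /count big_ord_recr/=; exact: leq_addr.
by exists 0 => _ [n _ <-]; have /andP[] := miss01 j n w.
Qed.

Let survive01 j w : 0 <= survive j w <= 1.
Proof.
apply/andP; split.
  by apply: limr_ge; [exact: (cvgP _ (@miss_cvg j w))|]; apply: nearW => m; have /andP[] := miss01 j m w.
by apply: limr_le; [exact: (cvgP _ (@miss_cvg j w))|]; apply: nearW => m; have /andP[] := miss01 j m w.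
Qed.

Let msurvive j : measurable_fun setT (survive j).
Proof. by apply: (measurable_fun_cvg (mmiss j)) => w _; exact: miss_cvg. Qed.

Let survive_cell j k w : cell (B j) k w -> survive j w = (1 - c j) ^+ k.
Proof.
move=> Bk; apply/cvg_lim => //.
(* The partial counts are integers, at most [k], and tend to [k]; at distance less than 1 they are
   equal to [k]. *)
have /cvgrPdist_lt/(_ _ (@ltr01 R))[M _ h] := cell_cvg Bk.
apply: (@cvg_trans _ ((1 - c j) ^+ k @[m --> \oo])); last exact: cvg_cst.
apply: near_eq_cvg; exists M => // m /= Mm; rewrite missE; congr (_ ^+ _).
have := h m Mm => /=; have := count_le m Bk; rewrite leq_eqVlt => /orP[/eqP ->//|lt].
rewrite ger0_norm ?subr_ge0 ?ler_nat ?(ltnW lt)// -natrB ?(ltnW lt)// ltrn1.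
by rewrite ltnNge subn_gt0 lt.
Qed.

(** On a cell [survive j] is [(1 - c j)^k]; [poisson_thinning] turns its weights into
    [exp (- lam c)] times those of another Poisson law, of total mass 1. *)
Let survive_mean j : (\int[P]_w (survive j w)%:E = (expR (- (fine (leb (B j)) * c j)))%:E)%E.
Proof.
rewrite (integral_partition (A := cell (B j)))//; last 3 first.
- by move=> k; exact: mcell.
- exact: cell_sum.
- by move=> w; have /andP[] := survive01 j w.
have lam0 : 0 <= fine (leb (B j)) by exact: fine_ge0.
rewrite -[RHS]mule1 -(poisson_prob_sum (fine (leb (B j)) * (1 - c j))) -nneseriesZl//.
apply: eq_eseriesr => k _; rewrite -poisson_thinning// -cell_prob//.
have := integral_indic P measurableT (mcell k (mB j)); rewrite setIT => <-.
have /andP[h0 h1] := c01' j.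
rewrite -ge0_integralZl//; last 2 first.
- by apply/measurable_EFinP; apply: measurable_indic; exact: mcell.
- by rewrite lee_fin exprn_ge0.
apply: eq_integral => w _; rewrite -EFinM; congr EFin.
rewrite indicE; case: (boolP (w \in _)) => [/set_mem h|_]; last by rewrite !mulr0.
by rewrite (survive_cell h).
Qed.

Let cell_independent (n : 'I_p -> nat) :
  P (\big[setI/setT]_(j < p) cell (B j) (n j)) = (\prod_(j < p) P (cell (B j) (n j)))%E.
Proof.
have [_ _ ind] := poisson_U.
apply: (@mutually_independent_ord _ _ _ P _ _ _ p id _ (fun _ _ h => h) (fun _ => I) (ind p B mB tB)).
move=> j /=; exists [set (n j)%:R%:E]; first exact: emeasurable_set1.
by rewrite setTI.
Qed.

(** Exchanging the products over points and over sets isolates one factor per set. Its limit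
    [survive j] is a function of the number of points in [B j], and the counts of disjoint sets are
    independent. *)
Lemma poisson_simple_functional :
  \int[P]_w \prod_(i < m) \prod_j (1 - c j * \1_(B j) (U i w)) @[m --> \oo] -->
  expR (- \sum_j c j * fine (leb (B j))).
Proof.
have -> : expR (- \sum_j c j * fine (leb (B j))) = \int[P]_w \prod_j survive j w.
  apply: EFin_inj; rewrite EFin_Rintegral; last first.
    apply: integrable01 => [|w]; first exact: measurable_prod.
    by apply/andP; split; [apply: prodr_ge0 => j _|apply: prodr_ile1 => j _]; have /andP[] := survive01 j w.
  rewrite (@independent_discrete _ _ _ P p (fun j => cell (B j)) survive (fun j k => (1 - c j) ^+ k))//.
  - rewrite (eq_bigr _ (fun j _ => survive_mean j)) prodEFin -expR_sum -sumrN.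
    by congr (expR _)%:E; apply: eq_bigr => j _; rewrite mulrC.
  - by move=> j k; exact: mcell.
  - by move=> j; exact: cell_sum.
  - by move=> j k; have /andP[h0 h1] := c01' j; exact: exprn_ge0.
have e m w : \prod_(i < m) \prod_j (1 - c j * \1_(B j) (U i w)) = \prod_j miss j m w.
  by rewrite exchange_big.
apply: (@Rdominated_cvg _ _ _ P _ _ (fun=> 1)).
- by move=> m; apply: measurable_prod => i _; apply: measurable_prod => j _; apply: measurable_funB => //;
    apply: measurable_funM => //; exact: m1U.
- move=> w; under eq_fun do rewrite e.
  by apply: cvg_big => [|j _]; [exact: mul_continuous|exact: miss_cvg].
- exact: finite_measure_integrable_cst.
- move=> m w; rewrite e ger0_norm.
    by apply: prodr_ile1 => j _; exact: miss01.
  by apply: prodr_ge0 => j _; have /andP[] := miss01 j m w.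
Qed.

End simple_functional.

End poisson_process.

Section total_image.
Context d (Omega : measurableType d) (R : realType) (P : {measure set Omega -> \bar R}).
Context d' (T : measurableType d') (X : nat -> Omega -> T).
Hypothesis mX : forall i, measurable_fun setT (X i).

Lemma ge0_integral_images_le (nu : {measure set T -> \bar R}) (f : T -> \bar R) m :
  (forall A, measurable A -> \sum_(i < m) P (X i @^-1` A) <= nu A)%E ->
  measurable_fun setT f -> (forall x, 0 <= f x)%E ->
  (\sum_(i < m) \int[P]_w f (X i w) <= \int[nu]_x f x)%E.
Proof.
move=> PX mf f0.
pose push i : {measure set T -> \bar R} := pushforward P (X i).
pose m_ := push mX.
have e := @ge0_integral_measure_sum _ _ _ m_ setT measurableT f (fun x _ => f0 x) mf m.
have -> : (\sum_(i < m) \int[P]_w f (X i w) = \int[msum m_ m]_x f x)%E.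
  rewrite e; apply: eq_bigr => i _.
  exact/esym/(@ge0_integral_pushforward _ _ _ _ _ (X i) (mX i) P setT f measurableT mf (fun x _ => f0 x)).
by apply: ge0_le_measure_integral.
Qed.

End total_image.

Lemma prod_disjoint (R : realType) (T : Type) p (c : 'I_p -> R) (B : 'I_p -> set T) (u : T) :
  trivIset setT B ->
  \prod_j (1 - c j * \1_(B j) u) = 1 - \sum_j c j * \1_(B j) u.
Proof.
move=> tB; have [[j Bj]|nB] := pselect (exists j, B j u).
  have h i : i != j -> c i * \1_(B i) u = 0.
    move=> ij; rewrite indicE memNset ?mulr0// => Bi.
    by move/eqP: ij; apply; apply: tB => //; exists u.
  rewrite (bigD1 j)//= [in RHS](bigD1 j)//= !big1 ?mulr1 ?addr0//.
  by move=> i ij; rewrite h ?subr0.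
have h i : c i * \1_(B i) u = 0 by rewrite indicE memNset ?mulr0// => Bi; apply: nB; exists i.
by rewrite !big1 ?subr0// => i _; rewrite h ?subr0.
Qed.

Section level_approximation.
Context (R : realType) (h : R -> R).
Local Notation leb := (@lebesgue_measure R).
Hypotheses (mh : measurable_fun setT h) (h01 : forall u, 0 <= h u <= 1)
  (ih : leb.-integrable setT (EFin \o h)).

(* [layered N] rounds [h] down to multiples of [1 / N.+1] on [- N, N] and vanishes elsewhere;
   each of its layers has finite measure, as the Poisson counts require. *)
Definition layer N (j : 'I_N.+1) : set (measurableTypeR R) :=
  [set u | j.+1%:R <= N.+1%:R * h u < j.+2%:R] `&` `[- N%:R, N%:R].

Definition layer_value N (j : 'I_N.+1) : R := j.+1%:R / N.+1%:R.

Definition layered N (u : R) : R := \sum_j @layer_value N j * \1_(@layer N j) u.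

Lemma layer_value01 N j : 0 <= @layer_value N j <= 1.
Proof. by rewrite divr_ge0//= ler_pdivrMr// mul1r ler_nat ltn_ord. Qed.

Lemma measurable_layer N j : measurable (@layer N j).
Proof.
apply: measurableI => //.
have mf : measurable_fun setT (fun u : measurableTypeR R => N.+1%:R * h u) by exact: measurable_funM.
have -> : [set u | j.+1%:R <= N.+1%:R * h u < j.+2%:R] =
    setT `&` (fun u => N.+1%:R * h u) @^-1` `[j.+1%:R, j.+2%:R[%classic.
  by rewrite setTI; apply/seteqP; split => u /=; rewrite in_itv.
exact: mf.
Qed.

Lemma layer_finite N j : (leb (@layer N j) < +oo)%E.
Proof.
apply: (@le_lt_trans _ _ (leb `[- N%:R, N%:R]%classic)).
  by apply: le_measure; rewrite ?inE//; [exact: measurable_layer|move=> u []].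
by rewrite lebesgue_measure_itv/=; case: ifP => _; rewrite -?EFinB ?ltry.
Qed.

Lemma trivIset_layer N : trivIset setT (@layer N).
Proof.
move=> i j _ _ [u [[/andP[i1 i2] _] [/andP[j1 j2] _]]]; apply/val_inj/eqP.
have := le_lt_trans i1 j2; have := le_lt_trans j1 i2.
by rewrite !ltr_nat !ltnS eqn_leq => -> ->.
Qed.

Lemma layered_bounds N u : 0 <= layered N u <= h u /\ (`|u| <= N%:R -> h u - layered N u <= N.+1%:R^-1).
Proof.
have /andP[h0 h1] := h01 u.
have N0 : 0 < N.+1%:R :> R by [].
have [[j uj]|nB] := pselect (exists j, @layer N j u).
  have -> : layered N u = layer_value j.
    rewrite /layered (bigD1 j)//= indicE mem_set// mulr1 big1 ?addr0// => i ij.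
    rewrite indicE memNset ?mulr0// => ui.
    by move/eqP: ij; apply; apply: (@trivIset_layer N) => //; exists u.
  have [/andP[j1 j2] _] := uj; have /andP[v0 _] := layer_value01 j.
  rewrite v0/= /layer_value ler_pdivrMr// mulrC j1; split => // _.
  rewrite -(ler_pM2l N0) mulrBr mulfV// [_ * (_ / _)]mulrCA mulfV// mulr1.
  by rewrite lerBlDl natr1; exact: ltW.
have l0 : layered N u = 0.
  by rewrite /layered big1// => i _; rewrite indicE memNset ?mulr0// => ui; apply: nB; exists i.
rewrite l0 lexx h0; split => // uN; rewrite subr0.
rewrite leNgt; apply/negP => hN.
have a0 : 0 <= N.+1%:R * h u by rewrite mulr_ge0.
(* Layer [j] starts at height [j.+1], so a point with [l] the integer part of [N.+1 * h u] belongs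
   to layer [l.-1]; [l] is positive because [h u] exceeds [1 / N.+1]. *)
have /andP[t1 t2] := truncn_itv a0; set l := Num.trunc _ in t1 t2.
have l1 : (0 < l)%N.
  rewrite -ltnS -(ltr_nat R); apply: le_lt_trans t2.
  by apply: (@le_trans _ _ (N.+1%:R * N.+1%:R^-1)); [rewrite mulfV|rewrite ler_pM2l// ltW].
have lN : (l.-1 < N.+1)%N.
  by rewrite prednK// -(ler_nat R) (le_trans t1)// ler_piMr.
apply: nB; exists (Ordinal lN); split => /=; first by rewrite prednK// t1.
by rewrite in_itv/= -ler_norml.
Qed.

Lemma measurable_layered N : measurable_fun setT (layered N : measurableTypeR R -> R).
Proof.
apply: measurable_sum => j; apply: measurable_funM => //; apply: measurable_indic.
exact: measurable_layer.
Qed.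

Lemma integral_layered N : leb.-integrable setT (EFin \o layered N) /\
  \int[leb]_u layered N u = \sum_j @layer_value N j * fine (leb (@layer N j)).
Proof.
have i1 j : leb.-integrable setT (EFin \o (\1_(@layer N j) : R -> R)).
  apply: (@integrable_le _ _ _ leb _ (\1_(`[- N%:R, N%:R]%classic))).
  - by apply: measurable_indic; exact: measurable_layer.
  - move=> u; rewrite ger0_norm ?indicE// ler_nat.
    by case: (boolP (u \in layer j)) => // /set_mem[_ uN]; rewrite mem_set.
  - exact: integrable_indic_itv.
have i2 j : leb.-integrable setT (EFin \o (fun u => @layer_value N j * \1_(@layer N j) u)).
  by rewrite (_ : _ \o _ = fun u => ((@layer_value N j)%:E * (\1_(@layer N j) u)%:E)%E)//; exact: (integrableZl measurableT _ (i1 j)).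
have [i3 ->] := Rintegral_sum (index_enum 'I_N.+1) i2; split => //.
apply: eq_bigr => j _; rewrite RintegralZl//; congr (_ * _).
rewrite /Rintegral; congr fine.
by have := integral_indic leb measurableT (measurable_layer j); rewrite setIT.
Qed.

Lemma layered_cvg u : layered N u @[N --> \oo] --> h u.
Proof.
apply/cvgrPdist_le => eps eps0.
have [M _ hM] : \forall N \near \oo, `|N.+1%:R^-1| <= eps.
  by move/cvgr0_norm_le : (@cvg_harmonic R) => /(_ _ eps0).
exists (maxn M (Num.trunc `|u|).+1) => // N /=; rewrite geq_max => /andP[MN uN].
have [/andP[l0 l1] l2] := layered_bounds N u.
rewrite ger0_norm ?subr_ge0// (le_trans (l2 _))//.
  rewrite (le_trans (ltW (truncnS_gt _)))// ler_nat//.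
by have := hM N MN; apply: le_trans; exact: ler_norm.
Qed.

Lemma integral_layered_cvg : \int[leb]_u layered N u @[N --> \oo] --> \int[leb]_u h u.
Proof.
apply: (@Rdominated_cvg _ _ _ leb _ _ h).
- exact: measurable_layered.
- exact: layered_cvg.
- exact: ih.
- by move=> N u; have [/andP[l0 l1] _] := layered_bounds N u; rewrite ger0_norm.
Qed.

End level_approximation.

Section poisson_functional.
Context d (Omega : measurableType d) (R : realType) (P : probability Omega R).
Variable U : nat -> {RV P >-> R}.
Local Notation leb := (@lebesgue_measure R).
Hypothesis poisson_U : poisson_points leb U.
Variable h : R -> R.
Hypotheses (mh : measurable_fun setT h) (h01 : forall u, 0 <= h u <= 1)
  (ih : leb.-integrable setT (EFin \o h)).

(** Campbell's formula as an inequality, for the first [m] points of any enumeration. *)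
Lemma poisson_points_integral (f : R -> R) m : measurable_fun setT f -> (forall u, 0 <= f u) ->
  (\sum_(i < m) \int[P]_w (f (U i w))%:E <= \int[leb]_u (f u)%:E)%E.
Proof.
move=> mf f0.
apply: (@ge0_integral_images_le _ _ _ P _ (measurableTypeR R) (fun i w => U i w) _ leb (EFin \o f)).
- by move=> i; have : measurable_fun setT (U i) by [].
- by move=> A mA; exact: (poisson_points_mean poisson_U m mA).
- exact/measurable_EFinP.
- by move=> u; rewrite lee_fin.
Qed.

(** Telescoping for products of numbers in [[0, 1]]; the induction carries the order and the bounds
    of the two products along with the estimate. *)
Lemma prod_dist_le (m : nat) (a b : nat -> R) : (forall i, 0 <= a i <= b i) -> (forall i, b i <= 1) ->
  `|\prod_(i < m) (1 - b i) - \prod_(i < m) (1 - a i)| <= \sum_(i < m) (b i - a i).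
Proof.
move=> ab b1.
suff : [/\ 0 <= \prod_(i < m) (1 - b i), \prod_(i < m) (1 - b i) <= \prod_(i < m) (1 - a i),
    \prod_(i < m) (1 - a i) <= 1 &
    \prod_(i < m) (1 - a i) - \prod_(i < m) (1 - b i) <= \sum_(i < m) (b i - a i)].
  by move=> [_ h1 _ h2]; rewrite distrC ger0_norm// subr_ge0.
elim: m => [|m [IH1 IH2 IH3 IH4]]; first by rewrite !big_ord0 subrr; split.
rewrite !big_ord_recr/=.
move: IH1 IH2 IH3 IH4; set p := \prod_(i < m) (1 - b i); set q := \prod_(i < m) (1 - a i) => h1 h2 h3 h4.
have /andP[a0 ab'] := ab m; have b1' := b1 m.
have h5 : 0 <= 1 - b m by rewrite subr_ge0.
have h6 : 1 - b m <= 1 - a m by rewrite lerD2l lerN2.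
have h7 : 1 - a m <= 1 by rewrite gerBl.
split.
- exact: mulr_ge0.
- exact: ler_pM.
- exact: (mulr_ile1 (le_trans h1 h2) (le_trans h5 h6) h3 h7).
- have -> : q * (1 - a m) - p * (1 - b m) = (q - p) * (1 - b m) + q * (b m - a m) by ring.
  apply: lerD; last by rewrite ler_piMl// subr_ge0.
  by apply: le_trans h4; rewrite ler_piMr ?subr_ge0// gerBl (le_trans a0).
Qed.

(** The functions [layered h N] are covered by [poisson_simple_functional]. Replacing [h] costs at
    most the sum of [h - layered h N] over the points, whose mean is bounded by the Lebesgue
    integral, uniformly in the number [m] of factors. One error sequence has to serve for the
    integrals and for their limits, hence the two summands given to [cvg_approx]. *)
Lemma poisson_functional :
  \int[P]_w \prod_(i < m) (1 - h (U i w)) @[m --> \oo] --> expR (- \int[leb]_u h u).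
Proof.
have mhU i : measurable_fun setT (fun w => h (U i w)).
  exact: (measurableT_comp mh (_ : measurable_fun setT (U i))).
have mlU N i : measurable_fun setT (fun w => layered h N (U i w)).
  have mU : measurable_fun setT (U i : Omega -> measurableTypeR R) by have : measurable_fun setT (U i) by [].
  exact: (measurableT_comp (measurable_layered mh N) mU).
have lb N u := (layered_bounds h01 N u).1.
have l01 N u : 0 <= layered h N u <= 1.
  by have /andP[l0 lh] := lb N u; have /andP[_ h1] := h01 u; rewrite l0 (le_trans lh).
have prod01 m (f : nat -> Omega -> R) w : (forall i, 0 <= f i w <= 1) -> 0 <= \prod_(i < m) (1 - f i w) <= 1.
  move=> f01; apply/andP; split; [apply: prodr_ge0 => i _|apply: prodr_ile1 => i _];
  by have /andP[f0 f1] := f01 i; rewrite subr_ge0 ?f1 ?gerBl.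
have iprod m (f : nat -> Omega -> R) : (forall i, measurable_fun setT (f i)) ->
    (forall i w, 0 <= f i w <= 1) -> P.-integrable setT (EFin \o (fun w => \prod_(i < m) (1 - f i w))).
  move=> mf f01; apply: integrable01 => [|w]; last exact: prod01.
  by apply: measurable_prod => i _; exact: measurable_funB.
apply: (@cvg_approx _ _ _ (fun N m => \int[P]_w \prod_(i < m) (1 - layered h N (U i w)))
  (fun N => expR (- \int[leb]_u layered h N u))
  (fun N => `|\int[leb]_u h u - \int[leb]_u layered h N u| + `|expR (- \int[leb]_u h u) - expR (- \int[leb]_u layered h N u)|)).
- move=> N; have [_ ->] := integral_layered mh N.
  have := @poisson_simple_functional _ _ _ P U poisson_U _ (@layer_value R N) (@layer R h N)
    (@layer_value01 R N) (@measurable_layer R h mh N) (@layer_finite R h mh N) (@trivIset_layer R h N).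
  move=> hh; apply: cvg_trans hh; apply: near_eq_cvg; apply: nearW => m.
  apply: eq_RintegralT => w; apply: eq_bigr => i _; rewrite prod_disjoint//.
  exact: trivIset_layer.
- move=> N m; apply: (@le_trans _ _ (`|\int[leb]_u h u - \int[leb]_u layered h N u|)); last by rewrite /= lerDl.
  have i0 := iprod m (fun i w => h (U i w)) mhU (fun i w => h01 (U i w)).
  have i1 := iprod m (fun i w => layered h N (U i w)) (mlU N) (fun i w => l01 N (U i w)).
  have [il el] := integral_layered mh N.
  have idiff : leb.-integrable setT (EFin \o (fun u => h u - layered h N u)).
    rewrite (_ : _ \o _ = fun u => ((h u)%:E - (layered h N u)%:E)%E)//.
    exact: (integrableB measurableT ih il).
  rewrite -RintegralB// [leRHS]ger0_norm; last first.
    by apply: Rintegral_ge0 => u _; have /andP[_] := lb N u; rewrite subr_ge0.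
  rewrite -RintegralB//.
  have id0 : P.-integrable setT (EFin \o (fun w => \prod_(i < m) (1 - h (U i w)) - \prod_(i < m) (1 - layered h N (U i w)))).
    rewrite (_ : _ \o _ = fun w => ((\prod_(i < m) (1 - h (U i w)))%:E - (\prod_(i < m) (1 - layered h N (U i w)))%:E)%E)//.
    exact: (integrableB measurableT i0 i1).
  apply: le_trans (le_normr_Rintegral measurableT id0) _.
  have md : measurable_fun setT (fun u => h u - layered h N u).
    by apply/measurable_EFinP; exact: (measurable_int _ idiff).
  have d0 u : 0 <= h u - layered h N u by have /andP[_] := lb N u; rewrite subr_ge0.
  have d1 u : h u - layered h N u <= 1.
    by have /andP[l0 _] := lb N u; have /andP[_ h1] := h01 u; lra.
  have isum i : P.-integrable setT (EFin \o (fun w => h (U i w) - layered h N (U i w))).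
    apply: integrable01 => [|w]; last by rewrite d0 d1.
    exact: (measurable_funB (mhU i) (mlU N i)).
  have [isums esums] := Rintegral_sum (index_enum 'I_m) (fun i => isum (i : nat)).
  apply: (@le_trans _ _ (\int[P]_w \sum_(i < m) (h (U i w) - layered h N (U i w)))).
    apply: le_Rintegral => //; first exact: (integrable_norm id0).
    by move=> w _; apply: (@prod_dist_le m (fun i => layered h N (U i w)) (fun i => h (U i w))) => i; [exact: lb|have /andP[] := h01 (U i w)].
  rewrite esums -lee_fin EFin_Rintegral// -sumEFin.
  rewrite (eq_bigr (fun i : 'I_m => (\int[P]_w (h (U i w) - layered h N (U i w))%:E)%E)).
    exact: poisson_points_integral.
  by move=> i _; rewrite EFin_Rintegral.
- by move=> N; rewrite /= lerDr.
- set a := \int[leb]_u h u; set b := fun N => \int[leb]_u layered h N u.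
  have ba : b N @[N --> \oo] --> a by exact: (integral_layered_cvg mh h01 ih).
  have c1 : `|a - b N| @[N --> \oo] --> `|a - a| by apply: cvg_norm; apply: cvgB => //; exact: cvg_cst.
  have c2 : `|expR (- a) - expR (- b N)| @[N --> \oo] --> `|expR (- a) - expR (- a)|.
    apply: cvg_norm; apply: cvgB; first exact: cvg_cst.
    by apply: (cvg_comp _ _ (cvgN ba)); exact: continuous_expR.
  have e0 : (0 : R) = `|a - a| + `|expR (- a) - expR (- a)| by rewrite !subrr !normr0 addr0.
  rewrite e0; exact: (cvgD c1 c2).
Qed.

End poisson_functional.

(** * The limit process *)

Section partial_expectation.
Context d1 (T1 : measurableType d1) d2 (T2 : measurableType d2) (R : realType)
  (m2 : probability T2 R) (F : T1 * T2 -> R).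
Hypotheses (mF : measurable_fun setT F) (F01 : forall z, 0 <= F z <= 1).

Let mFx x : measurable_fun setT (fun y => F (x, y)).
Proof. exact: (measurableT_comp mF (pair1_measurable x)). Qed.

Lemma EFin_partial x : ((\int[m2]_y F (x, y))%:E = \int[m2]_y (F (x, y))%:E)%E.
Proof. by rewrite EFin_Rintegral//; exact: integrable01. Qed.

Lemma partial01 x : 0 <= \int[m2]_y F (x, y) <= 1.
Proof. exact: (Rintegral01 m2 (mFx x)). Qed.

Lemma measurable_partial : measurable_fun setT (fun x => \int[m2]_y F (x, y)).
Proof.
apply/measurable_EFinP; rewrite (_ : _ \o _ = fun x => (\int[m2]_y (F (x, y))%:E)%E).
  apply: (@measurable_fun_fubini_tonelli_F _ _ _ _ _ m2 (EFin \o F)) => //.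
    exact/measurable_EFinP.
  by move=> z; rewrite lee_fin; have /andP[] := F01 z.
by apply/funext => x; rewrite /= EFin_partial.
Qed.

End partial_expectation.

(** The intersections of [B] and [C] form a pi-system, on which [P (A & .)] and [P A * P] agree; two
    finite measures agreeing there agree on the generated sigma-algebra. This makes [S'] and [Z]
    together one block independent of the points. *)
Lemma independent_joint d (Omega : measurableType d) (R : realType) (P : probability Omega R)
    (G2 G3 : set (set Omega)) (A : set Omega) : measurable A ->
  G2 `<=` measurable -> G3 `<=` measurable ->
  (forall B C, <<s G2 >> B -> <<s G3 >> C -> P (A `&` (B `&` C)) = (P A * (P B * P C))%E) ->
  (forall B C, <<s G2 >> B -> <<s G3 >> C -> P (B `&` C) = (P B * P C)%E) ->
  forall E, <<s [set B `&` C | B in <<s G2 >> & C in <<s G3 >>] >> E -> P (A `&` E) = (P A * P E)%E.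
Proof.
move=> mA m2 m3 ind ind23 E GE.
have PA : P A \is a fin_num by exact: fin_num_measure.
pose c : {nonneg R} := NngNum (fine_ge0 (measure_ge0 P A)).
have cE : (c%:num)%:E = P A by rewrite /= fineK.
have cM X : mscale c P X = (P A * P X)%E by rewrite -cE.
pose G := [set B `&` C | B in <<s G2 >> & C in <<s G3 >>].
have T2 : <<s G2 >> setT by exact: (@measurableT _ (g_sigma_algebraType G2)).
have T3 : <<s G3 >> setT by exact: (@measurableT _ (g_sigma_algebraType G3)).
have GT : G setT by exists setT => //; exists setT => //; rewrite setIT.
have Gm : G `<=` measurable.
  move=> _ [B FB [C FC <-]]; apply: measurableI.
    exact: (sub_sigma_measurable m2).
  exact: (sub_sigma_measurable m3).
have cover : \bigcup_(k : nat) [set: Omega] = setT.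
  by apply/seteqP; split => // w _; exists 0%N.
have GI : setI_closed G.
  move=> _ _ [B FB [C FC <-]] [B' FB' [C' FC' <-]].
  exists (B `&` B'); first exact: (@measurableI _ (g_sigma_algebraType G2)).
  by exists (C `&` C'); [exact: (@measurableI _ (g_sigma_algebraType G3))|rewrite setIACA].
have h := @g_sigma_algebra_measure_unique _ R Omega G Gm (fun=> setT) (fun=> GT) cover
  (mrestr P mA) (mscale c P) GI.
have e : mrestr P mA E = mscale c P E.
  apply: h => // [_ [B FB [C FC <-]]|k].
    apply: etrans (esym (cM _)); apply: (etrans (congr1 P (setIC (B `&` C) A))).
    by apply: (etrans (ind _ _ FB FC)); rewrite ind23.
  by change (P (setT `&` A) < +oo)%E; rewrite setTI ltey_eq PA.
by move: e; rewrite /mrestr /mscale/= fineK// setIC.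
Qed.

Section limit_process.
Context d0 (O0 : measurableType d0) d' (Omega' : measurableType d') (R : realType).
Variables (P0 : probability O0 R) (P' : probability Omega' R) (S : R -> {RV P0 >-> R})
  (kappa : R) (U : nat -> {RV P' >-> R}) (S' Z : nat -> R -> {RV P' >-> R})
  (k : nat) (t x : 'I_k -> R).
Local Notation leb := (@lebesgue_measure R).
Hypotheses (kappa0 : 0 < kappa) (poisson_U : poisson_points leb U)
  (S'_law : forall i, same_law S (S' i))
  (indS' : mutually_independent P' [set: nat] (fun i => sigma_process (S' i)))
  (Z_same : forall i j, same_law (Z i) (Z j))
  (indZ : mutually_independent P' [set: nat] (fun i => sigma_process (Z i)))
  (ind3 : mutually_independent P' [set: 'I_3] (tnth
    [tuple sigma_process U;
           sigma_join [set: nat] (fun i => sigma_process (S' i));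
           sigma_join [set: nat] (fun i => sigma_process (Z i))])).

Let joinS := sigma_join [set: nat] (fun i => sigma_process (S' i)).
Let joinZ := sigma_join [set: nat] (fun i => sigma_process (Z i)).

Definition limit_alive i : set Omega' :=
  [set w | alive kappa x (fun j => S' i (t j) w) (fun j => U i w + Z i (t j) w)].

Let shift (u : R) (j : 'I_k) (y : R) : R := u + y.

Let mshift u j : measurable_fun setT (shift u j). Proof. exact: measurable_funD. Qed.

Let mU i : measurable_fun setT (U i). Proof. by []. Qed.
Let mZ i s : measurable_fun setT (Z i s). Proof. by []. Qed.
Let mS' i s : measurable_fun setT (S' i s). Proof. by []. Qed.
Let mS s : measurable_fun setT (S s). Proof. by []. Qed.

Lemma measurable_limit_alive i : measurable (limit_alive i).
Proof.
apply: (@measurable_alive _ _ _ _ kappa0 _ _ (fun j w => S' i (t j) w) (fun j w => U i w + Z i (t j) w)) => j.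
  exact: mS'.
by apply: measurable_funD; [exact: mU|exact: mZ].
Qed.

Let hit (z : (measurableTypeR R * O0) * Omega') : R :=
  1 - \prod_j (1 - window (level kappa x (fun j => S (t j) z.1.2) j) (z.1.1 + Z 0%N (t j) z.2)).

Let mhit : measurable_fun setT hit.
Proof.
apply: measurable_funB => //.
apply: (@measurable_survival _ _ _ x kappa0 _ _ (fun j (z : (measurableTypeR R * O0) * Omega') => S (t j) z.1.2)
   (fun j (z : (measurableTypeR R * O0) * Omega') => z.1.1 + Z 0%N (t j) z.2)) => j.
  apply: measurableT_comp (mS (t j)) _.
  exact: (measurableT_comp measurable_snd measurable_fst).
apply: measurable_funD; first exact: (measurableT_comp measurable_fst measurable_fst).
by apply: measurableT_comp (mZ 0%N (t j)) _; exact: measurable_snd.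
Qed.

Let hit01 z : 0 <= hit z <= 1.
Proof.
have /andP[h0 h1] := survival01 kappa x (fun j => S (t j) z.1.2) (fun j => z.1.1 + Z 0%N (t j) z.2).
by rewrite /hit subr_ge0 h1 gerBl.
Qed.

Let hit1 (z : measurableTypeR R * O0) : R := \int[P']_w hit (z, w).

Let mhit1 : measurable_fun setT hit1. Proof. exact: measurable_partial. Qed.
Let hit1_01 z : 0 <= hit1 z <= 1. Proof. exact: partial01. Qed.

(** The function [h] of the overview: the chance that a term whose point sits at [u] fails to exceed
    some threshold. The common laws of the marks are represented by [S] and by [Z 0]. *)
Definition hit_probability (u : measurableTypeR R) : R := \int[P0]_w0 hit1 (u, w0).

Lemma measurable_hit_probability : measurable_fun setT hit_probability.
Proof. exact: measurable_partial. Qed.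

Lemma hit_probability01 u : 0 <= hit_probability u <= 1.
Proof. exact: partial01. Qed.

Lemma limit_alive_shift i (u : R) :
  P' [set w | alive kappa x (fun j => S' i (t j) w) (fun j => shift u j (Z i (t j) w))] =
  (1 - hit_probability u)%:E.
Proof.
rewrite (@independent_alive _ _ _ _ _ P0 P' _ _ kappa x t kappa0 S (S' i) (Z i) (shift u))//; last first.
  move=> A B SA ZB; have := mutually_independent_triple ind3 (A := setT) (B := A) (C := B).
  rewrite setTI probability_setT mul1e; apply.
  - exact: (@measurableT _ (g_sigma_algebraType _)).
  - by apply: sub_sigma_algebra; exists i.
  - by apply: sub_sigma_algebra; exists i.
congr EFin.
transitivity (\int[P0]_w0 (1 - hit1 (u, w0))); last first.
  rewrite RintegralB//.
  - by rewrite Rintegral_cst//= -[fine _]/(fine (P0 setT)) probability_setT mulr1.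
  - exact: finite_measure_integrable_cst.
  - apply: integrable01 => [|w0]; last exact: hit1_01.
    exact: (measurableT_comp mhit1 (pair1_measurable u)).
apply: eq_RintegralT => w0.
have msurv : measurable_fun setT (fun tau : k.-tuple R =>
    \prod_j (1 - window (level kappa x (fun j => S (t j) w0) j) (shift u j (tnth tau j)))).
  apply: (@measurable_survival _ _ _ x kappa0 _ _ (fun j _ => S (t j) w0) (fun j (tau : k.-tuple R) => shift u j (tnth tau j))) => j //.
  exact: (measurableT_comp (mshift u j) (measurable_tnth j)).
have := @same_law_Rintegral _ _ _ _ _ P' P' _ (Z i) (Z 0%N) _ t _ (Z_same i 0%N) msurv.
have e l : \int[P']_w \prod_j (1 - window (level kappa x (fun j => S (t j) w0) j) (shift u j (Z l (t j) w))) =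
    \int[P']_w \prod_j (1 - window (level kappa x (fun j => S (t j) w0) j)
      (shift u j (tnth [tuple Z l (t j) w | j < k] j))).
  by apply: eq_RintegralT => w; apply: eq_bigr => j _; rewrite tnth_mktuple.
rewrite -!e => ->; rewrite /hit1 /hit/= RintegralB//.
- rewrite Rintegral_cst//= -[fine _]/(fine (P' setT)) probability_setT mulr1 subKr.
  by [].
- exact: finite_measure_integrable_cst.
- apply: integrable01 => [|w]; last exact: survival01.
  apply: (@measurable_survival _ _ _ x kappa0 _ _ (fun j _ => S (t j) w0) (fun j w => u + Z 0%N (t j) w)) => j //.
  exact: (measurableT_comp (mshift u j) (mZ 0%N (t j))).
Qed.

(** Tonelli in the extended reals, because the integrability of [hit_probability] is deduced from
    this identity and cannot be a premise; finiteness enters through [marginal_hit]. *)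
Lemma integral_hit_probability :
  (\int[leb]_u (hit_probability u)%:E = (@limit_intensity _ _ _ _ _ P0 P' S kappa (Z 0%N) k t x)%:E)%E.
Proof.
have mh1 : measurable_fun setT (EFin \o hit1) by exact/measurable_EFinP.
have h10 z : (0 <= (EFin \o hit1) z)%E by rewrite lee_fin; have /andP[] := hit1_01 z.
transitivity (\int[leb]_u \int[P0]_w0 (hit1 (u, w0))%:E)%E.
  by apply: eq_integral => u _; rewrite EFin_partial.
rewrite -(@fubini_tonelli1 _ _ _ _ _ leb P0 (EFin \o hit1))//.
rewrite (@fubini_tonelli2 _ _ _ _ _ leb P0 (EFin \o hit1))// /fubini_G/=.
pose H w0 (z : measurableTypeR R * Omega') : R := hit ((z.1, w0), z.2).
have mH w0 : measurable_fun setT (H w0).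
  apply: (measurableT_comp mhit); apply: measurable_fun_pair; last exact: measurable_snd.
  by apply: measurable_fun_pair => //; exact: measurable_fst.
have my j : measurable_fun setT (fun z : measurableTypeR R * Omega' => z.1 + Z 0%N (t j) z.2).
  apply: measurable_funD; first exact: measurable_fst.
  by apply: (measurableT_comp (mZ 0%N (t j))); exact: measurable_snd.
have marg j (B : set (measurableTypeR R)) : measurable B ->
    (sigma_finite_product leb P' ((fun z => (z.1 + Z 0%N (t j) z.2)%R) @^-1` B) <= leb B)%E.
  by move=> mB; rewrite (product_translation P' (mZ 0%N (t j)) mB).
have bound w0 := marginal_hit my marg (level kappa x (fun j => S (t j) w0)).
have e w0 : (\int[leb]_u (hit1 (u, w0))%:E = (\int[sigma_finite_product leb P']_z H w0 z)%:E)%E.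
  have [iH _] := bound w0.
  rewrite EFin_Rintegral; last exact: iH.
  transitivity (\int[leb]_u \int[P']_w (H w0 (u, w))%:E)%E.
    by apply: eq_integral => u _; rewrite EFin_partial.
  apply: esym; apply: (@fubini_tonelli1 _ _ _ _ _ leb P' (EFin \o H w0)).
    exact/measurable_EFinP.
  by move=> z; rewrite lee_fin; have /andP[] := hit01 ((z.1, w0), z.2).
under eq_integral do rewrite e.
rewrite -EFin_Rintegral//.
apply: (@integrable_le _ _ _ P0 _ (fun=> \sum_j 2 * (`|x j| / kappa))).
- apply/measurable_EFinP; rewrite (_ : _ \o _ = fun w0 => (\int[leb]_u (hit1 (u, w0))%:E)%E).
    exact: (@measurable_fun_fubini_tonelli_G _ _ _ _ _ leb (EFin \o hit1)).
  by apply/funext => w0; rewrite e.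
- move=> w0; have [_ hle] := bound w0; rewrite ger0_norm; last first.
    by apply: Rintegral_ge0 => z _; have /andP[] := hit01 ((z.1, w0), z.2).
  apply: (le_trans hle); apply: ler_sum => j _.
  rewrite ge_max mulr_ge0 ?divr_ge0 ?(ltW kappa0)// andbT ler_pM2l//.
  by apply: le_trans (level_bound x kappa0 _ _); exact: ler_norm.
- exact: finite_measure_integrable_cst.
Qed.

Lemma integrable_hit_probability : leb.-integrable setT (EFin \o hit_probability).
Proof.
apply/integrableP; split; first by apply/measurable_EFinP; exact: measurable_hit_probability.
rewrite (eq_integral (fun u => (hit_probability u)%:E)) ?integral_hit_probability ?ltry// => u _.
by have /andP[h0 _] := hit_probability01 u; rewrite /= ger0_norm.
Qed.

Let joinT (F : nat -> set (set Omega')) : sigma_join [set: nat] F setT.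
Proof. exact: (@measurableT _ (g_sigma_algebraType _)). Qed.

Let indSZ A B : joinS A -> joinZ B -> P' (A `&` B) = (P' A * P' B)%E.
Proof.
move=> SA ZB; have := mutually_independent_triple ind3 (A := setT) (B := A) (C := B).
by rewrite setTI probability_setT mul1e; apply => //; exact: (@measurableT _ (g_sigma_algebraType _)).
Qed.

Let sub_join (X : nat -> R -> {RV P' >-> R}) :
  \bigcup_(i in [set: nat]) sigma_process (X i) `<=` (measurable : set (set Omega')).
Proof.
move=> A [i _]; apply: sub_sigma_measurable; exact: sigma_process_measurable.
Qed.

(** With the points frozen by [independent_product], the terms become independent by
    [independent_sequences], and [limit_alive_shift] gives the factor of each index. *)
Lemma prob_limit_alives m (f : 'I_m -> nat) : injective f ->
  P' (\big[setI/setT]_(i < m) limit_alive (f i)) =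
  (\int[P']_w \prod_(i < m) (1 - hit_probability (U (f i) w)))%:E.
Proof.
move=> injf.
pose G1 := \bigcup_(i in [set: nat]) preimage_set_system [set: Omega'] (U i) measurable.
(* The intersections generate a sigma-algebra for which both families are measurable, in the form
   that [independent_joint] accepts. *)
pose G2 := [set B `&` C | B in joinS & C in joinZ].
pose T1 := g_sigma_algebraType G1; pose T2 := g_sigma_algebraType G2.
have process_in (X : nat -> R -> {RV P' >-> R}) i s (B : set R) : measurable B ->
    sigma_join [set: nat] (fun i => sigma_process (X i)) (X i s @^-1` B).
  move=> mB; apply: sub_sigma_algebra; exists i => //; apply: sub_sigma_algebra.
  by exists s => //; exists B => //; rewrite setTI.
have mU1 i : measurable_fun setT (U i : T1 -> R) := measurable_sub_process (X := U) i.
have mS2 i s : measurable_fun setT (S' i s : T2 -> R).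
  move=> _ B mB; rewrite setTI; apply: sub_sigma_algebra; exists (S' i s @^-1` B); first exact: process_in.
  by exists setT; [exact: joinT|rewrite setIT].
have mZ2 i s : measurable_fun setT (Z i s : T2 -> R).
  move=> _ B mB; rewrite setTI; apply: sub_sigma_algebra; exists setT; first exact: joinT.
  by exists (Z i s @^-1` B); [exact: process_in|rewrite setTI].
pose Q := [set z : T1 * T2 | forall i : 'I_m,
  alive kappa x (fun j => S' (f i) (t j) z.2) (fun j => U (f i) z.1 + Z (f i) (t j) z.2)].
have mQ : measurable Q.
  apply: (@measurable_forall _ (T1 * T2)%type _ (fun i => [set z : T1 * T2 |
    alive kappa x (fun j => S' (f i) (t j) z.2) (fun j => U (f i) z.1 + Z (f i) (t j) z.2)])) => i.
  apply: (@measurable_alive _ _ _ _ kappa0 _ (T1 * T2)%type (fun j (z : T1 * T2) => S' (f i) (t j) z.2)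
    (fun j (z : T1 * T2) => U (f i) z.1 + Z (f i) (t j) z.2)) => j.
    exact: (measurableT_comp (mS2 (f i) (t j)) (measurable_snd : measurable_fun setT (snd : T1 * T2 -> T2))).
  apply: measurable_funD.
    exact: (measurableT_comp (mU1 (f i)) (measurable_fst : measurable_fun setT (fst : T1 * T2 -> T1))).
  exact: (measurableT_comp (mZ2 (f i) (t j)) (measurable_snd : measurable_fun setT (snd : T1 * T2 -> T2))).
have G1m : G1 `<=` measurable by exact: sigma_process_measurable.
have G2m : G2 `<=` measurable.
  move=> _ [B SB [C ZC <-]]; apply: measurableI; apply: sub_sigma_measurable.
  - exact: (@sub_join S').
  - exact: SB.
  - exact: (@sub_join Z).
  - exact: ZC.
have ind12 C D : <<s G1 >> C -> <<s G2 >> D -> P' (C `&` D) = (P' C * P' D)%E.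
  move=> UC; apply: independent_joint.
  - exact: sub_sigma_measurable UC.
  - exact: sub_join.
  - exact: sub_join.
  - by move=> B E SB ZE; apply: (mutually_independent_triple ind3).
  - exact: indSZ.
have := independent_product G1m G2m ind12 mQ; rewrite bigI_forall => h.
apply: (etrans h); rewrite EFin_Rintegral; last first.
  apply: integrable01 => [|w].
    apply: measurable_prod => i _; apply: measurable_funB => //.
    exact: (measurableT_comp measurable_hit_probability (mU (f i) : measurable_fun setT (U (f i) : Omega' -> measurableTypeR R))).
  apply/andP; split; [apply: prodr_ge0 => i _|apply: prodr_ile1 => i _];
  by have /andP[h0 h1] := hit_probability01 (U (f i) w); rewrite subr_ge0 ?h1 ?gerBl.
apply: eq_integral => w1 _.
have := @independent_sequences _ _ _ P' _ _ _ _ _ indS' indZ indSZ setT m f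
  (fun i => [set w | alive kappa x (fun j => S' (f i) (t j) w)
     (fun j => shift (U (f i) w1) j (Z (f i) (t j) w))]).
rewrite setTI probability_setT mul1e bigI_forall => hp.
rewrite -prodEFin -(eq_bigr _ (fun i _ => limit_alive_shift (f i) (U (f i) w1))).
apply: hp => //.
- by move=> A B SA ZB; rewrite setTI mul1e indSZ.
- by move=> i; eexists; [exact: (@measurable_alive_section _ _ _ P' _ _ kappa x t kappa0 (S' (f i)) (Z (f i)) _ (mshift (U (f i) w1)))|].
Qed.

Lemma prob_limit_hit i : P' (~` limit_alive i) = (\int[P']_w (hit_probability (U i w))%:E)%E.
Proof.
have mhU : measurable_fun setT (fun w => hit_probability (U i w)).
  exact: (measurableT_comp measurable_hit_probability (mU i : measurable_fun setT (U i : Omega' -> measurableTypeR R))).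
have ih : P'.-integrable setT (EFin \o (fun w => hit_probability (U i w))).
  by apply: integrable01 => // w; exact: hit_probability01.
have := @prob_limit_alives 1%N (fun=> i) (fun a b _ => etrans (ord1 a) (esym (ord1 b))).
rewrite big_ord_recl big_ord0 setIT => h.
have := probability_setC P' (measurable_limit_alive i); rewrite h => ->.
rewrite -EFin_Rintegral// -EFinB; congr EFin.
transitivity (1 - \int[P']_w (1 - hit_probability (U i w))).
  by congr (1 - _); apply: eq_RintegralT => w; rewrite big_ord_recl big_ord0 mulr1.
rewrite RintegralB//; last exact: finite_measure_integrable_cst.
by rewrite Rintegral_cst//= -[fine _]/(fine (P' setT)) probability_setT mulr1 subKr.
Qed.

(** By [prob_limit_hit] the partial sums are means of [hit_probability] over the points, bounded by
    its Lebesgue integral. This is the premise of Borel-Cantelli in [ae_zeta_attained]. *)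
Lemma limit_hit_sum : (\sum_(i <oo) P' (~` limit_alive i) < +oo)%E.
Proof.
apply: (@le_lt_trans _ _ ((@limit_intensity _ _ _ _ _ P0 P' S kappa (Z 0%N) k t x)%:E)); last exact: ltry.
apply: lime_le; first by apply: is_cvg_nneseries.
apply: nearW => m; rewrite big_mkord -integral_hit_probability.
rewrite (eq_bigr (fun i : 'I_m => (\int[P']_w (hit_probability (U i w))%:E)%E)).
  apply: (poisson_points_integral poisson_U); first exact: measurable_hit_probability.
  by move=> u; have /andP[] := hit_probability01 u.
by move=> i _; exact: prob_limit_hit.
Qed.

Lemma prob_all_limit_alive :
  P' (\bigcap_i limit_alive i) = (expR (- @limit_intensity _ _ _ _ _ P0 P' S kappa (Z 0%N) k t x))%:E.
Proof.
pose F m := \big[setI/setT]_(i < m) limit_alive i.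
have mF m : measurable (F m).
  by apply: big_ind => //; [exact: measurableI|move=> i _; exact: measurable_limit_alive].
have FE : \bigcap_m F m = \bigcap_i limit_alive i.
  apply/seteqP; split => w Fw i _.
    by have := Fw i.+1 I; rewrite /F big_ord_recr/= => -[].
  by rewrite /F bigI_forall => l; exact: Fw.
have c1 : P' (F m) @[m --> \oo] --> P' (\bigcap_m F m).
  apply: nonincreasing_cvg_mu => //.
  - by rewrite ltey_eq fin_num_measure.
  - exact: bigcap_measurable.
  - apply/nonincreasing_seqP => m; apply/subsetPset.
    by rewrite /F big_ord_recr/= => w [].
rewrite -FE -(cvg_lim (@ereal_hausdorff R) c1); apply/cvg_lim => //.
have := poisson_functional poisson_U (h := hit_probability)
  measurable_hit_probability hit_probability01 integrable_hit_probability.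
have -> : \int[leb]_u hit_probability u = @limit_intensity _ _ _ _ _ P0 P' S kappa (Z 0%N) k t x.
  by apply: EFin_inj; rewrite EFin_Rintegral ?integral_hit_probability//; exact: integrable_hit_probability.
move=> c2; apply: cvg_EFin; first by apply: nearW => m; exact: fin_num_measure.
apply: cvg_trans c2; apply: near_eq_cvg; apply: nearW => m.
by rewrite /= /F prob_limit_alives//; exact: val_inj.
Qed.

End limit_process.

(** * The attained minimum and its survival probabilities *)

Section attained_minimum.
Context d0 (O0 : measurableType d0) d' (Omega' : measurableType d') (R : realType).
Variables (P0 : probability O0 R) (P' : probability Omega' R) (S : R -> {RV P0 >-> R})
  (kappa : R) (U : nat -> {RV P' >-> R}) (S' Z : nat -> R -> {RV P' >-> R}).
Local Notation leb := (@lebesgue_measure R).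
Hypotheses (kappa0 : 0 < kappa) (S_kappa : forall s, {ae P0, forall w, kappa < S s w})
  (poisson_U : poisson_points leb U)
  (S'_law : forall i, same_law S (S' i))
  (indS' : mutually_independent P' [set: nat] (fun i => sigma_process (S' i)))
  (Z_same : forall i j, same_law (Z i) (Z j))
  (indZ : mutually_independent P' [set: nat] (fun i => sigma_process (Z i)))
  (ind3 : mutually_independent P' [set: 'I_3] (tnth
    [tuple sigma_process U;
           sigma_join [set: nat] (fun i => sigma_process (S' i));
           sigma_join [set: nat] (fun i => sigma_process (Z i))])).

Local Notation term s w := (zeta_term U S' Z s w).

Lemma ae_S'_gt s : {ae P', forall w, forall i, kappa < S' i s w}.
Proof. by apply: ae_foralln => i; exact: (same_law_gt (S'_law i) (S_kappa s)). Qed.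

Lemma level_lt_term (x s : R) i w : kappa < S' i s w ->
  (x / Num.max (S' i s w) kappa < `|U i w + Z i s w|) = (x < term s w i).
Proof.
move=> h; rewrite (max_idPl (ltW h)) ltr_pdivrMr ?(lt_trans kappa0 h)//.
by rewrite /zeta_term mulrC.
Qed.

(** By Borel-Cantelli, almost surely only finitely many terms lie below any given integer level;
    integer levels suffice and keep the union of null sets countable. *)
Lemma ae_zeta_attained s : {ae P', forall w, exists i, forall j, term s w i <= term s w j}.
Proof.
pose F (L i : nat) := ~` limit_alive kappa U S' Z (fun _ : 'I_1 => s) (fun=> L%:R) i.
have F0 L : P' (lim_sup_set (F L)) = 0%E.
  apply: lim_sup_set_cvg0.
    by move=> i; apply: measurableC; exact: measurable_limit_alive.
  exact: (limit_hit_sum (fun _ : 'I_1 => s) (fun=> L%:R) kappa0 poisson_U S'_law indS' Z_same indZ ind3).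
have mF L : measurable (lim_sup_set (F L)).
  apply: bigcap_measurable; first by exists 0%N.
  move=> n _; apply: bigcup_measurable => i _; apply: measurableC.
  exact: measurable_limit_alive.
have aeF : {ae P', forall w, forall L, ~ lim_sup_set (F L) w}.
  apply: ae_foralln => L; exists (lim_sup_set (F L)).
  by split; [exact: mF|exact: F0|move=> w /= /contrapT].
apply: filterS2 aeF (ae_S'_gt s) => w hF hS.
(* A level above the term of index 0: from some [n] on no term can beat that one, so the minimum
   over the indices up to [n] is global. *)
pose L := (Num.trunc `|term s w 0%N|).+1.
have L0 : term s w 0%N < L%:R by rewrite (le_lt_trans (ler_norm _))// truncnS_gt.
have [n hn] : exists n, forall j, (n <= j)%N -> L%:R < term s w j.
  apply: contrapT => h; apply: (hF L) => n _; apply: contrapT => hn; apply: h.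
  exists n => j nj; rewrite -level_lt_term//.
  have [|/contrapT h] := pselect (F L j w); last exact: (h ord0).
  by move=> FLj; exfalso; apply: hn; exists j.
pose i0 : 'I_n.+1 := [arg min_(i < ord0) term s w (i : 'I_n.+1)]%O.
have i0P (j : 'I_n.+1) : term s w i0 <= term s w j.
  by rewrite /i0; case: arg_minP => // i _; apply.
exists i0 => j; have [jn|nj] := ltnP j n.+1; first exact: (i0P (Ordinal jn)).
by rewrite (le_trans (i0P ord0))//= (le_trans (ltW L0))// ltW// hn// ltnW.
Qed.

(** Attainment is essential: a strict lower bound of all terms need not be strict for an infimum
    that is not attained. *)
Lemma lt_zeta (x s : R) w : (exists i, forall j, term s w i <= term s w j) ->
  (x < zeta U S' Z s w) <-> (forall i, x < term s w i).
Proof.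
move=> [i hi].
have -> : zeta U S' Z s w = term s w i.
  apply/eqP; rewrite eq_le; apply/andP; split.
    by apply: ge_inf; [exists (term s w i) => _ [j _ <-]|exists i].
  by apply: lb_le_inf; [exists (term s w i); exists i|move=> _ [j _ <-]].
by split => [xi j|]; [exact: lt_le_trans (hi j)|apply].
Qed.

(** On sample points where the terms are unbounded below, the real [inf] is 0, and so is [fine] of
    [-oo]. Hence [zeta] is [fine] of the extended infimum everywhere, not just almost everywhere. *)
Lemma measurable_zeta s : measurable_fun setT (zeta U S' Z s).
Proof.
have mt i : measurable_fun setT (fun w => term s w i).
  apply: measurable_funM; first by have : measurable_fun setT (S' i s) by [].
  apply: measurableT_comp; first exact: normr_measurable.
  have mU : measurable_fun setT (U i) by [].
  have mZ : measurable_fun setT (Z i s) by [].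
  exact: measurable_funD.
have me : measurable_fun setT (fun w => einfs (fun i => (term s w i)%:E) 0%N).
  by apply: (@measurable_fun_einfs _ _ _ _ (fun i w => (term s w i)%:E)) => i; exact/measurable_EFinP.
rewrite (_ : zeta U S' Z s = fine \o (fun w => einfs (fun i => (term s w i)%:E) 0%N)).
  exact: (measurableT_comp _ me).
apply/funext => w /=.
have -> : einfs (fun i => (term s w i)%:E) 0%N = ereal_inf [set y%:E | y in range (term s w)].
  rewrite /einfs; congr ereal_inf; apply/seteqP; split => y /=.
    by move=> [i _ <-]; exists (term s w i) => //; exists i.
  by move=> [_ [i _ <-] <-]; exists i.
rewrite /zeta; have [lb|nlb] := pselect (has_lbound (range (term s w))).
  by rewrite ereal_inf_EFin//; exists (term s w 0%N); exists 0%N.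
rewrite inf_out; last by move=> [].
suff -> : ereal_inf [set y%:E | y in range (term s w)] = -oo%E by [].
apply: contrapT => /eqP h; apply: nlb.
have ub := @ereal_inf_lbound _ [set y%:E | y in range (term s w)].
move: h ub; case: ereal_inf => [r| |] // _ ub.
  by exists r => y ry; rewrite -lee_fin; apply: ub; exists y.
have := ub (term s w 0%N)%:E; rewrite leye_eq/= => h.
by have := h (ex_intro2 _ _ (term s w 0%N) (ex_intro2 _ _ 0%N I erefl) erefl).
Qed.

Lemma zeta_survival k (t x : 'I_k -> R) :
  P' [set w | forall j, x j < zeta U S' Z (t j) w] =
  (expR (- @limit_intensity _ _ _ _ _ P0 P' S kappa (Z 0%N) k t x))%:E.
Proof.
rewrite -(prob_all_limit_alive t x kappa0 poisson_U S'_law indS' Z_same indZ ind3).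
apply: eq_probability_ae.
- apply: measurable_forall => j.
  have := measurable_fun_ltr (measurable_cst (x j)) (measurable_zeta (t j)) measurableT (Y := [set true]) I.
  by rewrite setTI.
- by apply: bigcap_measurable; [exists 0%N|move=> i _; exact: measurable_limit_alive].
have aeS : {ae P', forall w, forall j : 'I_k, forall i, kappa < S' i (t j) w}.
  by apply: ae_finite => j; exact: ae_S'_gt.
have aeM : {ae P', forall w, forall j : 'I_k, exists i, forall l, term (t j) w i <= term (t j) w l}.
  by apply: ae_finite => j; exact: ae_zeta_attained.
apply: filterS2 aeS aeM => w hS hM; split => [h i _ j|h j].
  by rewrite /level level_lt_term//; exact: (lt_zeta (x j) (hM j)).1 (h j) i.
by apply/(lt_zeta (x j) (hM j)) => i; rewrite -level_lt_term//; exact: h.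
Qed.

End attained_minimum.

(** * From survival probabilities to weak convergence *)

Section grid_approximation.
Context (R : realType) (k : nat) (f : 'rV[R]_k -> R) (B : R).
Hypotheses (cf : continuous f) (fB : forall v, `|f v| <= B).

(** Half-open, so that the cells of a grid are disjoint and a box comes from survival events by
    differences. *)
Definition box (x y : 'I_k -> R) : set ('I_k -> R) := [set v | forall j, x j < v j <= y j].

(** Heine-Cantor, through the near-covering form of compactness; only [u] is confined to the
    cube. *)
Lemma uniform_continuity_cube (A eps : R) : 0 < eps ->
  exists2 delta, 0 < delta & forall u v : 'I_k -> R, (forall j, `|u j| <= A) ->
    (forall j, `|u j - v j| <= delta) -> `|f (\row_j u j) - f (\row_j v j)| <= eps.
Proof.
move=> eps0.
pose K : set 'rV[R]_k := [set v | forall i, `[- A, A]%classic (v ord0 i)].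
have cK : compact K.
  exact: (@rV_compact R k (fun=> `[- A, A]%classic) (fun _ => @segment_compact R (- A) A)).
pose Q (delta : R) (u : 'rV[R]_k) := forall v : 'rV[R]_k,
  (forall j, `|u ord0 j - v ord0 j| <= delta) -> `|f u - f v| <= eps.
have : \forall delta \near 0^'+, K `<=` Q delta.
  apply: ((@compact_near_coveringP _ K).1 cK R (0^'+) Q) => u Ku.
  have eps2 : 0 < eps / 2 by rewrite divr_gt0.
  have cfu : f v @[v --> u] --> f u by exact: cf.
  have /cvgrPdist_le/(_ _ eps2)/nbhs_ballP[r /= r0 hr] := cfu.
  have r2 : 0 < r / 2 by rewrite divr_gt0.
  have r2r : r / 2 <= r by lra.
  near=> u' delta => v uv.
  have uu' : ball u (r / 2) u' by near: u'; exact: nbhsx_ballx.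
  have d2 : delta < r / 2 by near: delta; exact: nbhs_right_lt.
  have h1 : `|f u - f u'| <= eps / 2.
    by apply: hr; exact: (le_ball r2r uu').
  have h2 : `|f u - f v| <= eps / 2.
    apply: hr; split => // i j; rewrite (ord1 i).
    have := uu'.2 ord0 j; rewrite /ball/= => h.
    have := uv j => h'.
    have -> : u ord0 j - v ord0 j = (u ord0 j - u' ord0 j) + (u' ord0 j - v ord0 j) by ring.
    by rewrite (le_lt_trans (ler_normD _ _))// [ltRHS]splitr ltrD// (le_lt_trans h').
  have -> : f u' - f v = (f u - f v) - (f u - f u') by ring.
  by rewrite (le_trans (ler_normB _ _))// [leRHS]splitr lerD.
move=> [delta /= delta0 h]; exists (delta / 2); first by rewrite divr_gt0.
move=> u v uA uv.
apply: (h (delta / 2)).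
- by rewrite /= sub0r normrN gtr0_norm ?divr_gt0// ltr_pdivrMr// ltr_pMr// ltr1n.
- by rewrite divr_gt0.
- by move=> j; rewrite /= mxE in_itv/= -ler_norml.
- by move=> j; rewrite !mxE.
Unshelve. all: by end_near.
Qed.

Lemma grid_cell (A : R) N (a : R) : 0 < A -> - A < a <= A ->
  exists l : 'I_N.+1, - A + 2 * A / N.+1%:R * l%:R < a <= - A + 2 * A / N.+1%:R * l.+1%:R.
Proof.
move=> A0 /andP[a1 a2]; set h := 2 * A / N.+1%:R.
have h0 : 0 < h by rewrite divr_gt0// mulr_gt0.
have hN : h * N.+1%:R = 2 * A by rewrite /h divfK.
have ex : exists l, a <= - A + h * l%:R.
  by exists N.+1; rewrite hN; lra.
case: (ex_minnP ex) => -[|l] hl hmin; first by move: hl; rewrite mulr0 addr0 leNgt a1.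
have lN : (l < N.+1)%N by apply: hmin; rewrite hN; lra.
exists (Ordinal lN); rewrite hl andbT ltNge; apply/negP => /hmin.
by rewrite ltnn.
Qed.

(** On each cell [f] is replaced by its value at the lower corner, the mesh being at most the
    modulus of continuity on the cube; outside the cube the step function is 0 and the error is at
    most [B]. *)
Lemma grid_approx (m : nat) : exists (I : finType) (c : I -> R) (x y : I -> 'I_k -> R),
  forall v : 'I_k -> R,
  `|f (\row_j v j) - \sum_i c i * \1_(box (x i) (y i)) v| <=
  m.+1%:R^-1 + B * (1 - \1_(box (fun=> - m.+1%:R) (fun=> m.+1%:R)) v).
Proof.
pose A : R := m.+1%:R; have A0 : 0 < A by [].
have [delta delta0 hd] := @uniform_continuity_cube A m.+1%:R^-1 ltac:(by rewrite invr_gt0).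
pose N := Num.trunc (2 * A / delta).
pose h := 2 * A / N.+1%:R.
have h0 : 0 < h by rewrite divr_gt0// mulr_gt0.
have hdelta : h <= delta.
  rewrite /h ler_pdivrMr// -ler_pdivrMl// [leLHS]mulrC ltW//; exact: truncnS_gt.
pose x (i : {ffun 'I_k -> 'I_N.+1}) j := - A + h * (i j)%:R.
pose y (i : {ffun 'I_k -> 'I_N.+1}) j := - A + h * (i j).+1%:R.
exists {ffun 'I_k -> 'I_N.+1}, (fun i => f (\row_j x i j)), x, y => v.
have cell_in i : box (x i) (y i) v -> box (fun=> - A) (fun=> A) v.
  move=> vi j; have /andP[h1 h2] := vi j; apply/andP; split.
    by apply: le_lt_trans h1; rewrite /x lerDl mulr_ge0// ltW.
  apply: (le_trans h2); rewrite /y addrC lerBlDr.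
  have -> : A + A = h * N.+1%:R by rewrite /h divfK//; ring.
  by rewrite ler_pM2l// ler_nat ltn_ord.
have [vA|nvA] := pselect (box (fun=> - A) (fun=> A) v); last first.
  rewrite big1 => [|i _]; last by rewrite indicE memNset ?mulr0// => /cell_in.
  by rewrite subr0 indicE memNset// subr0 mulr1 (le_trans (fB _))// lerDr invr_ge0.
have [i0 hi0] := choice (fun j => grid_cell N A0 (vA j)).
pose i : {ffun 'I_k -> 'I_N.+1} := [ffun j => i0 j].
have vi : box (x i) (y i) v by move=> j; have := hi0 j; rewrite /x /y ffunE.
rewrite (bigD1 i)//= big1 => [|i' ii']; last first.
  rewrite indicE memNset ?mulr0// => vi'; move/eqP : ii'; apply; apply/ffunP => j.
  have /andP[a1 a2] := vi j; have /andP[b1 b2] := vi' j.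
  have := lt_le_trans a1 b2; have := lt_le_trans b1 a2.
  rewrite /x /y !ltrD2l !ltr_pM2l// !ltr_nat !ltnS => c1 c2.
  by apply/val_inj/eqP; rewrite eqn_leq c1 c2.
rewrite !indicE !mem_set// mulr1 addr0 subrr mulr0 addr0.
apply: hd => j; have /andP[a1 a2] := vA j.
  by rewrite ler_norml a2 ltW.
have /andP[b1 b2] := vi j; rewrite ger0_norm ?subr_ge0 ?(ltW b1)//.
apply: le_trans hdelta; rewrite lerBlDr (le_trans b2)// /x /y -natr1 mulrDr mulr1; lra.
Qed.

End grid_approximation.

Section box_probability.
Context d (Omega : measurableType d) (R : realType) (P : probability Omega R) (k : nat)
  (M : 'I_k -> Omega -> R).
Hypothesis mM : forall j, measurable_fun setT (M j).

(* Bounding one more coordinate above removes an event of the same kind, so that boxes are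
   reached from survival events by induction on [l]. *)
Definition mixed_event (l : nat) (x y : 'I_k -> R) : set Omega :=
  [set w | forall j, x j < M j w /\ ((j < l)%N -> M j w <= y j)].

Lemma measurable_lt_event (c : R) j : measurable [set w | c < M j w].
Proof.
by have := measurable_fun_ltr (measurable_cst c) (mM j) measurableT (Y := [set true]) I; rewrite setTI.
Qed.

Lemma measurable_mixed_event l x y : measurable (mixed_event l x y).
Proof.
apply: measurable_forall => j; apply: measurableI; first exact: measurable_lt_event.
have [jl|jl] := boolP (j < l)%N; last first.
  by rewrite [X in measurable X](_ : _ = setT)//; apply/seteqP; split.
rewrite [X in measurable X](_ : _ = ~` [set w | y j < M j w]); first exact/measurableC/measurable_lt_event.
apply/seteqP; split => w /=; first by move=> /(_ isT); rewrite leNgt => /negP.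
by move=> /negP; rewrite -leNgt.
Qed.

(** Imposing [M o <= y o] removes the event with the lower bound raised to [y o]; [Num.max] covers
    [y o < x o], where everything is removed. *)
Lemma mixed_event_step (o : 'I_k) x y :
  fine (P (mixed_event o.+1 x y)) = fine (P (mixed_event o x y)) -
  fine (P (mixed_event o (fun j => if j == o then Num.max (x j) (y j) else x j) y)).
Proof.
set x' := fun j => _.
have x'E : mixed_event o x' y = mixed_event o x y `&` [set w | y o < M o w].
  apply/seteqP; split => w /=.
    move=> h; split; last by have [] := h o; rewrite /x' eqxx gt_max => /andP[].
    move=> j; have [h1 h2] := h j; split => //; move: h1; rewrite /x'.
    by case: eqP => // _; rewrite gt_max => /andP[].
  move=> [h yo] j; have [h1 h2] := h j; split => //; rewrite /x'.
  by case: eqP => // ->; rewrite gt_max yo andbT; have [] := h o.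
have -> : mixed_event o.+1 x y = mixed_event o x y `\` mixed_event o x' y.
  rewrite x'E; apply/seteqP; split => w /=.
    move=> h; split=> [j|[_]]; last by have [_ /(_ (leqnn _))] := h o; rewrite leNgt => /negP.
    by have [h1 h2] := h j; split => // jo; apply: h2; exact: ltnW.
  move=> [h no] j; have [h1 h2] := h j; split => //; rewrite ltnS leq_eqVlt => /orP[/eqP/val_inj ->|//].
  by rewrite leNgt; apply/negP => yo; apply: no.
have m1 := measurable_mixed_event o x y; have m2 := measurable_mixed_event o x' y.
have sub : mixed_event o x' y `<=` mixed_event o x y by rewrite x'E => w [].
rewrite measureD//; last by rewrite ltey_eq fin_num_measure.
by rewrite setIidr// fineB// fin_num_measure.
Qed.

Lemma box_mixed_event x y : [set w | box x y (M ^~ w)] = mixed_event k x y.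
Proof.
apply/seteqP; split => w /= h j; first by have /andP[h1 h2] := h j.
by have [h1 /(_ (ltn_ord j)) h2] := h j; rewrite h1.
Qed.

Lemma survival_mixed_event x y : [set w | forall j, x j < M j w] = mixed_event 0 x y.
Proof. by apply/seteqP; split => w /= h j; [split|have [] := h j]. Qed.

Lemma measurable_box_event x y : measurable [set w | box x y (M ^~ w)].
Proof. by rewrite box_mixed_event; exact: measurable_mixed_event. Qed.

Lemma box_indic x y w : \1_(box x y) (M ^~ w) = \1_[set w | box x y (M ^~ w)] w :> R.
Proof. by rewrite !indicE; congr (_%:R); congr nat_of_bool; apply/idP/idP; rewrite !inE. Qed.

Lemma Rintegral_box x y : P.-integrable setT (EFin \o (fun w => \1_(box x y) (M ^~ w))) /\
  \int[P]_w \1_(box x y) (M ^~ w) = fine (P [set w | box x y (M ^~ w)]).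
Proof.
have mb := measurable_box_event x y.
rewrite (_ : (fun w => \1_(box x y) (M ^~ w)) = \1_[set w | box x y (M ^~ w)]); last first.
  by apply/funext => w; exact: box_indic.
split; first exact: integrable_indic.
rewrite (eq_RintegralT _ (box_indic x y)) /Rintegral; congr fine.
by have := integral_indic P measurableT mb; rewrite setIT.
Qed.

Variables (f : 'rV[R]_k -> R) (B : R).
Hypotheses (cf : continuous f) (fB : forall v, `|f v| <= B).

Let cube m : set ('I_k -> R) := box (fun=> - m.+1%:R) (fun=> m.+1%:R).

Lemma in_cube w : \forall m \near \oo, cube m (M ^~ w).
Proof.
suff : \forall m \near \oo, forall j, `|M j w| < m.+1%:R.
  apply: filterS => m h j; have := h j; rewrite ltr_norml => /andP[-> h2].
  exact: ltW.
exists (\max_j Num.trunc `|M j w|)%N => // m /= hm j.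
apply: (lt_le_trans (truncnS_gt _)); rewrite ler_nat ltnS.
by apply: leq_trans hm; exact: (leq_bigmax j).
Qed.

Lemma cube_cvg w : 1 - \1_(cube m) (M ^~ w) @[m --> \oo] --> (0 : R).
Proof.
apply: (@cvg_trans _ ((fun=> 0 : R) m @[m --> \oo])); last exact: cvg_cst.
apply: near_eq_cvg; apply: filterS (in_cube w) => m h.
by rewrite indicE mem_set// subrr.
Qed.

(** A pointwise limit of the step functions of [grid_approx], since each sample point eventually
    lies in the cube. *)
Lemma measurable_row_comp : measurable_fun setT (fun w => f (\row_j M j w)).
Proof.
have h m : exists F : Omega -> R, measurable_fun setT F /\ forall w,
    `|f (\row_j M j w) - F w| <= m.+1%:R^-1 + B * (1 - \1_(cube m) (M ^~ w)).
  have [I [c [x [y hxy]]]] := grid_approx cf fB m.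
  exists (fun w => \sum_i c i * \1_(box (x i) (y i)) (M ^~ w)); split => [|w]; last exact: hxy.
  apply: measurable_sum => i; apply: measurable_funM => //.
  by have [/integrableP[/measurable_EFinP]] := Rintegral_box (x i) (y i).
have [F hF] := choice h.
apply: (@measurable_fun_cvg _ _ _ setT F) => [m|w _]; first by have [] := hF m.
apply/cvgrPdist_le => eps eps0.
have hc : m.+1%:R^-1 + B * (1 - \1_(cube m) (M ^~ w)) @[m --> \oo] --> 0 + B * 0.
  by apply: cvgD; [exact: cvg_harmonic|apply: cvgM; [exact: cvg_cst|exact: cube_cvg]].
rewrite mulr0 addr0 in hc.
move/cvgr0_norm_le : hc => /(_ _ eps0); apply: filterS => m; apply: le_trans.
by have [_ /(_ w)] := hF m; move=> h1; apply: le_trans h1 (ler_norm _).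
Qed.

Lemma integrable_row_comp : P.-integrable setT (EFin \o (fun w => f (\row_j M j w))).
Proof.
apply: (@integrable_le _ _ _ P _ (fun=> B)); first exact: measurable_row_comp.
  by move=> w; exact: fB.
exact: finite_measure_integrable_cst.
Qed.

Lemma grid_approx_integral m (I : finType) (c : I -> R) (x y : I -> 'I_k -> R) :
  (forall v : 'I_k -> R, `|f (\row_j v j) - \sum_i c i * \1_(box (x i) (y i)) v| <=
     m.+1%:R^-1 + B * (1 - \1_(cube m) v)) ->
  `|\int[P]_w f (\row_j M j w) - \sum_i c i * fine (P [set w | box (x i) (y i) (M ^~ w)])| <=
  m.+1%:R^-1 + B * (1 - fine (P [set w | cube m (M ^~ w)])).
Proof.
move=> h.
have i1 i := RintegralZ (c i) (Rintegral_box (x i) (y i)).1.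
have [i2 e2] := Rintegral_sum (index_enum I) i1.
have -> : \sum_i c i * fine (P [set w | box (x i) (y i) (M ^~ w)]) =
    \int[P]_w \sum_i c i * \1_(box (x i) (y i)) (M ^~ w).
  rewrite e2; apply: eq_bigr => i _; have [j1 <-] := Rintegral_box (x i) (y i).
  by rewrite RintegralZl.
have i3 := integrable_row_comp.
rewrite -RintegralB//.
have i4 : P.-integrable setT (EFin \o (fun w => f (\row_j M j w) - \sum_i c i * \1_(box (x i) (y i)) (M ^~ w))).
  rewrite (_ : _ \o _ = fun w => ((f (\row_j M j w))%:E - (\sum_i c i * \1_(box (x i) (y i)) (M ^~ w))%:E)%E)//.
  exact: (integrableB measurableT i3 i2).
apply: le_trans (le_normr_Rintegral measurableT i4) _.
have [i5 e5] := Rintegral_box (fun=> - m.+1%:R) (fun=> m.+1%:R).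
have one : P.-integrable setT (EFin \o (fun=> 1 : R)) by exact: finite_measure_integrable_cst.
have i6 : P.-integrable setT (EFin \o (fun w => 1 - \1_(cube m) (M ^~ w))).
  rewrite (_ : _ \o _ = fun w => ((1:R)%:E - (\1_(cube m) (M ^~ w))%:E)%E)//.
  exact: (integrableB measurableT one i5).
have i7 := RintegralZ B i6.
have i8 : P.-integrable setT (EFin \o (fun=> m.+1%:R^-1 : R)) by exact: finite_measure_integrable_cst.
have e1 c0 : \int[P]_w c0 = c0.
  by rewrite Rintegral_cst//= -[fine _]/(fine (P setT)) probability_setT mulr1.
have -> : m.+1%:R^-1 + B * (1 - fine (P [set w | cube m (M ^~ w)])) =
    \int[P]_w (m.+1%:R^-1 + B * (1 - \1_(cube m) (M ^~ w))).
  by rewrite RintegralD// RintegralZl// RintegralB// !e1 e5.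
apply: le_Rintegral => //; first exact: (integrable_norm i4).
  rewrite (_ : _ \o _ = fun w => ((m.+1%:R^-1)%:E + (B * (1 - \1_(cube m) (M ^~ w)))%:E)%E)//.
  exact: (integrableD measurableT i8 i7).
Qed.

Lemma cube_prob_cvg : 1 - fine (P [set w | cube m (M ^~ w)]) @[m --> \oo] --> (0 : R).
Proof.
have one : P.-integrable setT (EFin \o (fun=> 1 : R)) by exact: finite_measure_integrable_cst.
have e m : 1 - fine (P [set w | cube m (M ^~ w)]) = \int[P]_w (1 - \1_(cube m) (M ^~ w)).
  have [i5 <-] := Rintegral_box (fun=> - m.+1%:R) (fun=> m.+1%:R).
  by rewrite RintegralB// Rintegral_cst//= -[fine _]/(fine (P setT)) probability_setT mulr1.
have -> : (0 : R) = \int[P]_w (0 : R) by rewrite Rintegral_cst// mul0r.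
under eq_fun do rewrite e.
apply: (@Rdominated_cvg _ _ _ P _ _ (fun=> 1)) => //.
- move=> m; apply: measurable_funB => //.
  by have [/integrableP[/measurable_EFinP]] := Rintegral_box (fun=> - m.+1%:R) (fun=> m.+1%:R).
- exact: cube_cvg.
- by move=> m w; rewrite indicE; case: (_ \in _); rewrite ?subrr ?subr0 ?normr0 ?normr1.
Qed.

End box_probability.

(** Tightness comes for free: the cube is itself a box, so its probability under [P] converges, and
    the mass outside it is controlled by the limit law. *)
Lemma survival_cvg d (Omega : measurableType d) d' (Omega' : measurableType d') (R : realType)
    (P : probability Omega R) (P' : probability Omega' R) (k : nat)
    (M : nat -> 'I_k -> Omega -> R) (M' : 'I_k -> Omega' -> R) (f : 'rV[R]_k -> R) (B : R) :
  (forall n j, measurable_fun setT (M n j)) -> (forall j, measurable_fun setT (M' j)) ->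
  (forall x : 'I_k -> R, fine (P [set w | forall j, x j < M n j w]) @[n --> \oo] -->
     fine (P' [set w | forall j, x j < M' j w])) ->
  continuous f -> (forall v, `|f v| <= B) ->
  \int[P]_w f (\row_j M n j w) @[n --> \oo] --> \int[P']_w f (\row_j M' j w).
Proof.
move=> mM mM' surv cf fB.
have mixed l : (l <= k)%N -> forall x y, fine (P (mixed_event (M n) l x y)) @[n --> \oo] -->
    fine (P' (mixed_event M' l x y)).
  elim: l => [_ x y|l IH lk x y].
    rewrite -survival_mixed_event; under eq_fun do rewrite -survival_mixed_event; exact: surv.
  have e1 n := @mixed_event_step _ _ _ P _ (M n) (mM n) (Ordinal lk) x y.
  have e2 := @mixed_event_step _ _ _ P' _ M' mM' (Ordinal lk) x y.
  rewrite [X in _ --> X]e2; under eq_fun do rewrite e1.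
  by apply: cvgB; apply: IH; exact: ltnW.
have boxc x y : fine (P [set w | box x y (M n ^~ w)]) @[n --> \oo] -->
    fine (P' [set w | box x y (M' ^~ w)]).
  rewrite box_mixed_event; under eq_fun do rewrite box_mixed_event; exact: mixed.
apply/cvgrPdist_le => eps eps0.
pose p' m := fine (P' [set w | box (fun=> - m.+1%:R) (fun=> m.+1%:R) (M' ^~ w)]).
pose p n m := fine (P [set w | box (fun=> - m.+1%:R) (fun=> m.+1%:R) (M n ^~ w)]).
(* One quarter for the step approximation of the limit, one for the box probabilities, and two for
   the approximation along the sequence, whose bound contains the probability of the cube at [n]. *)
have eps4 : 0 < eps / 4 by rewrite divr_gt0.
have hc : m.+1%:R^-1 + B * (1 - p' m) @[m --> \oo] --> 0 + B * 0.
  by apply: cvgD; [exact: cvg_harmonic|apply: cvgM; [exact: cvg_cst|exact: cube_prob_cvg]].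
rewrite mulr0 addr0 in hc.
move/cvgr0_norm_le : hc => /(_ _ eps4)[m _ /(_ m (leqnn m)) /= hm].
have {}hm := le_trans (ler_norm _) hm.
have [I [c [x [y hxy]]]] := grid_approx cf fB m.
have h' := grid_approx_integral P' mM' cf fB hxy.
have hn n := grid_approx_integral P (mM n) cf fB hxy.
have c1 : \sum_i c i * fine (P [set w | box (x i) (y i) (M n ^~ w)]) @[n --> \oo] -->
    \sum_i c i * fine (P' [set w | box (x i) (y i) (M' ^~ w)]).
  by apply: cvg_big => [|i _]; [exact: add_continuous|apply: cvgM; [exact: cvg_cst|exact: boxc]].
have c2 : B * p n m @[n --> \oo] --> B * p' m by apply: cvgM; [exact: cvg_cst|exact: boxc].
move/cvgrPdist_le : c1 => /(_ _ eps4) c1; move/cvgrPdist_le : c2 => /(_ _ eps4) c2.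
apply: filterS2 c1 c2 => n h1 h2.
have := hn n; rewrite -/(p n m); move: h' h1 h2; rewrite -/(p' m).
set a' := \int[P']_w _; set a := \int[P]_w _; set b' := \sum_i _ * fine (P' _); set b := \sum_i _ * _.
have final (q u v a1 a2 b1 b2 : R) : q + (B - u) <= eps / 4 -> `|a2 - b2| <= q + (B - u) ->
    `|b2 - b1| <= eps / 4 -> `|u - v| <= eps / 4 -> `|a1 - b1| <= q + (B - v) -> `|a2 - a1| <= eps.
  rewrite !ler_norml => h0 /andP[? ?] /andP[? ?] /andP[? ?] /andP[? ?]; apply/andP; split; lra.
move=> k1 k2 k3 k4; apply: (final m.+1%:R^-1 (B * p' m) (B * p n m) a a' b b') => //.
- by move: hm; rewrite mulrBr mulr1.
- by move: k1; rewrite mulrBr mulr1.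
- by move: k4; rewrite mulrBr mulr1.
Qed.

Lemma measurable_array_min d (Omega : measurableType d) (R : realType)
    (X : nat -> nat -> R -> Omega -> R) n t :
  (forall i, measurable_fun setT (X n i t)) -> measurable_fun setT (array_min X n t).
Proof.
move=> mX; have mv i : measurable_fun setT (fun w => norming n * `|X n i t w|).
  apply: measurable_funM => //; apply: measurableT_comp (mX i); exact: normr_measurable.
rewrite /array_min /row_min; elim: (index_enum 'I_n) => [|i s IH].
  by under eq_fun do rewrite big_nil; exact: mv.
by under eq_fun do rewrite big_cons; exact: measurable_minr.
Qed.

Theorem theorem5p2 (R : realType)
  (d0 : measure_display) (O0 : measurableType d0) (P0 : probability O0 R)
  (S : R -> {RV P0 >-> R}) (kappa : R)
  (d : measure_display) (Omega : measurableType d) (P : probability Omega R)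
  (Y Sn : nat -> nat -> R -> {RV P >-> R}) (rho : nat -> R -> R -> R)
  (d' : measure_display) (Omega' : measurableType d')
  (P' : probability Omega' R)
  (Upsilon : nat -> {RV P' >-> R}) (S' Z : nat -> R -> {RV P' >-> R})
  (Gamma : R -> R -> R) :
  0 < kappa ->
  (forall t, {ae P0, forall w, kappa < S t w}) ->
  (forall n i, (i < n)%N ->
    [/\ gaussian_process (Y n i), mean_zero (Y n i), unit_variance (Y n i) &
        correlation_function (Y n i) (rho n)]) ->
  (forall n i, (i < n)%N -> same_law S (Sn n i)) ->
  mutually_independent P triangle (fun ni => sigma_process (Y ni.1 ni.2)) ->
  mutually_independent P triangle (fun ni => sigma_process (Sn ni.1 ni.2)) ->
  mutually_independent P [set: 'I_2] (tnth
    [tuple sigma_join triangle (fun ni => sigma_process (Y ni.1 ni.2));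
           sigma_join triangle (fun ni => sigma_process (Sn ni.1 ni.2))]) ->
  (forall t1 t2, t1 != t2 ->
    0 < Gamma t1 t2 /\
    2 * norming n ^+ 2 * (1 - rho n t1 t2) @[n --> \oo] --> Gamma t1 t2) ->
  poisson_points lebesgue_measure Upsilon ->
  (forall i, same_law S (S' i)) ->
  mutually_independent P' [set: nat] (fun i => sigma_process (S' i)) ->
  (forall i, [/\ gaussian_process (Z i), mean_zero (Z i) &
                 incremental_variance (Z i) Gamma]) ->
  (forall i j, same_law (Z i) (Z j)) ->
  mutually_independent P' [set: nat] (fun i => sigma_process (Z i)) ->
  mutually_independent P' [set: 'I_3] (tnth
    [tuple sigma_process Upsilon;
           sigma_join [set: nat] (fun i => sigma_process (S' i));
           sigma_join [set: nat] (fun i => sigma_process (Z i))]) ->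
  (* the infimum defining zeta is a minimum *)
  (forall t, {ae P', forall w, exists i, forall j,
     zeta_term Upsilon S' Z t w i <= zeta_term Upsilon S' Z t w j}) /\
  fdd_cvg P P' (array_min (fun n i t w => Sn n i t w * Y n i t w))
    (zeta Upsilon S' Z).
Proof.
move=> kappa0 S_kappa Y_law Sn_law indY indS indYS cvg_rho poisson_U S'_law indS' Z_law Z_same indZ ind3.
split=> [t|k t f cf [B fB]].
  exact: (ae_zeta_attained kappa0 S_kappa poisson_U S'_law indS' Z_same indZ ind3).
set X := fun n i t w => Sn n i t w * Y n i t w.
have mX n i s : measurable_fun setT (X n i s).
  have mS : measurable_fun setT (Sn n i s) by [].
  have mY : measurable_fun setT (Y n i s) by [].
  exact: measurable_funM.
have mM n j : measurable_fun setT (array_min X n.+1 (t j)) by exact: measurable_array_min.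
have mM' j : measurable_fun setT (zeta Upsilon S' Z (t j)) by exact: measurable_zeta.
have E1 n : 'E_P[fun w => f (\row_(j < k) array_min X n.+1 (t j) w)]%E =
    (\int[P]_w f (\row_(j < k) array_min X n.+1 (t j) w))%:E.
  rewrite unlock -EFin_Rintegral//.
  exact: (integrable_row_comp P (M := fun j => array_min X n.+1 (t j)) _ cf fB).
have E2 : 'E_P'[fun w => f (\row_(j < k) zeta Upsilon S' Z (t j) w)]%E =
    (\int[P']_w f (\row_(j < k) zeta Upsilon S' Z (t j) w))%:E.
  rewrite unlock -EFin_Rintegral//.
  exact: (integrable_row_comp P' (M := fun j => zeta Upsilon S' Z (t j)) _ cf fB).
(* Row 0 is empty and its minimum is a default value, so the sequence starts at [n.+1]. *)
rewrite -cvg_shiftS E2; under eq_fun do rewrite E1.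
apply: cvg_EFin; first exact: nearW.
apply: (survival_cvg (M := fun n j => array_min X n.+1 (t j))
  (M' := fun j => zeta Upsilon S' Z (t j)) _ _ _ cf fB) => //.
move=> x.
rewrite (zeta_survival kappa0 S_kappa poisson_U S'_law indS' Z_same indZ ind3 t x).
apply: (cvg_array_survival kappa0 Y_law Sn_law indY indS indYS cvg_rho (Z_law 0%N) S_kappa).
Qed.
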